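(* Let $q>\frac{2s}{s-2}$ and $\tilde q>\tilde q_*(q):=\frac{2s}{s-2}+\frac{2s\,q}{q(s-2)-2s}$. Let $f\in W^{-1,s}(\Omega)$ and $f_D\in W^{1-1/s,s}(\tilde\Gamma)$. Let $F:W^{1,2}(\Omega)\to\mathbb{R}$ be twice continuously Fréchet differentiable and assume that $F'(y)\in W^{-1,2}(\Omega)$ and $F''(y)\in\mathcal{L}(W^{1,2}_{\tilde\Gamma}(\Omega),W^{-1,2}(\Omega))$ for all $y\in W^{1,2}(\Omega)$, with $F'$ and $F''$ Lipschitz continuous on $W^{1,2}(\Omega)$. Then $j:=F\circ S:(U_{\mathrm{ad}},\|\cdot\|_{L^{\tilde q}(\Omega)})\to\mathbb{R}$ is twice Fréchet differentiable on $U_{\mathrm{ad}}$ for feasible variations. More precisely, for $u\in U_{\mathrm{ad}}$, let $y:=S(u)$, $p:=S_p(y,u)$, $z_{u,\phi}:=S'(u)[\phi]$, $z_{u,\psi}:=S'(u)[\psi]$, $z_{u,\phi,\psi}:=S''(u)[\phi,\psi]$. Then for all $\phi,\psi\in U_{\mathrm{ad}}-u$, $$j'(u)[\phi]=\langle F'(y),z_{u,\phi}\rangle_{W^{-1,2},W^{1,2}_{\tilde\Gamma}}=\int_\Omega\phi\,\nabla y\cdot\nabla p\,dx$$ and $$j''(u)[\phi,\psi]=\langle F''(y)z_{u,\psi},z_{u,\phi}\rangle_{W^{-1,2},W^{1,2}_{\tilde\Gamma}}+\int_\Omega\psi\,\nabla z_{u,\phi}\cdot\nabla p\,dx+\int_\Omega\phi\,\nabla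 z_{u,\psi}\cdot\nabla p\,dx .$$ Moreover, $$\lim_{\substack{\eta\to0\\ u+\eta\in U_{\mathrm{ad}}}}\frac{\big|j(u+\eta)-j(u)-j'(u)[\eta]-\tfrac12 j''(u)[\eta,\eta]\big|}{\|\eta\|_{L^{\tilde q}(\Omega)}^2}=0,$$ and the bilinear map $j''(u):L^{\tilde q}(\Omega)\times L^{\tilde q}(\Omega)\to\mathbb{R}$ is bounded.
   Context: Setting. $\Omega\subset\mathbb{R}^d$, $d\ge2$, is a bounded domain with Lipschitz boundary of class $C^{1,\alpha}$; $\tilde\Gamma,\Gamma\subset\partial\Omega$ (Dirichlet and Neumann part of the boundary) are nonempty, closed and of positive surface measure. The set $\Omega\cup\Gamma$ is regular in the sense of Gröger: a bounded set $G\subset\mathbb{R}^d$ is regular if for each $x\in\partial G$ there are an open neighbourhood $U$ of $x$ and a bi-Lipschitz map $\Phi$ from $U$ onto an open subset of $\mathbb{R}^d$ with $\Phi(x)=0$ such that $\Phi(U\cap G)$ is one of $E_1=\{|z|<1,z_d<0\}$, $E_2=\{|z|<1,z_d\le0\}$, $E_3=\{z\in E_2: z_d<0\text{ or }z_1>0\}$. Spaces. $W^{1,p}_{\tilde\Gamma}(\Omega)$ is the closed subspace of $W^{1,p}(\Omega)$ of functions with vanishing trace on $\tilde\Gamma$; $W^{-1,p}(\Omega)$ is the dual of $W^{1,p'}_{\tilde\Gamma}(\Omega)$, $p'=p/(p-1)$. $0<u_\ell\le u_u$ are fixed scalars and $U_{\mathrm{ad}}=\{u\in BV(\Omega): u_\ell\le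 u(x)\le u_u\text{ for a.e. }x\in\Omega\}$. Dirichlet lift. The boundary setting is such that for every $p>1$ and $f_D\in W^{1-1/p,p}(\tilde\Gamma)$ the problem $-\Delta w=0$ in $\Omega$, $w=f_D$ on $\tilde\Gamma$, $\nabla w\cdot\nu=0$ on $\Gamma$ has a unique solution $\tilde f_D\in W^{1,p}(\Omega)$, with $\|\tilde f_D\|_{W^{1,p}}\le C(p)\|f_D\|_{W^{1-1/p,p}(\tilde\Gamma)}$. Control-to-state operator. For $u\in U_{\mathrm{ad}}$, $S(u)$ is the unique $y\in W^{1,2}(\Omega)$ with $y-\tilde f_D\in W^{1,2}_{\tilde\Gamma}(\Omega)$ and $\int_\Omega u\nabla y\cdot\nabla v\,dx=\langle f,v\rangle$ for all $v\in W^{1,2}_{\tilde\Gamma}(\Omega)$. The exponent $s$. $s>2$ is a fixed exponent (it exists by Gröger's regularity theory) such that for every $\sigma\in[2,s]$ there is $C(\sigma)\ge0$ such that for all $f\in W^{-1,\sigma}(\Omega)$, $f_D\in W^{1-1/\sigma,\sigma}(\tilde\Gamma)$, $u\in U_{\mathrm{ad}}$: $\|S(u)\|_{W^{1,\sigma}}\le C(\sigma)(\|f_D\|_{W^{1-1/\sigma,\sigma}(\tilde\Gamma)}+\|f\|_{W^{-1,\sigma}})$. Derivatives of $S$. With $y=S(u)$, $z_{u,\phi}=S'(u)[\phi]\in W^{1,2}_{\tilde\Gamma}(\Omega)$ is the unique solution of $\int_\Omega u\nabla z_{u,\phi}\cdot\nabla v\,dx=-\int_\Omega\phi\nabla y\cdot\nabla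 v\,dx$ for all $v\in W^{1,2}_{\tilde\Gamma}(\Omega)$, and $z_{u,\phi,\psi}=S''(u)[\phi,\psi]\in W^{1,2}_{\tilde\Gamma}(\Omega)$ is the unique solution of $\int_\Omega u\nabla z_{u,\phi,\psi}\cdot\nabla v\,dx=-\int_\Omega\psi\nabla z_{u,\phi}\cdot\nabla v\,dx-\int_\Omega\phi\nabla z_{u,\psi}\cdot\nabla v\,dx$ for all $v\in W^{1,2}_{\tilde\Gamma}(\Omega)$. Adjoint. $F'(y)$ is regarded as an element of $W^{-1,2}(\Omega)$ (acting on $W^{1,2}_{\tilde\Gamma}(\Omega)$). $S_p(y,u)$ is the unique $p\in W^{1,2}_{\tilde\Gamma}(\Omega)$ with $\int_\Omega u\nabla p\cdot\nabla v\,dx=-\langle F'(y),v\rangle$ for all $v\in W^{1,2}_{\tilde\Gamma}(\Omega)$. Differentiability ''for feasible variations'' means that all difference quotients / remainders are taken only along increments $\eta$ with $u+\eta\in U_{\mathrm{ad}}$, with the derivatives being bounded (multi)linear maps with respect to the indicated norm. *)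

(* Defs.v *)
From HB Require Import structures.
From mathcomp Require Import all_boot all_order all_algebra.
From mathcomp Require Import all_classical all_reals all_analysis.
Set Implicit Arguments.
Unset Strict Implicit.
Unset Printing Implicit Defensive.
Import Order.TTheory GRing.Theory Num.Theory.
Import numFieldNormedType.Exports.
Local Open Scope classical_set_scope.
Local Open Scope ring_scope.

Section euclidean.
Context {R : realType} {m : nat}.
Implicit Types x y : 'rV[R]_m.

Definition edot x y : R := \sum_(i < m) x 0 i * y 0 i.

(* The library norm of ['rV[R]_m] is the maximum norm; this one is Euclidean. *)
Definition enorm x : R := Num.sqrt (edot x x).

Definition eball x (r : R) : set 'rV[R]_m := [set y | enorm (y - x) < r].

Definition ebounded (A : set 'rV[R]_m) : Prop :=
  exists M : R, forall x, A x -> enorm x <= M.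

Definition bdry (A : set 'rV[R]_m) : set 'rV[R]_m := closure A `\` interior A.

Definition pderiv (i : 'I_m) (f : 'rV[R]_m -> R) : 'rV[R]_m -> R :=
  fun x => 'D_(delta_mx 0 i) f x.

Definition egrad (f : 'rV[R]_m -> R) : 'rV[R]_m -> 'rV[R]_m :=
  fun x => \row_i pderiv i f x.

Definition C1 (f : 'rV[R]_m -> R) : Prop :=
  continuous f /\
  forall i : 'I_m, (forall x, derivable f x (delta_mx 0 i)) /\
                   continuous (pderiv i f).

Definition Cinfty (f : 'rV[R]_m -> R) : Prop :=
  forall s : seq 'I_m, C1 (foldr pderiv f s).

Definition compact_support_in (A : set 'rV[R]_m) (f : 'rV[R]_m -> R) : Prop :=
  exists K : set 'rV[R]_m,
    [/\ compact K, K `<=` A & forall x, ~ K x -> f x = 0].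

Definition C1alpha (alpha : R) (f : 'rV[R]_m -> R) : Prop :=
  C1 f /\ exists L : R, forall (i : 'I_m) x y,
    `|pderiv i f x - pderiv i f y| <= L * (enorm (x - y)) `^ alpha.

End euclidean.

Section outer_measures.
Context {R : realType}.
Local Open Scope ereal_scope.

Definition cover_outer {T : Type} (zeta : set T -> \bar R) (A : set T) : \bar R :=
  ereal_inf [set \sum_(k <oo) zeta (F k) |
             F in [set F : (set T)^nat | A `<=` \bigcup_k F k]].

Section cover_outer_theory.
Context {T : pointedType} (zeta : set T -> \bar R).
Hypothesis zeta0 : zeta set0 = 0.
Hypothesis zeta_ge0 : forall A, 0 <= zeta A.

(* [mu_ext] on the discrete sigma-algebra, so that its theory applies. *)
Lemma cover_outerE (A : set T) :
  cover_outer zeta A =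
  mu_ext (zeta : set (g_sigma_algebraType [set: set T]) -> \bar R) A.
Proof.
rewrite /cover_outer /mu_ext; congr (ereal_inf _).
apply/seteqP; split => [_ [F AF <-]|_ [F [_ AF] <-]]; exists F => //.
by split => // i; exact: sub_sigma_algebra.
Qed.

Lemma cover_outer0 : cover_outer zeta set0 = 0.
Proof. by rewrite cover_outerE; exact: mu_ext0. Qed.

Lemma cover_outer_ge0 A : 0 <= cover_outer zeta A.
Proof. by rewrite cover_outerE; exact: mu_ext_ge0. Qed.

Lemma le_cover_outer A B : A `<=` B -> cover_outer zeta A <= cover_outer zeta B.
Proof. by move=> AB; rewrite !cover_outerE; exact: le_mu_ext. Qed.

Lemma cover_outer_sigma_subadditive : sigma_subadditive (cover_outer zeta).
Proof.
move=> F; rewrite cover_outerE.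
under eq_eseriesr do rewrite cover_outerE.
exact: (@mu_ext_sigma_subadditive _
  (g_sigma_algebraType [set: set T]) R zeta).
Qed.

End cover_outer_theory.

Context {n : nat}.
Implicit Types A : set 'rV[R]_n.+1.

Definition box_gauge A : \bar R :=
  ereal_inf [set (\prod_(i < n.+1) (p.2 0 i - p.1 0 i)%R)%:E |
    p in [set p : 'rV[R]_n.+1 * 'rV[R]_n.+1 |
      (forall i, p.1 0 i <= p.2 0 i)%R /\
      A `<=` [set x | forall i, p.1 0 i < x 0 i < p.2 0 i]%R]].

Definition leb_outer A : \bar R := cover_outer box_gauge A.

Definition ediam A : \bar R :=
  ereal_sup [set (enorm (x.1 - x.2))%:E | x in A `*` A].

Definition haus_gauge (k : nat) (delta : R) A : \bar R :=
  if A == set0 then 0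
  else if ediam A <= delta%:E then (ediam A) `^ k%:R else +oo.

(* [k]-dimensional Hausdorff measure, without the usual normalising factor.
   For [k = n] it is a constant multiple of the surface measure. *)
Definition haus_outer (k : nat) A : \bar R :=
  ereal_sup [set cover_outer (haus_gauge k delta) A |
             delta in [set delta : R | 0 < delta]%R].


Lemma box_gauge_ge0 A : 0 <= box_gauge A.
Proof.
apply: le_ereal_inf_tmp => _ [p [p12 _] <-].
by rewrite lee_fin prodr_ge0// => i _; rewrite subr_ge0.
Qed.

Lemma box_gauge0 : box_gauge set0 = 0.
Proof.
apply/eqP; rewrite eq_le box_gauge_ge0 andbT; apply: ereal_inf_lbound.
exists (0, 0)%R => /=; first by split => // x.
by rewrite big_ord_recl !mxE subrr mul0r.
Qed.

HB.instance Definition _ := isOuterMeasure.Build R 'rV[R]_n.+1 leb_outer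
  (cover_outer0 box_gauge0 box_gauge_ge0)
  (cover_outer_ge0 box_gauge_ge0)
  (@le_cover_outer _ box_gauge)
  (cover_outer_sigma_subadditive box_gauge_ge0).

Section hausdorff.
Variable k : nat.

Lemma haus_gauge_ge0 delta A : 0 <= haus_gauge k delta A.
Proof.
rewrite /haus_gauge; case: ifPn => // _; case: ifPn => // _.
exact: poweR_ge0.
Qed.

Lemma haus_gauge0 delta : haus_gauge k delta set0 = 0.
Proof. by rewrite /haus_gauge eqxx. Qed.

Lemma haus_outer0 : haus_outer k set0 = 0.
Proof.
rewrite /haus_outer (_ : [set _ | _ in _] = [set 0]) ?ereal_sup1//.
apply/seteqP; split => [_ [delta _ <-]|_ ->].
  by rewrite /= cover_outer0//; [exact: haus_gauge0|exact: haus_gauge_ge0].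
exists 1%R => /=; first exact: ltr01.
by rewrite cover_outer0//; [exact: haus_gauge0|exact: haus_gauge_ge0].
Qed.

Lemma haus_outer_ge0 A : 0 <= haus_outer k A.
Proof.
apply: (@le_trans _ _ (cover_outer (haus_gauge k 1) A)).
  by apply: cover_outer_ge0 => B; exact: haus_gauge_ge0.
by apply: ereal_sup_ubound; exists 1%R => //=; exact: ltr01.
Qed.

Lemma le_haus_outer : {homo haus_outer k : A B / A `<=` B >-> A <= B}.
Proof.
move=> A B AB; apply: ge_ereal_sup => _ [delta d0 <-].
apply: (le_trans (le_cover_outer _ AB)).
by apply: ereal_sup_ubound; exists delta.
Qed.

Lemma haus_outer_sigma_subadditive : sigma_subadditive (haus_outer k).
Proof.
move=> F; apply: ge_ereal_sup => _ [delta d0 <-].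
apply: (le_trans (cover_outer_sigma_subadditive (haus_gauge_ge0 delta) F)).
apply: lee_nneseries => i _.
  by move=> _; apply: cover_outer_ge0; exact: haus_gauge_ge0.
by apply: ereal_sup_ubound; exists delta.
Qed.

HB.instance Definition _ := isOuterMeasure.Build R 'rV[R]_n.+1 (haus_outer k)
  haus_outer0 haus_outer_ge0 le_haus_outer haus_outer_sigma_subadditive.

End hausdorff.

End outer_measures.


Section measures.
Context (R : realType) (n : nat).

Definition leb_om : {outer_measure set 'rV[R]_n.+1 -> \bar R} :=
  (@leb_outer R n).

Definition haus_om : {outer_measure set 'rV[R]_n.+1 -> \bar R} :=
  (@haus_outer R n n).

Definition leb :
  {measure set (caratheodory_type leb_om) -> \bar R} := leb_om.

Definition surf :
  {measure set (caratheodory_type haus_om) -> \bar R} := haus_om.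

End measures.

Section sobolev.
Context {R : realType} {n : nat}.
Local Notation E := 'rV[R]_n.+1.
Variable Omega : set E.
Implicit Types (p : R) (u phi g : E -> R).

Definition eLp p phi : \bar R := 'N[leb R n]_p%:E[EFin \o (phi \_ Omega)].
Definition inLp p phi : Prop := (phi \_ Omega) \in Lfun (leb R n) p%:E.
Definition normLp p phi : R := fine (eLp p phi).

Definition int_Omega phi : R := \int[leb R n]_(x in Omega) phi x.

(* A Sobolev function is represented by the pair of the function and its weak
   gradient; weak gradients being unique up to null sets, this is the closed
   subspace of [L^p * (L^p)^d] with which [W^{1,p}] is usually identified.
   Elements are not quotiented by almost-everywhere equality. *)
Definition sob : lmodType R := ((E -> R^o) * (E -> E))%type.
Definition grad (w : sob) : E -> E := w.2.

Definition is_weak_grad (w : sob) : Prop :=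
  forall phi (i : 'I_n.+1), Cinfty phi -> compact_support_in Omega phi ->
    int_Omega (fun x => w.1 x * pderiv i phi x) =
    - int_Omega (fun x => grad w x 0 i * phi x).

Definition W1p p (w : sob) : Prop :=
  [/\ inLp p w.1, forall i, inLp p (fun x => grad w x 0 i) & is_weak_grad w].

(* One of the usual equivalent norms. The extended value avoids [fine +oo = 0]
   when membership in [W^{1,p}] is not known. *)
Definition eW1p p (w : sob) : \bar R :=
  (eLp p w.1 + \sum_(i < n.+1) eLp p (fun x => grad w x 0 i)%R)%E.
Definition normW1p p (w : sob) : R := fine (eW1p p w).

Definition sob_eq (w1 w2 : sob) : Prop :=
  {ae leb R n, forall x, Omega x -> w1.1 x = w2.1 x /\ grad w1 x = grad w2 x}.

(* Trace operator [W^{1,1}(Omega) -> L^1(bdry Omega)]: the continuous extension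
   of the restriction of [C^1] functions. On a bounded domain [W^{1,p}] is
   contained in [W^{1,1}] and its trace operator is the restriction. *)
Definition is_trace (w : sob) g : Prop :=
  measurable_fun (bdry Omega : set (caratheodory_type (haus_om R n))) g /\
  exists phi : nat -> E -> R,
    [/\ forall k, C1 (phi k),
        (fun k => eW1p 1 (w - (phi k, egrad (phi k)) : sob)) @ \oo --> 0%E
      & (fun k => \int[surf R n]_(x in bdry Omega) `|phi k x - g x|%:E)%E
          @ \oo --> 0%E].

Section dirichlet_part.
Variable Gt : set E.

Definition has_trace_on (w : sob) g : Prop :=
  exists g', is_trace w g' /\ {ae surf R n, forall x, Gt x -> g' x = g x}.

Definition W1p0 p (w : sob) : Prop := W1p p w /\ has_trace_on w (fun=> 0).

(* Sobolev-Slobodeckij norm of order [1 - 1/p] on the [n]-dimensional set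
   [Gt]; the exponent is [n + (1 - 1/p) * p]. *)
Definition eWbd p g : \bar R :=
  ((\int[surf R n]_(x in Gt) (`|g x| `^ p)%:E +
    \int[surf R n]_(x in Gt) \int[surf R n]_(y in Gt)
      (`|g x - g y| `^ p / (enorm (x - y)) `^ (n%:R + p - 1))%R%:E) `^ p^-1)%E.
Definition Wbd p g : Prop :=
  measurable_fun (Gt : set (caratheodory_type (haus_om R n))) g /\
  (eWbd p g < +oo)%E.
Definition normWbd p g : R := fine (eWbd p g).

Definition is_linear_on (V : sob -> Prop) (f : sob -> R) : Prop :=
  forall (a : R) v w, V v -> V w -> f (a *: v + w) = a * f v + f w.

(* The dual of [W1p0 (p / (p - 1))]; the values of [f] outside that space are
   irrelevant. *)
Definition Wm1p p (f : sob -> R) : Prop :=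
  is_linear_on (W1p0 (p / (p - 1))) f /\
  exists C : R, forall v, W1p0 (p / (p - 1)) v ->
    `|f v| <= C * normW1p (p / (p - 1)) v.
Definition normWm1p p (f : sob -> R) : R :=
  sup [set `|f v| | v in
        [set v | W1p0 (p / (p - 1)) v /\ normW1p (p / (p - 1)) v <= 1]].

Definition weak_form u (w v : sob) : R :=
  int_Omega (fun x => u x * edot (grad w x) (grad v x)).

(* Weak form of [- Delta w = 0] in [Omega], [w = fD] on [Gt], with homogeneous
   Neumann condition on the rest of the boundary. *)
Definition is_lift p (fD : E -> R) (w : sob) : Prop :=
  [/\ W1p p w, has_trace_on w fD
    & forall v, W1p0 (p / (p - 1)) v -> weak_form (fun=> 1) w v = 0].

Definition lift_wellposed : Prop :=
  forall p, 1 < p -> exists C : R, forall fD, Wbd p fD ->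
    exists w, [/\ is_lift p fD w,
                  forall w', is_lift p fD w' -> sob_eq w w'
                & normW1p p w <= C * normWbd p fD].

Definition is_state (f : sob -> R) (fD : E -> R) u (y : sob) : Prop :=
  [/\ W1p 2 y,
      exists w, is_lift 2 fD w /\ W1p0 2 (y - w)
    & forall v, W1p0 2 v -> weak_form u y v = f v].

Definition BV u : Prop :=
  inLp 1 u /\ exists M : R, forall phi : 'I_n.+1 -> E -> R,
    (forall i, C1 (phi i) /\ compact_support_in Omega (phi i)) ->
    (forall x, \sum_(i < n.+1) phi i x ^+ 2 <= 1) ->
    int_Omega (fun x => u x * \sum_(i < n.+1) pderiv i (phi i) x) <= M.

Variables ul uu : R.

Definition Uad u : Prop :=
  BV u /\ {ae leb R n, forall x, Omega x -> ul <= u x <= uu}.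

(* [S f fD] is the control-to-state operator for the data [f], [fD]; uniqueness
   is up to [sob_eq]. *)
Definition is_solution_operator (s : R)
    (S : (sob -> R) -> (E -> R) -> (E -> R) -> sob) : Prop :=
  forall (sigma : R) f fD u, 2 <= sigma <= s ->
    Wm1p sigma f -> Wbd sigma fD -> Uad u ->
    is_state f fD u (S f fD u) /\
    forall y, is_state f fD u y -> sob_eq y (S f fD u).

Definition is_groger_exponent (s : R)
    (S : (sob -> R) -> (E -> R) -> (E -> R) -> sob) : Prop :=
  forall sigma : R, 2 <= sigma <= s -> exists2 C : R, 0 <= C &
    forall f fD u, Wm1p sigma f -> Wbd sigma fD -> Uad u ->
      W1p sigma (S f fD u) /\
      normW1p sigma (S f fD u) <= C * (normWbd sigma fD + normWm1p sigma f).

(* [z] is [S'(u)[phi]], where [y] is the state for [u]. *)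
Definition is_dS u (y : sob) phi (z : sob) : Prop :=
  W1p0 2 z /\ forall v, W1p0 2 v -> weak_form u z v = - weak_form phi y v.

(* [q] is the adjoint state for the derivative [dFy] of [F] at the state. *)
Definition is_adjoint u (dFy : sob -> R) (q : sob) : Prop :=
  W1p0 2 q /\ forall v, W1p0 2 v -> weak_form u q v = - dFy v.

Section objective.
Variables (F : sob -> R) (dF : sob -> sob -> R) (d2F : sob -> sob -> sob -> R).
Local Notation H1 := (W1p 2).
Local Notation H1D := (W1p0 2).
Local Notation nH1 := (normW1p 2).

(* [d2F y h v] is the value at [v] of the functional [F''(y) h]. *)
Definition frechet_C2 : Prop :=
  (forall y, H1 y ->
     is_linear_on H1 (dF y) /\
     exists C : R, forall v, H1 v -> `|dF y v| <= C * nH1 v) /\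
  (forall y, H1 y ->
     [/\ forall h, H1 h -> is_linear_on H1 (d2F y h),
         forall v, H1 v -> is_linear_on H1 ((d2F y)^~ v)
       & exists C : R, forall h v, H1 h -> H1 v ->
           `|d2F y h v| <= C * nH1 h * nH1 v]) /\
  (forall y, H1 y -> forall e : R, 0 < e -> exists2 d : R, 0 < d &
     forall h, H1 h -> nH1 h < d ->
       `|F (y + h) - F y - dF y h| <= e * nH1 h) /\
  (forall y, H1 y -> forall e : R, 0 < e -> exists2 d : R, 0 < d &
     forall h, H1 h -> nH1 h < d -> forall v, H1 v ->
       `|dF (y + h) v - dF y v - d2F y h v| <= e * nH1 h * nH1 v) /\
  (forall y, H1 y -> forall e : R, 0 < e -> exists2 d : R, 0 < d &
     forall k, H1 k -> nH1 k < d -> forall h v, H1 h -> H1 v ->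
       `|d2F (y + k) h v - d2F y h v| <= e * nH1 h * nH1 v).

Definition derivatives_in_dual : Prop :=
  forall y, H1 y ->
    [/\ Wm1p 2 (dF y), forall h, H1D h -> Wm1p 2 (d2F y h),
        forall v, H1D v -> is_linear_on H1D ((d2F y)^~ v)
      & exists C : R, forall h, H1D h -> normWm1p 2 (d2F y h) <= C * nH1 h].

Definition derivatives_lipschitz : Prop :=
  (exists L : R, forall y1 y2, H1 y1 -> H1 y2 ->
     normWm1p 2 (dF y1 - dF y2) <= L * nH1 (y1 - y2)) /\
  (exists L : R, forall y1 y2 h, H1 y1 -> H1 y2 -> H1D h ->
     normWm1p 2 (d2F y1 h - d2F y2 h) <= L * nH1 (y1 - y2) * nH1 h).

End objective.

(* [rem eta] tends to [0] as [eta] tends to [0] in [L^r] along the increments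
   [eta != 0] with [u + eta] admissible. *)
Definition feasible_to0 (r : R) u (rem : (E -> R) -> R) : Prop :=
  forall e : R, 0 < e -> exists2 d : R, 0 < d &
    forall eta, Uad (u + eta) -> 0 < normLp r eta < d -> `|rem eta| < e.

Definition bounded_linear_Lp (r : R) (l : (E -> R) -> R) : Prop :=
  (forall (a : R) phi psi, inLp r phi -> inLp r psi ->
     l (fun x => a * phi x + psi x) = a * l phi + l psi) /\
  exists C : R, forall phi, inLp r phi -> `|l phi| <= C * normLp r phi.

Definition bounded_bilinear_Lp (r : R) (b : (E -> R) -> (E -> R) -> R) : Prop :=
  [/\ forall (a : R) phi phi' psi, inLp r phi -> inLp r phi' -> inLp r psi ->
        b (fun x => a * phi x + phi' x) psi = a * b phi psi + b phi' psi,
      forall (a : R) phi psi psi', inLp r phi -> inLp r psi -> inLp r psi' ->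
        b phi (fun x => a * psi x + psi' x) = a * b phi psi + b phi psi'
    & exists C : R, forall phi psi, inLp r phi -> inLp r psi ->
        `|b phi psi| <= C * normLp r phi * normLp r psi].

Definition norm_dual_Lp (r : R) (l : (E -> R) -> R) : R :=
  sup [set `|l phi| | phi in [set phi | inLp r phi /\ normLp r phi <= 1]].

(* [j1] and [j2] are the first and second derivative of [j] on [Uad] for
   feasible variations with respect to the [L^r] norm. *)
Definition twice_frechet_feasible (r : R) (j : (E -> R) -> R)
    (j1 : (E -> R) -> (E -> R) -> R)
    (j2 : (E -> R) -> (E -> R) -> (E -> R) -> R) : Prop :=
  forall u, Uad u ->
    [/\ bounded_linear_Lp r (j1 u), bounded_bilinear_Lp r (j2 u),
        feasible_to0 r u (fun eta =>
          (j (u + eta) - j u - j1 u eta) / normLp r eta)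
      & feasible_to0 r u (fun eta =>
          norm_dual_Lp r (fun phi => j1 (u + eta) phi - j1 u phi - j2 u phi eta)
            / normLp r eta)].

End dirichlet_part.
End sobolev.

Section geometry.
Context {R : realType} {n : nat}.
Local Notation E := 'rV[R]_n.+1.

(* Near each boundary point, in suitable rotated coordinates, [Omega] is the
   strict subgraph of a Lipschitz function of class [C^{1,alpha}]. *)
Definition C1alpha_boundary (alpha : R) (Omega : set E) : Prop :=
  forall x, bdry Omega x ->
    exists (r : R) (Q : 'M[R]_n.+1) (gamma : 'rV[R]_n -> R),
      [/\ 0 < r, Q *m Q^T = 1%:M, C1alpha alpha gamma,
          exists L : R, forall a b, `|gamma a - gamma b| <= L * enorm (a - b)
        & forall y, eball x r y ->
            (Omega y <-> ((y - x) *m Q) 0 ord_max <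
                         gamma (col' ord_max ((y - x) *m Q)))].

Definition groger_E1 : set E := [set z | enorm z < 1 /\ z 0 ord_max < 0].
Definition groger_E2 : set E := [set z | enorm z < 1 /\ z 0 ord_max <= 0].
Definition groger_E3 : set E :=
  [set z | groger_E2 z /\ (z 0 ord_max < 0 \/ 0 < z 0 ord0)].

Definition groger_regular (G : set E) : Prop :=
  ebounded G /\
  forall x, bdry G x ->
    exists (U : set E) (Phi : E -> E) (L : R),
      [/\ open U /\ U x, 0 < L,
          forall y z, U y -> U z ->
            L^-1 * enorm (y - z) <= enorm (Phi y - Phi z) <= L * enorm (y - z),
          open (Phi @` U) /\ Phi x = 0
        & [\/ Phi @` (U `&` G) = groger_E1, Phi @` (U `&` G) = groger_E2
            | Phi @` (U `&` G) = groger_E3]].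

(* [Gt] and [Gn] are the Dirichlet and the Neumann part of the boundary. *)
Definition boundary_setting (alpha : R) (Omega Gt Gn : set E) : Prop :=
  [/\ [/\ open Omega, connected Omega, Omega !=set0 & ebounded Omega],
      0 < alpha <= 1 /\ C1alpha_boundary alpha Omega,
      [/\ Gt `<=` bdry Omega, closed Gt, Gt !=set0 & (0 < surf R n Gt)%E],
      [/\ Gn `<=` bdry Omega, closed Gn, Gn !=set0 & (0 < surf R n Gn)%E]
    & groger_regular (Omega `|` Gn)].

End geometry.

(* Main.v *)
(* Let u be admissible and 2 <= sigma <= s. Applying the solution operator to
   zero Dirichlet data and to the functional v |-> - int g . grad v solves
   int u grad z . grad v = - int g . grad v, with |z|_{W^{1,sigma}} <=
   C |g|_{L^sigma} uniformly in u. With g = phi grad S(u) this extends S'(u) to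
   all phi in L^qt, as required by the boundedness of j'(u) and j''(u) there.

   The increment d = S(u + eta) - S(u), its first-order remainder
   r = d - S'(u)[eta], and S'(u + eta)[phi] - S'(u)[phi] solve such equations,
   with right-hand sides eta grad S(u + eta), eta grad d, and
   eta grad S'(u + eta)[phi] + phi grad d. The condition on qt gives
   1/s + 2/qt < 1/2, so that by Hoelder d = O(|eta|) in W^{1,s1} and
   r = O(|eta|^2) in W^{1,s2} with 1/s1 = 1/s + 1/qt and 1/s2 = 1/s + 2/qt, in
   the norm |eta| of L^qt. The exponent 1/s2 + 1/qt may exceed 1/2, so
   int eta grad r . grad p is not O(|eta|^3); but feasible increments are
   uniformly bounded, hence |eta|_{L^rho} -> 0 for 1/rho = 1/2 - 1/s2, which
   gives o(|eta|^2). Testing with the adjoint state turns F'(y) r into such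
   integrals, and a Taylor expansion of F concludes. *)

Require Import Defs.
From mathcomp Require Import all_boot all_order all_algebra.
From mathcomp Require Import all_classical all_reals all_analysis.
From mathcomp Require Import measurable_realfun ring lra.
Import Order.TTheory GRing.Theory Num.Theory.
Import numFieldNormedType.Exports.
Local Open Scope classical_set_scope.
Local Open Scope ring_scope.
Set Implicit Arguments.
Unset Strict Implicit.
Unset Printing Implicit Defensive.

(** * Second-order Taylor expansion along a subspace *)

(** Two features of the encoding shape the proof. Both measures live on Caratheodory sigma-algebras
    of outer measures, so measurability of open sets, and with it all [L^p] theory and the linearity
    of traces, rests on the measurability of half-spaces. And elements of [sob] are representatives,
    so solutions are unique only up to null sets: equations are handled through the relation
    [solves], and any chosen solution is exchanged for another at the cost of a term of norm zero.

    The analytic obstacle beyond the expansion of [j] is the derivative of [j']. Its remainder must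
    be small uniformly over [phi] in the unit ball of L^qt, and such [phi] are not uniformly
    bounded, so only the factor [eta] can be measured in L^rho. In the integral of
    [phi grad r . grad p] the remainder [r] is therefore needed in W^{1,s3} with 1/s3 = 1/2 - 1/qt,
    where its norm is O(|eta|_{L^rho} |eta|). The same [rho] serves both purposes, since 1/s3 - 1/s1
    = 1/2 - 1/s2. *)

Lemma is_derive_remainder (R : realType) (G : R -> R) (t L : R) :
  (forall e, 0 < e -> exists2 d, 0 < d & forall tau, `|tau| < d ->
     `|G (t + tau) - G t - tau * L| <= e * `|tau|) ->
  is_derive t 1 G L.
Proof.
move=> hG.
have h : (fun h => h^-1 *: ((G \o shift t) (h *: 1) - G t)) @ 0^' --> L.
  apply/cvgrPdist_le => e e0; have [d d0 hd] := hG e e0.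
  near=> tau.
  have tau0 : tau != 0 by near: tau; exact: nbhs_dnbhs_neq.
  have taud : `|tau| < d.
    near: tau; apply: dnbhs0_lt => //.
  rewrite /= /shift scaler1 [tau + t]addrC distrC.
  have -> : tau^-1 *: (G (t + tau) - G t) - L = tau^-1 * (G (t + tau) - G t - tau * L).
    by rewrite mulrBr mulrA mulVf// mul1r.
  rewrite normrM normfV mulrC ler_pdivrMr ?normr_gt0//.
  exact: hd.
by split; [apply/cvg_ex; exists L|apply/cvg_lim].
Unshelve. all: by end_near. Qed.

Section taylor.
Context (R : realType) (V : lmodType R) (H : V -> Prop) (nH : V -> R).
Hypothesis HP : forall (a : R) v w, H v -> H w -> H (a *: v + w).
Hypothesis nHZ : forall (a : R) v, H v -> nH (a *: v) <= `|a| * nH v.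
Hypothesis nH0 : forall v, 0 <= nH v.
Variables (F : V -> R) (dF : V -> V -> R) (d2F : V -> V -> V -> R).
Hypothesis dF_lin : forall y (a : R) v w, H y -> H v -> H w ->
  dF y (a *: v + w) = a * dF y v + dF y w.
Hypothesis d2F_lin : forall y v (a : R) h k, H y -> H v -> H h -> H k ->
  d2F y (a *: h + k) v = a * d2F y h v + d2F y k v.
Hypothesis dFP : forall y, H y -> forall e : R, 0 < e -> exists2 d : R, 0 < d &
  forall h, H h -> nH h < d -> `|F (y + h) - F y - dF y h| <= e * nH h.
Hypothesis d2FP : forall y, H y -> forall e : R, 0 < e -> exists2 d : R, 0 < d &
  forall h, H h -> nH h < d -> forall v, H v ->
    `|dF (y + h) v - dF y v - d2F y h v| <= e * nH h * nH v.

(** No topology is assumed on [V], so the expansion is reduced to one real variable: [G] is the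
    remainder along the segment from [y] to [y + h], with [G 0 = 0]. Differentiability of [F] at
    every point of the segment yields [G'], the mean value theorem reduces [G 1] to a value of [G'],
    and differentiability of [dF] at the single point [y] bounds that value. *)
Lemma taylor2 y (e : R) : H y -> H 0 -> 0 < e -> exists2 d : R, 0 < d &
  forall h, H h -> nH h < d ->
    `|F (y + h) - F y - dF y h - 2^-1 * d2F y h h| <= e * nH h ^+ 2.
Proof.
move=> Hy Hz e0; have [d d0 hd] := d2FP Hy e0; exists d => // h Hh hlt.
pose G (t : R) := F (y + t *: h) - F y - t * dF y h - t ^+ 2 / 2 * d2F y h h.
pose G' (t : R) := dF (y + t *: h) h - dF y h - t * d2F y h h.
have HZ (t : R) : H (t *: h) by rewrite -[t *: h]addr0; exact: HP.
have Hyt (t : R) : H (y + t *: h) by rewrite addrC; exact: HP.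
have dFZ x (a : R) : H x -> dF x (a *: h) = a * dF x h.
  move=> Hx; have := dF_lin 1 Hx Hz Hz; rewrite scale1r addr0 mul1r => dF0.
  by have := dF_lin a Hx Hh Hz; rewrite addr0 => ->; lra.
have d2FZ (a : R) : d2F y (a *: h) h = a * d2F y h h.
  have := d2F_lin 1 Hy Hh Hz Hz; rewrite scale1r addr0 mul1r => d2F0.
  by have := d2F_lin a Hy Hh Hh Hz; rewrite addr0 => ->; lra.
have dG (t : R) : is_derive t 1 G (G' t).
  apply: is_derive_remainder => e1 e10.
  pose e2 := e1 / 2 / (nH h + 1).
  have nh1 : 0 < nH h + 1 by have := nH0 h; lra.
  have e20 : 0 < e2 by rewrite divr_gt0// divr_gt0.
  have [d1 d10 hd1] := dFP (Hyt t) e20.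
  pose B := `|d2F y h h|.
  have B0 : 0 <= B by exact: normr_ge0.
  (* The first bound keeps [tau *: h] where the remainder of [F] is controlled by [e2]; the second
     makes the quadratic term at most [e1 / 2 * |tau|]. Adding [1] avoids dividing by a vanishing
     seminorm. *)
  exists (Num.min (d1 / (nH h + 1)) (e1 / (B + 1))).
    by rewrite lt_min !divr_gt0//; lra.
  move=> tau; rewrite lt_min => /andP[tau1 tau2].
  have ntau : nH (tau *: h) <= `|tau| * nH h by exact: nHZ.
  have tn : `|tau| * nH h <= `|tau| * (nH h + 1) by rewrite ler_wpM2l//; lra.
  have small : nH (tau *: h) < d1.
    by apply: (le_lt_trans ntau); apply: (le_lt_trans tn); rewrite -ltr_pdivlMr.
  have := hd1 (tau *: h) (HZ tau) small.
  rewrite -(addrA y) -scalerDl dFZ// => h1.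
  have -> : G (t + tau) - G t - tau * G' t =
      (F (y + (t + tau) *: h) - F (y + t *: h) - tau * dF (y + t *: h) h)
      - tau ^+ 2 / 2 * d2F y h h.
    by rewrite /G /G'; field.
  apply: (le_trans (ler_normB _ _)).
  have b1 : e2 * nH (tau *: h) <= e1 / 2 * `|tau|.
    apply: (@le_trans _ _ (e2 * (`|tau| * (nH h + 1)))).
      by rewrite ler_wpM2l ?(ltW e20)// (le_trans ntau).
    rewrite le_eqVlt; apply/orP; left; apply/eqP; rewrite /e2; field.
    by rewrite gt_eqF.
  have b2 : `|tau ^+ 2 / 2 * d2F y h h| <= e1 / 2 * `|tau|.
    rewrite normrM -/B ger0_norm; last by rewrite divr_ge0// sqr_ge0.
    rewrite -real_normK ?num_real// expr2.
    have : `|tau| * (B + 1) <= e1 by rewrite -ler_pdivlMr ?ltW//; lra.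
    have := normr_ge0 tau; nra.
  by have := le_trans h1 b1; lra.
have [c cin] : exists2 c, c \in `](0:R), 1[%R & G 1 - G 0 = G' c * (1 - 0).
  apply: MVT => //; apply: derivable_within_continuous => x _.
  by have [] := dG x.
move: cin; rewrite in_itv /= => /andP[c0 c1].
have G0 : G 0 = 0 by rewrite /G scale0r addr0; ring.
rewrite G0 !subr0 mulr1 /G scale1r => GE.
have -> : F (y + h) - F y - dF y h - 2^-1 * d2F y h h = G' c.
  by rewrite -GE; field.
have nc : nH (c *: h) <= c * nH h by have := nHZ c Hh; rewrite (ger0_norm (ltW c0)).
have nc' : c * nH h <= nH h by have := nH0 h; nra.
have := hd (c *: h) (HZ c) (le_lt_trans (le_trans nc nc') hlt) h Hh.
rewrite d2FZ => /le_trans; apply.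
rewrite expr2 mulrA; apply: ler_wpM2r => //; apply: ler_wpM2l; first exact: ltW.
exact: le_trans nc nc'.
Qed.

End taylor.

(** * Borel sets are measurable for the Lebesgue and Hausdorff outer measures *)

Section borel.
Context {R : realType} {n : nat}.
Variable mu : {outer_measure set 'rV[R]_n.+1 -> \bar R}.
Hypothesis half_space : forall (i : 'I_n.+1) (c : R),
  mu.-cara.-measurable [set x : 'rV[R]_n.+1 | x 0 i < c].

Let rbox (q : 'rV[rat]_n.+1) (r : rat) : set 'rV[R]_n.+1 :=
  [set x | forall i, ratr (q 0 i) - ratr r <= x 0 i < ratr (q 0 i) + ratr r].

Let measurable_rbox q r : mu.-cara.-measurable (rbox q r).
Proof.
have -> : rbox q r = \bigcap_(i in [set: 'I_n.+1])
    ([set x : 'rV[R]_n.+1 | x 0 i < ratr (q 0 i) + ratr r] `\`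
     [set x : 'rV[R]_n.+1 | x 0 i < ratr (q 0 i) - ratr r]).
  apply/seteqP; split => [x qx i _ /=|x qx i].
    by have /andP[] := qx i; rewrite leNgt => /negP ? ?; split.
  by have [/= -> /negP] := qx i I; rewrite -leNgt => ->.
apply: (@fin_bigcap_measurable _ (caratheodory_type mu)).
  exact: finite_finset.
by move=> i _; apply: (@measurableD _ (caratheodory_type mu)); exact: half_space.
Qed.

(** Boxes with rational centre and radius are finite intersections of differences of half-spaces,
    and those contained in [U] form a countable cover of it. The enumeration runs over codes of
    pairs; indices that code nothing, or code a box not contained in [U], contribute the empty
    set. *)
Lemma open_caratheodory (U : set 'rV[R]_n.+1) :
  open U -> mu.-cara.-measurable U.
Proof.
move=> oU.
pose B (k : nat) : set 'rV[R]_n.+1 := if unpickle k is Some (q, r) then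
  if pselect (rbox q r `<=` U) then rbox q r else set0 else set0.
have -> : U = \bigcup_k B k.
  apply/seteqP; split => [x Ux|x [k _]]; last first.
    rewrite /B; case: unpickle => [[q r]|//].
    by case: pselect => // qU; exact: qU.
  have /nbhs_ballP[e /= e0 eU] : nbhs x U by exact: open_nbhs_nbhs.
  have /all_sig[q hq] (i : 'I_n.+1) :
      {q : rat | x 0 i - e / 4 < ratr q < x 0 i + e / 4}.
    apply/cid; have [|r] := @rat_in_itvoo R (x 0 i - e / 4) (x 0 i + e / 4).
      by lra.
    by rewrite in_itv /=; exists r.
  (* The centre is within [e / 4] of [x], so a radius above [e / 4] captures [x], and one below
     [e / 2] keeps the box within distance [3 e / 4] of [x]. *)
  have [|r] := @rat_in_itvoo R (e / 4) (e / 2); first by lra.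
  rewrite in_itv /= => /andP[r1 r2].
  pose Q : 'rV[rat]_n.+1 := \row_i q i.
  have Qx : rbox Q r x.
    by move=> i; rewrite mxE; have /andP[] := hq i; lra.
  have QU : rbox Q r `<=` U.
    move=> y Qy; apply: eU; split => // a b; rewrite (ord1 a).
    have := Qy b; rewrite mxE => /andP[y1 y2].
    have /andP[q1 q2] := hq b.
    by rewrite /ball /= ltr_distlC; apply/andP; lra.
  exists (pickle (Q, r)) => //; rewrite /B pickleK.
  by case: pselect.
apply: (@bigcupT_measurable _ (caratheodory_type mu)) => k.
rewrite /B; case: unpickle => [[q r]|]; last exact: measurable0.
by case: pselect => ?; [exact: measurable_rbox|exact: measurable0].
Qed.

Lemma continuous_caratheodory (D : set 'rV[R]_n.+1) (f : 'rV[R]_n.+1 -> R) :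
  mu.-cara.-measurable D -> continuous f ->
  measurable_fun (D : set (caratheodory_type mu)) f.
Proof.
move=> mD cf; apply: (measurability _ (measurable_realfun.RGenOInfty.measurableE R)) => _ [_ [x ->] <-].
apply: measurableI => //; apply: open_caratheodory.
by move/continuousP : cf; apply; exact: interval_open.
Qed.

End borel.

(** * Superadditivity of covering outer measures *)

Section cover_split.
Context {R : realType} {T : Type} (zeta : set T -> \bar R).
Hypothesis zeta_ge0 : forall A, (0 <= zeta A)%E.

(** Cutting every member of a cover of [X] by [H1] and by [H2] yields covers of the two pieces, so
    an inequality for the gauge of each single set passes to the outer measure. It serves a
    half-space with its complement as well as two sets at positive distance. *)
Lemma cover_outer_split (H1 H2 X : set T) :
  (forall B, (zeta (B `&` H1) + zeta (B `&` H2) <= zeta B)%E) ->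
  (cover_outer zeta (X `&` H1) + cover_outer zeta (X `&` H2) <=
   cover_outer zeta X)%E.
Proof.
move=> split_le; apply: le_ereal_inf_tmp => _ [F /= XF <-].
apply: (@le_trans _ _ (\sum_(k <oo) zeta (F k `&` H1) +
                       \sum_(k <oo) zeta (F k `&` H2))%E).
  by apply: leeD; apply: ereal_inf_lbound;
    [exists (fun k => F k `&` H1)|exists (fun k => F k `&` H2)] => //=;
    rewrite -setI_bigcupl; apply: setSI.
rewrite -nneseriesD//; apply: lee_nneseries => // k _ _.
by apply: adde_ge0.
Qed.

End cover_split.

(** * Half-spaces are Lebesgue measurable *)

Section lebesgue.
Context {R : realType} {n : nat}.
Local Notation E := 'rV[R]_n.+1.

Lemma box_gauge_le (a b : E) (B : set E) : (forall i, a 0 i <= b 0 i) ->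
  (B `<=` [set x | forall i, a 0 i < x 0 i < b 0 i]) ->
  (box_gauge B <= (\prod_(i < n.+1) (b 0 i - a 0 i))%:E)%E.
Proof. by move=> ab Bab; apply: ereal_inf_lbound; exists (a, b). Qed.

Let upd (a : E) (i : 'I_n.+1) (c : R) : E :=
  \row_j if j == i then c else a 0 j.

Let prod_upd (a b : E) (i : 'I_n.+1) :
  \prod_(j < n.+1) (b 0 j - a 0 j) =
  (b 0 i - a 0 i) * \prod_(j < n.+1 | j != i) (b 0 j - a 0 j).
Proof. by rewrite (bigD1 i). Qed.

(* Cutting an open box along the hyperplane leaves an open box and a set
   contained in an open box that overlaps it in an arbitrarily thin slab. *)
Lemma box_gauge_split (i : 'I_n.+1) (c : R) (B : set E) :
  (box_gauge (B `&` [set x : E | (x 0 i < c)%R]) +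
   box_gauge (B `&` ~` [set x : E | (x 0 i < c)%R]) <= box_gauge B)%E.
Proof.
apply: le_ereal_inf_tmp => _ [[a b] /= [ab Bab] <-].
have [ca|ac] := leP c (a 0 i).
  rewrite [X in box_gauge X](_ : _ = set0); last first.
    apply/seteqP; split => // x [/Bab/(_ i) /= /andP[ax _] xc]; lra.
  rewrite box_gauge0 add0e; apply: box_gauge_le => //.
  by apply: subset_trans Bab => x [].
have [bc|cb] := leP (b 0 i) c.
  rewrite [X in (_ + box_gauge X)%E](_ : _ = set0); last first.
    apply/seteqP; split => // x [/Bab/(_ i) /= /andP[_ xb] /negP xc]; lra.
  rewrite box_gauge0 adde0; apply: box_gauge_le => //.
  by apply: subset_trans Bab => x [].
rewrite (prod_upd a b i); set P := \prod_(j < _ | _) _.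
have P0 : 0 <= P by apply: prodr_ge0 => j _; rewrite subr_ge0.
apply/lee_addgt0Pr => e e0.
(* The closed side of the cut contains points with coordinate exactly [c], so its open box must
   start below [c], at [c - d]. The overlap then has volume [d * P], at most [e]; [P + 1] allows for
   degenerate boxes with [P = 0]. *)
pose d := Num.min (c - a 0 i) (e / (P + 1)).
have d0 : 0 < d by rewrite lt_min; apply/andP; split; [lra|apply: divr_gt0; lra].
have dc : d <= c - a 0 i by rewrite ge_min lexx.
have dP : d * P <= e.
  have : d <= e / (P + 1) by rewrite ge_min lexx orbT.
  rewrite ler_pdivlMr; last by lra.
  by apply: le_trans; rewrite ler_pM2l//; lra.
apply: (@le_trans _ _ (((c - a 0 i) * P)%:E + ((b 0 i - (c - d)) * P)%:E)%E).
  apply: leeD.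
    have -> : (c - a 0 i) * P = \prod_(j < n.+1) ((upd b i c) 0 j - a 0 j).
      rewrite (bigD1 i)//= mxE eqxx; congr (_ * _).
      by apply: eq_bigr => j ji; rewrite mxE (negbTE ji).
    apply: box_gauge_le => [j|x [/Bab /= xab xc] j]; rewrite mxE; case: eqP => //.
      by move=> ->; exact: ltW.
    by move=> ->; rewrite xc andbT; have /andP[] := xab i.
  have -> : (b 0 i - (c - d)) * P =
      \prod_(j < n.+1) (b 0 j - (upd a i (c - d)) 0 j).
    rewrite (bigD1 i)//= mxE eqxx; congr (_ * _).
    by apply: eq_bigr => j ji; rewrite mxE (negbTE ji).
  apply: box_gauge_le => [j|x [/Bab /= xab /negP xc] j]; rewrite mxE; case: eqP => //.
    by move=> ->; lra.
  by move=> ->; apply/andP; split; [lra|have /andP[] := xab i].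
rewrite -!EFinD lee_fin.
have -> : (c - a 0 i) * P + (b 0 i - (c - d)) * P = (b 0 i - a 0 i) * P + d * P by ring.
lra.
Qed.

Lemma leb_half_space (i : 'I_n.+1) (c : R) :
  (leb_om R n).-cara.-measurable [set x : E | x 0 i < c].
Proof.
apply: le_caratheodory_measurable => X; apply: cover_outer_split.
  exact: box_gauge_ge0.
exact: box_gauge_split.
Qed.

End lebesgue.

(** * Half-spaces are measurable for metric outer measures *)

Section metric_outer_measure.
Context {R : realType} {n : nat}.
Local Notation E := 'rV[R]_n.+1.
Variable mu : {outer_measure set E -> \bar R}.
Hypothesis mu_metric : forall (d : R) (A B : set E), 0 < d ->
  (forall x y, A x -> B y -> d <= enorm (x - y)) ->
  (mu A + mu B <= mu (A `|` B))%E.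

Lemma coord_le_enorm (x : E) i : `|x 0 i| <= enorm x.
Proof.
rewrite /enorm -sqrtr_sqr ler_sqrt /edot; last first.
  by apply: sumr_ge0 => j _; rewrite -expr2 sqr_ge0.
rewrite (bigD1 i)//= -expr2 lerDl.
by apply: sumr_ge0 => j _; rewrite -expr2 sqr_ge0.
Qed.

Section half_space.
Variables (i : 'I_n.+1) (c : R) (X : set E).
Let H : set E := [set x | x 0 i < c].
Let t (k : nat) : R := c - k.+1%:R^-1.
Let A (k : nat) : set E := X `&` [set x | x 0 i <= t k].
Let D (k : nat) : set E := X `&` [set x | t k < x 0 i <= t k.+1].

Let t_lt k : t k < t k.+1.
Proof. by rewrite /t ltrD2l ltrN2 ltf_pV2 ?posrE ?ltr0n// ltr_nat. Qed.

Let t_ltc k : t k < c.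
Proof. by rewrite /t ltrBlDr ltrDl invr_gt0 ltr0n. Qed.

Let t_cvg (x : R) : x < c -> exists k, x <= t k.
Proof.
move=> xc; have d0 : 0 < c - x by lra.
exists (Num.truncn (c - x)^-1).
have : (Num.truncn (c - x)^-1).+1%:R^-1 <= c - x; last by rewrite /t lerBrDr lerBrDl.
rewrite -[leRHS]invrK lef_pV2 ?posrE ?ltr0n ?invr_gt0//.
exact/ltW/truncnS_gt.
Qed.

Let mu_AD (k : nat) : (mu (A k) + mu (D k.+1) <= mu (A k.+2))%E.
Proof.
apply: (@le_trans _ _ (mu (A k `|` D k.+1))); last first.
- apply: le_outer_measure => x [[Xx /= xt]|[Xx /= /andP[_ xt]]]; split => //=.
  by rewrite (le_trans xt)// (le_trans (ltW (t_lt k)))// ltW.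
- apply: (@mu_metric (t k.+1 - t k)); first by rewrite subr_gt0.
  move=> x y [_ /= xt] [_ /= /andP[ty _]]; apply: le_trans (coord_le_enorm _ i).
  by rewrite !mxE distrC ler_normr; apply/orP; left; lra.
Qed.

(** [A N] and the slice [D N.+1] together have measure at most that of [A N.+2], so adding a slice
    advances one of the two terms by two indices. Two terms are needed because neighbouring slices
    are not separated: even and odd ones telescope independently. *)
Let sum_D (N : nat) :
  (\sum_(0 <= k < N) mu (D k.+1) <= mu (A N) + mu (A N.+1))%E.
Proof.
elim: N => [|N ih]; first by rewrite big_geq// adde_ge0.
rewrite big_nat_recr//= addeC.
apply: (@le_trans _ _ (mu (D N.+1) + (mu (A N) + mu (A N.+1)))%E).
  exact: leeD2l.
by rewrite addeA addeC (addeC (mu (D _))) leeD2l.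
Qed.

Let XH_sub (k : nat) : X `&` H `<=` A k `|` \bigcup_j D (j + k).
Proof.
move=> x [Xx /= xc]; have [xk|kx] := leP (x 0 i) (t k); first by left.
right.
have [m0 xm0] := t_cvg xc.
have ex : exists m, x 0 i <= t m by exists m0.
pose m := ex_minn ex.
have [xm minm] : x 0 i <= t m /\ forall l, x 0 i <= t l -> (m <= l)%N.
  by rewrite /m; case: ex_minnP.
have tmono : {homo t : a b / (a <= b)%N >-> a <= b}.
  by apply: homo_leq => // [|l]; [exact: le_trans|exact: ltW].
have km : (k < m)%N.
  by rewrite ltnNge; apply/negP => /tmono mk; lra.
(* Minimality of [m] puts the coordinate strictly above [t m.-1], so the point lies in the slice
   [D m.-1], whose index is counted from [k]. *)
exists (m.-1 - k)%N => //=.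
have mk1 : (m.-1 - k + k = m.-1)%N by rewrite subnK// -ltnS prednK// (leq_ltn_trans _ km).
rewrite mk1; split => //=; rewrite prednK ?(leq_ltn_trans _ km)// xm andbT ltNge.
apply/negP => /minm; rewrite leqNgt => /negP; apply.
by rewrite prednK// (leq_ltn_trans _ km).
Qed.

(* Caratheodory's criterion: the slices [D k] accumulating at the hyperplane
   have a convergent sum of measures, because [A k] and [D k.+1] are at
   positive distance. *)
Lemma metric_half_space_le : (mu (X `&` H) + mu (X `&` ~` H) <= mu X)%E.
Proof.
have [->|Xoo] := eqVneq (mu X) +oo%E; first exact: leey.
have muX : (mu X < +oo)%E by rewrite ltey.
have AX k : (mu (A k) <= mu X)%E by apply: le_outer_measure => x [].
have sumoo : (\sum_(0 <= k <oo) mu (D k.+1) < +oo)%E.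
  apply: (@le_lt_trans _ _ (mu X + mu X)%E); last exact: lte_add_pinfty.
  apply: lime_le; first by apply: is_cvg_nneseries.
  by apply: nearW => N; apply: (le_trans (sum_D N)); exact: leeD.
have tail0 := nneseries_tail_cvg sumoo (fun _ _ => outer_measure_ge0 mu _).
(* Passing from [X] intersected with the half-space to [A k.+1] costs only a tail of the series of
   slices, and [A k.+1] is at distance [c - t k.+1 > 0] from the complementary piece. *)
have bound k : (mu (X `&` H) + mu (X `&` ~` H) <=
    mu X + \sum_(k <= j <oo) mu (D j.+1))%E.
  have h1 : (mu (X `&` H) <= mu (A k.+1) + \sum_(k <= j <oo) mu (D j.+1))%E.
    apply: (le_trans (le_outer_measure mu _ _ (@XH_sub k.+1))).
    apply: (le_trans (outer_measureU2 _ _ _)); apply: leeD2l.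
    apply: (le_trans (outer_measure_sigma_subadditive mu _)).
    rewrite -(@nneseries_addn _ (fun j => mu (D j.+1)))//.
    by under eq_eseriesr do rewrite addnS.
  have h2 : (mu (A k.+1) + mu (X `&` ~` H) <= mu X)%E.
    apply: (@le_trans _ _ (mu (A k.+1 `|` (X `&` ~` H)))); last first.
    - by apply: le_outer_measure => x [[Xx _]|[Xx _]]; exact: Xx.
    - apply: (@mu_metric (c - t k.+1)); first by rewrite subr_gt0.
      move=> x y [_ /= xt] [_ /= /negP yc]; apply: le_trans (coord_le_enorm _ i).
      by rewrite !mxE distrC ler_normr; apply/orP; left; lra.
  apply: (le_trans (leeD2r _ h1)).
  by rewrite addeAC; exact: leeD2r.
have h : (mu X + \sum_(k <= j <oo) mu (D j.+1))%E @[k --> \oo] --> (mu X + 0)%E.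
  by apply: cvgeD => //; [exact: fin_num_adde_defl|exact: cvg_cst].
rewrite -[leRHS]adde0; apply: (cvge_ge _ h); exact: nearW.
Qed.

End half_space.

Lemma metric_half_space (i : 'I_n.+1) (c : R) :
  mu.-cara.-measurable [set x : E | x 0 i < c].
Proof.
by apply: le_caratheodory_measurable => X; exact: metric_half_space_le.
Qed.

End metric_outer_measure.

(** * The Hausdorff measure is a metric outer measure *)

Section hausdorff.
Context {R : realType} {n : nat}.
Local Notation E := 'rV[R]_n.+1.

Lemma ediam_le (A B : set E) : A `<=` B -> (ediam A <= ediam B)%E.
Proof.
move=> AB; apply: le_ereal_sup.
by apply: image_subset => x [? ?]; split; exact: AB.
Qed.

(** A set meeting both [A1] and [A2] has diameter at least [d > delta], so its gauge is infinite.
    Otherwise one of the two pieces is empty and monotonicity of the gauge suffices. *)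
Lemma haus_gauge_split (k : nat) (delta d : R) (A1 A2 B : set E) : delta < d ->
  (forall x y, A1 x -> A2 y -> d <= enorm (x - y)) ->
  (haus_gauge k delta (B `&` A1) + haus_gauge k delta (B `&` A2) <=
   haus_gauge k delta B)%E.
Proof.
move=> deltad dist.
have le_gauge (A C : set E) : A `<=` C -> (haus_gauge k delta A <= haus_gauge k delta C)%E.
  move=> AC; have [->|A0] := eqVneq A set0; first by rewrite haus_gauge0 haus_gauge_ge0.
  have C0 : C != set0.
    by apply/set0P; have /set0P[x Ax] := A0; exists x; exact: AC.
  rewrite /haus_gauge (negbTE A0) (negbTE C0).
  case: ifPn => Ad; case: ifPn => Cd; rewrite ?leey//.
    have Ad0 : (0 <= ediam A)%E.
      have /set0P[x Ax] := A0; apply: (@le_trans _ _ (enorm (x - x))%:E).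
        by rewrite lee_fin sqrtr_ge0.
      by apply: ereal_sup_ubound; exists (x, x).
    apply: gt0_ler_poweR; rewrite ?ler0n ?in_itv ?leey ?andbT ?ediam_le//=.
      by rewrite Ad0 leey.
    rewrite leey andbT; exact: (le_trans Ad0 (ediam_le AC)).
  by have := le_trans (ediam_le AC) Cd; rewrite (negbTE Ad).
have [BA1|BA1] := eqVneq (B `&` A1) set0.
  by rewrite BA1 haus_gauge0 add0e le_gauge.
have [BA2|BA2] := eqVneq (B `&` A2) set0.
  by rewrite BA2 haus_gauge0 adde0 le_gauge.
have /set0P[x [Bx A1x]] := BA1; have /set0P[y [By A2y]] := BA2.
rewrite [leRHS]/haus_gauge; case: ifPn => [/eqP B0|_].
  by rewrite B0 in Bx.
case: ifPn => [Bd|_]; last exact: leey.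
have : ((enorm (x - y))%:E <= delta%:E)%E.
  by apply: le_trans Bd; apply: ereal_sup_ubound; exists (x, y).
rewrite lee_fin => /le_lt_trans/(_ deltad).
by rewrite ltNge dist.
Qed.

Lemma haus_metric (d : R) (A B : set E) : 0 < d ->
  (forall x y, A x -> B y -> d <= enorm (x - y)) ->
  (haus_om R n A + haus_om R n B <= haus_om R n (A `|` B))%E.
Proof.
move=> d0 dist.
have le_delta (d1 d2 : R) (C : set E) : d1 <= d2 ->
    (cover_outer (haus_gauge n d2) C <= cover_outer (haus_gauge n d1) C)%E.
  move=> d12; apply: le_ereal_inf_tmp => _ [F CF <-].
  apply: (@le_trans _ _ (\sum_(k <oo) haus_gauge n d2 (F k))%E).
    by apply: ereal_inf_lbound; exists F.
  apply: lee_nneseries => j _; first by move=> _; exact: haus_gauge_ge0.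
  rewrite /haus_gauge; case: ifPn => // _; case: ifPn => [_|dj].
    by case: ifPn => // _; exact: leey.
  case: ifPn => // dj'; move: dj; by rewrite (le_trans dj') ?lee_fin.
have key (d1 : R) : 0 < d1 -> d1 < d ->
   (cover_outer (haus_gauge n d1) A + cover_outer (haus_gauge n d1) B <=
    haus_om R n (A `|` B))%E.
  move=> d10 d1d.
  apply: (@le_trans _ _ (cover_outer (haus_gauge n d1) (A `|` B))); last first.
    by apply: ereal_sup_ubound; exists d1.
  have := @cover_outer_split _ _ (haus_gauge n d1) (haus_gauge_ge0 n d1) A B (A `|` B)
    (fun C => haus_gauge_split n C d1d dist).
  have -> : (A `|` B) `&` A = A by apply/setIidr; exact: subsetUl.
  by have -> : (A `|` B) `&` B = B by apply/setIidr; exact: subsetUr.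
have [->|Moo] := eqVneq (haus_om R n (A `|` B)) +oo%E; first exact: leey.
have Mfin : haus_om R n (A `|` B) \is a fin_num.
  by rewrite ge0_fin_numE ?ltey//; exact: haus_outer_ge0.
(* Two unrelated meshes are needed because the suprema for [A] and for [B] are taken one after the
   other. A common mesh below both, and strictly below [d], only increases the left-hand side. *)
have key2 (d1 d2 : R) : 0 < d1 -> 0 < d2 ->
   (cover_outer (haus_gauge n d1) A + cover_outer (haus_gauge n d2) B <=
    haus_om R n (A `|` B))%E.
  move=> d10 d20; pose d3 := Num.min (Num.min d1 d2) (d / 2).
  have [h1 h2 h3] : [/\ d3 <= d1, d3 <= d2 & d3 <= d / 2].
    by rewrite /d3 !ge_min !lexx !orbT.
  have d30 : 0 < d3 by rewrite /d3 !lt_min d10 d20 divr_gt0.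
  apply: le_trans (key d3 d30 _); last by lra.
  by apply: leeD; exact: le_delta.
have finA (d1 : R) : 0 < d1 -> cover_outer (haus_gauge n d1) A \is a fin_num.
  move=> d10; rewrite ge0_fin_numE; last by apply: cover_outer_ge0; exact: haus_gauge_ge0.
  apply: (@le_lt_trans _ _ (haus_om R n (A `|` B))); last by rewrite ltey.
  apply: le_trans (key2 d1 d1 d10 d10); apply: leeDl.
  by apply: cover_outer_ge0; exact: haus_gauge_ge0.
have finB : haus_om R n B \is a fin_num.
  rewrite ge0_fin_numE; last exact: haus_outer_ge0.
  apply: (@le_lt_trans _ _ (haus_om R n (A `|` B))); last by rewrite ltey.
  by apply: le_haus_outer; exact: subsetUr.
rewrite -leeBrDr//; apply: ge_ereal_sup => _ [d1 /= d10 <-].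
rewrite leeBrDr// -leeBrDl ?finA//; apply: ge_ereal_sup => _ [d2 /= d20 <-].
by rewrite leeBrDl ?finA//; exact: key2.
Qed.

Lemma haus_half_space (i : 'I_n.+1) (c : R) :
  (haus_om R n).-cara.-measurable [set x : E | x 0 i < c].
Proof. by apply: metric_half_space; exact: haus_metric. Qed.

End hausdorff.

(** * Lp norms on a set of finite measure *)

Section Lnorm_extra.
Context d (T : measurableType d) (R : realType).
Variable mu : {measure set T -> \bar R}.
Local Notation "'N_ p [ f ]" := (Lnorm mu p%:E (EFin \o f)).
Implicit Types (f g : T -> R) (p q r : R).
Local Open Scope ereal_scope.

Lemma ae_imp (P Q : T -> Prop) : (forall x, P x -> Q x) ->
  {ae mu, forall x, P x} -> {ae mu, forall x, Q x}.
Proof. by move=> PQ; apply: filterS. Qed.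

Lemma ae_imp2 (P Q S : T -> Prop) : (forall x, P x -> Q x -> S x) ->
  {ae mu, forall x, P x} -> {ae mu, forall x, Q x} -> {ae mu, forall x, S x}.
Proof. by move=> PQS; apply: filterS2. Qed.

Lemma Lnorm_powR f (p r : R) : (0 < p)%R -> (0 < r)%R ->
  'N_(p / r) [ (fun x => `|f x| `^ r)%R ] = 'N_p [f] `^ r.
Proof.
move=> p0 r0; rewrite unlock /Lnorm.
rewrite -poweRrM invf_div [X in _ = _ `^ X]mulrC; f_equal.
apply: eq_integral => x _ /=.
rewrite ger0_norm ?powR_ge0// -powRrM; congr ((_ `^ _)%:E).
by rewrite mulrC divfK ?gt_eqF.
Qed.

(** The classical inequality for [|f|^r] and [|g|^r] with the conjugate exponents [p / r] and
    [q / r], followed by an [r]-th root. *)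
Lemma hoelder_mul f g (p q r : R) :
  measurable_fun [set: T] f -> measurable_fun [set: T] g ->
  (0 < p)%R -> (0 < q)%R -> (0 < r)%R -> (p^-1 + q^-1 = r^-1)%R ->
  'N_r [ (f \* g)%R ] <= 'N_p [f] * 'N_q [g].
Proof.
move=> mf mg p0 q0 r0 pqr.
have mpow (h : T -> R) : measurable_fun [set: T] h ->
    measurable_fun [set: T] (fun x => `|h x| `^ r)%R.
  move=> mh; apply: (@measurableT_comp _ _ _ _ _ _ (@powR R ^~ r)) => //.
  exact: measurableT_comp.
have := @hoelder _ _ _ mu _ _ (p / r) (q / r) (mpow f mf) (mpow g mg)
  (divr_gt0 p0 r0) (divr_gt0 q0 r0).
rewrite !invf_div -mulrDr pqr divff ?gt_eqF// => /(_ erefl).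
rewrite !Lnorm_powR// -poweRM ?Lnorm_ge0// => h.
rewrite -[leLHS]poweRe1 ?Lnorm_ge0// -[leRHS]poweRe1 ?mule_ge0 ?Lnorm_ge0//.
rewrite -(@divff _ r) ?gt_eqF// !poweRrM.
apply: gt0_ler_poweR.
- by rewrite invr_ge0 ltW.
- by rewrite in_itv/= poweR_ge0 leey.
- by rewrite in_itv/= poweR_ge0 leey.
apply: le_trans h; rewrite le_eqVlt; apply/orP; left; apply/eqP.
rewrite -Lnorm_powR// divff ?gt_eqF//; congr (Lnorm mu 1 _).
by apply/funext => x /=; rewrite normrM powRM.
Qed.

Lemma LnormZl f (a p : R) : measurable_fun [set: T] f -> (0 < p)%R ->
  'N_p [ (fun x => a * f x)%R ] = `|a|%:E * 'N_p [f].
Proof.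
move=> mf p0; rewrite unlock /Lnorm.
under eq_integral do rewrite /= normrM powRM// EFinM.
rewrite ge0_integralZl//; last first.
  apply/measurable_EFinP; apply: (@measurableT_comp _ _ _ _ _ _ (@powR R ^~ p)) => //.
  exact: measurableT_comp.
rewrite poweRM ?lee_fin ?powR_ge0 ?integral_ge0//.
by rewrite poweR_EFin -powRrM divff ?gt_eqF// powRr1.
Qed.

Lemma ae_eq_Lnorm f g (p : R) : measurable_fun [set: T] f ->
  measurable_fun [set: T] g -> {ae mu, forall x, f x = g x} ->
  'N_p [f] = 'N_p [g].
Proof.
move=> mf mg fg; rewrite unlock /Lnorm; f_equal.
have mpow (h : T -> R) : measurable_fun [set: T] h ->
    measurable_fun [set: T] (fun x => (`|h x| `^ p)%:E).
  move=> mh; apply/measurable_EFinP.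
  apply: (@measurableT_comp _ _ _ _ _ _ (@powR R ^~ p)) => //.
  exact: measurableT_comp.
apply: ae_eq_integral => //; [exact: mpow|exact: mpow|].
by apply: filterS fg => x /= fgx _; rewrite fgx.
Qed.

Lemma le_Lnorm f g (p : R) : measurable_fun [set: T] f ->
  measurable_fun [set: T] g -> (0 < p)%R ->
  {ae mu, forall x, (`|f x| <= `|g x|)%R} -> 'N_p [f] <= 'N_p [g].
Proof.
move=> mf mg p0 fg; rewrite unlock /Lnorm.
have mpow (h : T -> R) : measurable_fun [set: T] h ->
    measurable_fun [set: T] (fun x => (`|h x| `^ p)%:E).
  move=> mh; apply/measurable_EFinP.
  apply: (@measurableT_comp _ _ _ _ _ _ (@powR R ^~ p)) => //.
  exact: measurableT_comp.
apply: gt0_ler_poweR.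
- by rewrite invr_ge0 ltW.
- by rewrite in_itv/= leey integral_ge0// => x _; exact: poweR_ge0.
- by rewrite in_itv/= leey integral_ge0// => x _; exact: poweR_ge0.
apply: ae_ge0_le_integral => //.
- by move=> x _; exact: poweR_ge0.
- exact: (mpow f mf).
- by move=> x _; exact: poweR_ge0.
- exact: (mpow g mg).
apply: ae_imp fg => x /= fgx _; rewrite lee_fin.
by apply: ge0_ler_powR; rewrite ?nnegrE// ltW.
Qed.

(** Interpolation between L^p and L^infinity, from the pointwise bound
    [|f|^q <= M^(q - p) |f|^p]. *)
Lemma bounded_Lnorm f (M p q : R) : measurable_fun [set: T] f ->
  (0 < p)%R -> (p <= q)%R -> (0 <= M)%R -> {ae mu, forall x, (`|f x| <= M)%R} ->
  'N_q [f] <= (M `^ (1 - p / q))%:E * 'N_p [f] `^ (p / q).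
Proof.
move=> mf p0 pq M0 fM; have q0 : (0 < q)%R := lt_le_trans p0 pq.
have mpow (r : R) : measurable_fun [set: T] (fun x => (`|f x| `^ r)%:E).
  apply/measurable_EFinP.
  apply: (@measurableT_comp _ _ _ _ _ _ (@powR R ^~ r)) => //.
  exact: measurableT_comp.
have h : \int[mu]_x (`|f x| `^ q)%:E <=
    (M `^ (q - p))%:E * \int[mu]_x (`|f x| `^ p)%:E.
  rewrite -ge0_integralZl ?lee_fin ?powR_ge0//.
  apply: ae_ge0_le_integral => //.
  - by move=> x _; rewrite mule_ge0 ?lee_fin ?powR_ge0.
  - exact: measurable_funeM.
  apply: filterS fM => x fx _; rewrite -EFinM lee_fin.
  have [->|fx0] := eqVneq (f x) 0%R.
    by rewrite normr0 !powR0 ?gt_eqF// mulr0.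
  have -> : (`|f x| `^ q = `|f x| `^ (q - p) * `|f x| `^ p)%R.
    by rewrite -powRD ?subrK// normr_eq0 fx0 implybT.
  by rewrite ler_wpM2r ?powR_ge0// ge0_ler_powR// ?nnegrE// subr_ge0.
rewrite unlock /Lnorm -poweRrM mulrA mulVf ?gt_eqF// mul1r.
have -> : (M `^ (1 - p / q))%:E = (M `^ (q - p))%:E `^ q^-1.
  by rewrite poweR_EFin -powRrM mulrBl divff ?gt_eqF.
rewrite -poweRM ?lee_fin ?powR_ge0 ?integral_ge0//.
apply: gt0_ler_poweR => //.
- by rewrite invr_ge0 ltW.
- by rewrite in_itv/= leey integral_ge0.
- by rewrite in_itv/= leey mule_ge0 ?lee_fin ?powR_ge0 ?integral_ge0.
- by move=> x _; exact: poweR_ge0.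
Qed.

End Lnorm_extra.

(** Stated in the extended reals because only measurability is available where it is applied, namely
    to the differences between traces and their approximants on the boundary. *)
Lemma integral_abs_lin d (T : measurableType d) (R : realType)
    (mu : {measure set T -> \bar R}) (D : set T) (a : R) (f g : T -> R) :
  measurable D -> measurable_fun D f -> measurable_fun D g ->
  (\int[mu]_(x in D) `|a * f x + g x|%:E <=
   `|a|%:E * \int[mu]_(x in D) `|f x|%:E + \int[mu]_(x in D) `|g x|%:E)%E.
Proof.
move=> mD mf mg.
have mnf : measurable_fun D (fun x => `|f x|%:E).
  by apply/measurable_EFinP; exact: measurableT_comp.
have mng : measurable_fun D (fun x => `|g x|%:E).
  by apply/measurable_EFinP; exact: measurableT_comp.
have ma : measurable_fun D (fun x => (`|a|%:E * `|f x|%:E)%E) by exact: measurable_funeM.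
rewrite -ge0_integralZl// -ge0_integralD//.
apply: ge0_le_integral => //.
- apply/measurable_EFinP; apply: measurableT_comp => //; apply: measurable_funD => //.
  exact: (@measurableT_comp _ _ _ _ _ _ ( *%R a)).
- exact: emeasurable_funD.
- by move=> x _; rewrite -EFinM -EFinD lee_fin (le_trans (ler_normD _ _))// normrM.
Qed.

Section Lnorm_on_set.
Context d (T : measurableType d) (R : realType).
Variables (mu : {measure set T -> \bar R}) (D : set T).
Hypotheses (mD : measurable D) (fD : (mu D < +oo)%E).
Implicit Types (phi psi : T -> R) (p q r : R).

Definition Lnorm_on p phi : \bar R := Lnorm mu p%:E (EFin \o (phi \_ D)).
Definition Lfun_on p phi : Prop := (phi \_ D) \in Lfun mu p%:E.
Definition fLnorm_on p phi : R := fine (Lnorm_on p phi).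
Definition int_on phi : R := \int[mu]_(x in D) phi x.

Lemma Lfun_onE p phi : Lfun_on p phi <->
  measurable_fun D phi /\ (Lnorm_on p phi < +oo)%E.
Proof.
rewrite /Lfun_on; split => [/andP[]|[mphi foo]].
  rewrite !inE /= => m f; split => //.
  by case: (@measurable_restrictT _ _ T R D phi mD) => _; apply.
apply/andP; split; rewrite inE//=.
by case: (@measurable_restrictT _ _ T R D phi mD) => + _; apply.
Qed.

Lemma Lfun_on_measurable p phi : Lfun_on p phi -> measurable_fun D phi.
Proof. by move/Lfun_onE => []. Qed.

Lemma Lnorm_on_ge0 p phi : (0 <= Lnorm_on p phi)%E.
Proof. exact: Lnorm_ge0. Qed.

Lemma fLnorm_on_ge0 p phi : 0 <= fLnorm_on p phi.
Proof. exact/fine_ge0/Lnorm_on_ge0. Qed.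

Lemma Lnorm_on_fin p phi : Lfun_on p phi -> Lnorm_on p phi = (fLnorm_on p phi)%:E.
Proof. by move/Lfun_onE => [_ h]; rewrite fineK// ge0_fin_numE// Lnorm_on_ge0. Qed.

Lemma restrictD phi psi :
  (fun x => phi x + psi x) \_ D = (phi \_ D \+ psi \_ D).
Proof. by apply/funext => x; rewrite /patch/=; case: ifP; rewrite ?addr0. Qed.

Lemma restrictM phi psi :
  (fun x => phi x * psi x) \_ D = (phi \_ D \* psi \_ D).
Proof. by apply/funext => x; rewrite /patch/=; case: ifP; rewrite ?mulr0. Qed.

Lemma restrictZ a phi :
  (fun x => a * phi x) \_ D = (fun x => a * (phi \_ D) x).
Proof. by apply/funext => x; rewrite /patch/=; case: ifP; rewrite ?mulr0. Qed.

Let mres phi : measurable_fun D phi ->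
  measurable_fun [set: T] (phi \_ D).
Proof. by case: (@measurable_restrictT _ _ T R D phi mD). Qed.

Lemma Lnorm_onD p phi psi : 1 <= p ->
  measurable_fun D phi -> measurable_fun D psi ->
  (Lnorm_on p (fun x => (phi x + psi x)%R) <= Lnorm_on p phi + Lnorm_on p psi)%E.
Proof.
move=> p1 mphi mpsi; rewrite /Lnorm_on restrictD.
by apply: eminkowski => //; exact: mres.
Qed.

Lemma Lfun_onD p phi psi : 1 <= p -> Lfun_on p phi -> Lfun_on p psi ->
  Lfun_on p (fun x => phi x + psi x).
Proof.
move=> p1 /Lfun_onE[mphi phioo] /Lfun_onE[mpsi psioo]; apply/Lfun_onE; split.
  exact: measurable_funD.
exact: le_lt_trans (Lnorm_onD p1 mphi mpsi) (lte_add_pinfty phioo psioo).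
Qed.

Lemma fLnorm_onD p phi psi : 1 <= p -> Lfun_on p phi -> Lfun_on p psi ->
  fLnorm_on p (fun x => phi x + psi x) <= fLnorm_on p phi + fLnorm_on p psi.
Proof.
move=> p1 lphi lpsi; rewrite -lee_fin EFinD -!Lnorm_on_fin//; last exact: Lfun_onD.
exact: (Lnorm_onD p1 (Lfun_on_measurable lphi) (Lfun_on_measurable lpsi)).
Qed.

Lemma Lnorm_onZ p a phi : 0 < p -> measurable_fun D phi ->
  Lnorm_on p (fun x => (a * phi x)%R) = (`|a|%:E * Lnorm_on p phi)%E.
Proof. by move=> p0 mphi; rewrite /Lnorm_on restrictZ LnormZl//; exact: mres. Qed.

Lemma Lfun_onZ p a phi : 0 < p -> Lfun_on p phi -> Lfun_on p (fun x => a * phi x).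
Proof.
move=> p0 lphi; have mphi := Lfun_on_measurable lphi.
apply/Lfun_onE; split; first exact: (@measurableT_comp _ _ _ _ _ _ ( *%R a)).
by rewrite Lnorm_onZ// Lnorm_on_fin// -EFinM ltry.
Qed.

Lemma fLnorm_onZ p a phi : 0 < p -> Lfun_on p phi ->
  fLnorm_on p (fun x => a * phi x) = `|a| * fLnorm_on p phi.
Proof.
move=> p0 lphi; apply: EFin_inj; rewrite EFinM -!Lnorm_on_fin//; last exact: Lfun_onZ.
exact: (Lnorm_onZ a p0 (Lfun_on_measurable lphi)).
Qed.

Lemma Lnorm_onM p q r phi psi : 0 < p -> 0 < q -> 0 < r -> p^-1 + q^-1 = r^-1 ->
  measurable_fun D phi -> measurable_fun D psi ->
  (Lnorm_on r (fun x => (phi x * psi x)%R) <= Lnorm_on p phi * Lnorm_on q psi)%E.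
Proof.
move=> p0 q0 r0 pqr mphi mpsi; rewrite /Lnorm_on restrictM.
by apply: hoelder_mul => //; exact: mres.
Qed.

Lemma Lfun_onM p q r phi psi : 0 < p -> 0 < q -> 0 < r -> p^-1 + q^-1 = r^-1 ->
  Lfun_on p phi -> Lfun_on q psi -> Lfun_on r (fun x => phi x * psi x).
Proof.
move=> p0 q0 r0 pqr lphi lpsi; apply/Lfun_onE.
have mphi := Lfun_on_measurable lphi; have mpsi := Lfun_on_measurable lpsi.
split; first exact: measurable_funM.
by apply: le_lt_trans (Lnorm_onM p0 q0 r0 pqr mphi mpsi) _; rewrite !Lnorm_on_fin// -EFinM ltry.
Qed.

Lemma fLnorm_onM p q r phi psi : 0 < p -> 0 < q -> 0 < r -> p^-1 + q^-1 = r^-1 ->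
  Lfun_on p phi -> Lfun_on q psi ->
  fLnorm_on r (fun x => phi x * psi x) <= fLnorm_on p phi * fLnorm_on q psi.
Proof.
move=> p0 q0 r0 pqr lphi lpsi; rewrite -lee_fin EFinM -!Lnorm_on_fin//; last first.
  exact: (Lfun_onM p0 q0 r0 pqr).
exact: (Lnorm_onM p0 q0 r0 pqr (Lfun_on_measurable lphi) (Lfun_on_measurable lpsi)).
Qed.

Lemma bounded_Lfun_on p phi (M : R) : 0 < p -> measurable_fun D phi ->
  {ae mu, forall x, D x -> `|phi x| <= M} -> Lfun_on p phi.
Proof.
move=> p0 mphi phiM; apply/Lfun_onE; split => //.
rewrite /Lnorm_on unlock /Lnorm; apply: poweR_lty.
have -> : (\int[mu]_x (`|(EFin \o phi \_ D) x| `^ p) =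
    \int[mu]_(x in D) (`|phi x| `^ p)%:E)%E.
  rewrite [RHS]integral_mkcond; apply: eq_integral => x _ /=.
  by rewrite /patch; case: ifP => //= _; rewrite normr0 powR0 ?gt_eqF.
have M0 := normr_ge0 M.
apply: (@le_lt_trans _ _ (\int[mu]_(x in D) (`|M| `^ p)%:E)%E); last first.
  by rewrite integral_cst// lte_mul_pinfty ?lee_fin ?powR_ge0//; exact: fD.
apply: ae_ge0_le_integral => //.
  apply/measurable_EFinP; apply: (@measurableT_comp _ _ _ _ _ _ (@powR R ^~ p)) => //.
  exact: measurableT_comp.
apply: ae_imp phiM => x /= phix Ox; rewrite lee_fin.
apply: ge0_ler_powR; rewrite ?nnegrE// ?(ltW p0)//.
by apply: (le_trans (phix Ox)); exact: ler_norm.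
Qed.

Lemma bounded_fLnorm_on (M p q : R) phi : Lfun_on p phi -> 0 < p -> p <= q ->
  0 <= M -> {ae mu, forall x, D x -> `|phi x| <= M} ->
  fLnorm_on q phi <= M `^ (1 - p / q) * fLnorm_on p phi `^ (p / q).
Proof.
move=> lphi p0 pq M0 phiM; have mphi := Lfun_on_measurable lphi.
have q0 := lt_le_trans p0 pq.
rewrite -lee_fin EFinM -[X in (_ * X)%E]poweR_EFin -!Lnorm_on_fin//; last exact: bounded_Lfun_on phiM.
apply: bounded_Lnorm => //; first exact: mres.
apply: ae_imp phiM => x /= phix; rewrite /patch; case: ifPn; rewrite ?normr0//.
by rewrite inE.
Qed.

Lemma Lnorm_on_le p phi psi : 0 < p -> measurable_fun D phi ->
  measurable_fun D psi ->
  {ae mu, forall x, D x -> `|phi x| <= `|psi x|} ->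
  (Lnorm_on p phi <= Lnorm_on p psi)%E.
Proof.
move=> p0 mphi mpsi phipsi; apply: le_Lnorm => //; [exact: mres|exact: mres|].
apply: ae_imp phipsi => x /= phix; rewrite /patch; case: ifPn; rewrite ?normr0//.
by rewrite inE.
Qed.

Lemma Lfun_onMb p phi psi (M : R) : 0 < p -> measurable_fun D phi ->
  {ae mu, forall x, D x -> `|phi x| <= M} ->
  Lfun_on p psi -> Lfun_on p (fun x => phi x * psi x).
Proof.
move=> p0 mphi phiM lpsi; have mpsi := Lfun_on_measurable lpsi.
apply/Lfun_onE; split; first exact: measurable_funM.
have [_] := (Lfun_onE _ _).1 (Lfun_onZ M p0 lpsi); apply: le_lt_trans.
apply: Lnorm_on_le => //; first exact: measurable_funM.
  exact: (@measurableT_comp _ _ _ _ _ _ ( *%R M)).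
apply: ae_imp phiM => x /= phix /phix phixM; rewrite !normrM ler_wpM2r//.
exact: le_trans (ler_norm _).
Qed.

Lemma Lfun_on_cst p (c : R) : 0 < p -> Lfun_on p (fun=> c).
Proof.
move=> p0; by apply: (@bounded_Lfun_on _ _ `|c|) => //; apply: aeW.
Qed.

Let conj_exponent p r : 0 < r -> r < p ->
  exists2 t, 0 < t & p^-1 + t^-1 = r^-1.
Proof.
move=> r0 rp; exists (r^-1 - p^-1)^-1; last by rewrite invrK addrC subrK.
by rewrite invr_gt0 subr_gt0 ltf_pV2 ?posrE// (lt_trans r0 rp).
Qed.

(** Hoelder's inequality against the constant [1], which belongs to every L^t because [D] has finite
    measure; here 1/t = 1/r - 1/p. The constant of the next lemma is the L^t norm of [1]. *)
Lemma Lfun_on_le p r phi : 0 < r -> r <= p -> Lfun_on p phi -> Lfun_on r phi.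
Proof.
move=> r0; rewrite le_eqVlt => /predU1P[->//|rp] lphi.
have [t t0 tE] := conj_exponent r0 rp.
have := Lfun_onM (lt_trans r0 rp) t0 r0 tE lphi (Lfun_on_cst 1 t0).
by under eq_fun do rewrite mulr1.
Qed.

Lemma fLnorm_on_le p r : 0 < r -> r <= p -> exists2 C : R, 0 <= C &
  forall phi, Lfun_on p phi -> fLnorm_on r phi <= C * fLnorm_on p phi.
Proof.
move=> r0; rewrite le_eqVlt => /predU1P[->|rp].
  by exists 1 => // phi _; rewrite mul1r.
have [t t0 tE] := conj_exponent r0 rp.
exists (fLnorm_on t (fun=> 1)); first exact: fLnorm_on_ge0.
move=> phi lphi.
have := fLnorm_onM (lt_trans r0 rp) t0 r0 tE lphi (Lfun_on_cst 1 t0).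
by under eq_fun do rewrite mulr1; rewrite mulrC.
Qed.

Lemma ae_eq_Lnorm_on p phi psi : measurable_fun D phi ->
  measurable_fun D psi ->
  {ae mu, forall x, D x -> phi x = psi x} -> Lnorm_on p phi = Lnorm_on p psi.
Proof.
move=> mphi mpsi phipsi; apply: ae_eq_Lnorm; [exact: mres|exact: mres|].
apply: ae_imp phipsi => x /= phix; rewrite /patch; case: ifPn => //.
by rewrite inE => /phix.
Qed.

Lemma ae_eq_Lfun_on p phi psi : measurable_fun D psi ->
  {ae mu, forall x, D x -> phi x = psi x} ->
  Lfun_on p phi -> Lfun_on p psi.
Proof.
move=> mpsi phipsi /Lfun_onE[mphi phioo]; apply/Lfun_onE; split => //.
by rewrite -(ae_eq_Lnorm_on p mphi mpsi phipsi).
Qed.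

Lemma Lfun_on1_integrable phi :
  Lfun_on 1 phi -> mu.-integrable D (EFin \o phi).
Proof.
move/Lfun1_integrable => h; apply/integrable_mkcond => //.
by rewrite restrict_EFin.
Qed.

Lemma le_norm_int_on phi : Lfun_on 1 phi ->
  `|int_on phi| <= fLnorm_on 1 phi.
Proof.
move=> lphi; apply: le_trans (le_normr_Rintegral _ (Lfun_on1_integrable lphi)) _ => //.
rewrite le_eqVlt; apply/orP; left; apply/eqP; congr fine.
rewrite /Lnorm_on Lnorm1 integral_mkcond; apply: eq_integral => x _.
by rewrite /= /patch; case: ifP => //=; rewrite normr0.
Qed.

Lemma int_onD phi psi : Lfun_on 1 phi -> Lfun_on 1 psi ->
  int_on (fun x => phi x + psi x) = int_on phi + int_on psi.
Proof. by move=> ? ?; apply: RintegralD => //; exact: Lfun_on1_integrable. Qed.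

Lemma int_onZ a phi : Lfun_on 1 phi ->
  int_on (fun x => a * phi x) = a * int_on phi.
Proof. by move=> ?; apply: RintegralZl => //; exact: Lfun_on1_integrable. Qed.

Lemma Lfun_on_sum p (I : Type) (r : seq I) (F : I -> T -> R) : 1 <= p ->
  (forall i, Lfun_on p (F i)) -> Lfun_on p (fun x => \sum_(i <- r) F i x).
Proof.
move=> p1 lF; have p0 : 0 < p := lt_le_trans ltr01 p1.
elim: r => [|i r ih].
  by under eq_fun do rewrite big_nil; exact: Lfun_on_cst.
by under eq_fun do rewrite big_cons; exact: Lfun_onD.
Qed.

Lemma fLnorm_on_sum p (I : Type) (r : seq I) (F : I -> T -> R) : 1 <= p ->
  (forall i, Lfun_on p (F i)) ->
  fLnorm_on p (fun x => \sum_(i <- r) F i x) <= \sum_(i <- r) fLnorm_on p (F i).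
Proof.
move=> p1 lF; have p0 : 0 < p := lt_le_trans ltr01 p1.
elim: r => [|i r ih].
  rewrite big_nil; have -> : (fun x => \sum_(j <- [::]) F j x) = (fun=> 0).
    by apply/funext => x; rewrite big_nil.
  by have := fLnorm_onZ 0 p0 (Lfun_on_cst 0 p0); rewrite normr0 !mul0r => ->.
rewrite big_cons.
have -> : (fun x => \sum_(j <- i :: r) F j x) = (fun x => F i x + \sum_(j <- r) F j x).
  by apply/funext => x; rewrite big_cons.
by apply: le_trans (fLnorm_onD p1 (lF i) (Lfun_on_sum r p1 lF)) _; rewrite lerD2l.
Qed.

End Lnorm_on_set.

Lemma cover_outer_le {R : realType} {T : Type} (zeta : set T -> \bar R) (A : set T) :
  zeta set0 = 0%E -> (cover_outer zeta A <= zeta A)%E.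
Proof.
move=> z0; apply: ereal_inf_lbound; exists (fun k => if k == 0%N then A else set0).
  by move=> x Ax; exists 0%N.
apply/cvg_lim => //; rewrite -(cvg_shiftn 1)/=; apply: cvg_near_cst.
apply: nearW => k; rewrite addn1 big_nat_recl//= big1 ?adde0//.
Qed.

(** * Algebra of the remainder estimates *)

Section real_algebra.
Context {R : realType}.
Implicit Types (a b c e x : R).

Lemma comb3 a (A B C A' B' C' : R) :
  (a * A + A') + (a * B + B') + (a * C + C') = a * (A + B + C) + (A' + B' + C').
Proof. by ring. Qed.

Lemma norm3_le (A B C e x : R) : `|A| <= e / 3 * x -> `|B| <= e / 3 * x ->
  `|C| <= e / 3 * x -> `|A + B + C| <= e * x.
Proof.
move=> hA hB hC; apply: (le_trans (ler_normD _ _)).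
by apply: (le_trans (lerD (ler_normD _ _) (lexx _))); lra.
Qed.

Lemma norm_sum3_le (A B C a b c x : R) : `|A| <= a * x -> `|B| <= b * x ->
  `|C| <= c * x -> `|A + B + C| <= (a + b + c) * x.
Proof.
move=> hA hB hC; apply: (le_trans (ler_normD _ _)).
by apply: (le_trans (lerD (ler_normD _ _) (lexx _))); rewrite !mulrDl; lra.
Qed.

Lemma norm_sum2_le (A B a b c x : R) : `|A| <= a * x -> `|B| <= b * x ->
  0 <= x -> a + b <= c -> `|A + B| <= c * x.
Proof.
move=> hA hB x0 hc; apply: (le_trans (ler_normD _ _)).
by apply: (le_trans (lerD hA hB)); rewrite -mulrDl; exact: ler_wpM2r.
Qed.

(** Primed quantities refer to the linearised state at [u + eta], the others to that at [u]. [X]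
    stands for F' at the new state, [Yz] and [Yz'] for F' at the old one; a leading [q] marks values
    of F'' and a leading [w] integrals with the adjoint state. The hypothesis is the adjoint
    identity. The three groups on the right are the remainder of F', the remainders inside the
    integrals, and those inside F''. *)
Lemma derivative_algebra (X qdz' qdz qez wz we Yz' Yz wz' wd : R) :
  Yz' - Yz = wz' + wd ->
  X - Yz - (qez + wz + we) =
  (X - Yz' - qdz') + ((wz' - wz) + (wd - we)) + ((qdz' - qdz) + (qdz - qez)).
Proof.
move=> h; have -> : Yz = Yz' - (wz' + wd) by rewrite -h; ring.
by ring.
Qed.

Lemma prod_le (D a b A B : R) : 0 <= D -> 0 <= a -> 0 <= b -> a <= A -> b <= B ->
  D * a * b <= D * A * B.
Proof.
by move=> D0 a0 b0 aA bB; apply: ler_pM => //; [exact: mulr_ge0|exact: ler_wpM2l].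
Qed.

Lemma half_gt0 (e : R) : 0 < e -> 0 < e / 2.
Proof. by move=> e0; rewrite divr_gt0. Qed.

Lemma quotient_lt (e x y : R) : 0 < e -> 0 < y -> `|x| <= e / 2 * y -> `|x / y| < e.
Proof.
move=> e0 y0 h; rewrite normrM normfV (gtr0_norm y0) ltr_pdivrMr//.
apply: (le_lt_trans h); rewrite ltr_pM2r//; lra.
Qed.

Lemma first_order_algebra (X Q C N : R) : `|X - 2^-1 * Q| <= 1 * N ^+ 2 ->
  `|Q| <= C * N * N -> 0 <= N -> `|X| <= (1 + `|C|) * N * N.
Proof.
move=> h1 h2 N0.
have h3 : C * N * N <= `|C| * N * N by rewrite !ler_wpM2r// ler_norm.
have h4 : `|X| <= `|X - 2^-1 * Q| + `|2^-1 * Q|.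
  by rewrite -[X in `|X| <= _](subrK (2^-1 * Q)) ler_normD.
rewrite normrM ger0_norm ?invr_ge0// in h4.
have := normr_ge0 Q; lra.
Qed.

Lemma half_sum_le (A B c : R) : `|A| <= c -> `|B| <= c -> `|2^-1 * (A + B)| <= c.
Proof.
move=> hA hB; rewrite normrM ger0_norm ?invr_ge0//.
by have := ler_normD A B; lra.
Qed.

(** [d] stands for the full increment of the state and [z] for its linearisation. The right-hand
    side is the Taylor remainder of [F] at [d] plus the cost of replacing [d] by [z] in the first-
    and in the second-order term. The two equal integrals of the second derivative, halved, make up
    the single [wz]. *)
Lemma second_order_algebra (Fd Fy dFd dFz qdd qdz qzz wd wz : R) : dFd - dFz = wd ->
  Fd - Fy - dFz - 2^-1 * (qzz + wz + wz) =
  (Fd - Fy - dFd - 2^-1 * qdd) + (wd - wz) + 2^-1 * ((qdd - qdz) + (qdz - qzz)).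
Proof. by move=> <-; field. Qed.

(** The tolerances of the form [e / (x + 1)] used for the remainders rest on this: with [x + 1] in
    the denominator a vanishing constant [x] needs no separate case. *)
Lemma frac_le (e x : R) : 0 < e -> 0 <= x -> e / (x + 1) * x <= e.
Proof.
move=> e0 x0; rewrite -mulrA -[leRHS]mulr1; apply: ler_wpM2l; first exact: ltW.
by rewrite mulrC ler_pdivrMr; lra.
Qed.

Lemma frac_gt0 (e x : R) : 0 < e -> 0 <= x -> 0 < e / (x + 1).
Proof. by move=> e0 x0; apply: divr_gt0 => //; lra. Qed.

End real_algebra.

(** * Sobolev functions on the domain *)

Section Lp_domain.
Context {R : realType} {n : nat}.
Local Notation E := 'rV[R]_n.+1.
Local Notation T := (caratheodory_type (leb_om R n)).
Local Notation mu := (leb R n).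
Variable Omega : set E.
Hypotheses (oO : open Omega) (bO : ebounded Omega).
Implicit Types (phi psi : E -> R) (p q r : R).

Lemma open_leb_measurable (U : set E) : open U -> measurable (U : set T).
Proof. by apply: open_caratheodory => i c; exact: leb_half_space. Qed.

Lemma continuous_leb_measurable (D : set E) phi : measurable (D : set T) ->
  continuous phi -> measurable_fun (D : set T) phi.
Proof. by apply: continuous_caratheodory => i c; exact: leb_half_space. Qed.

Let mO : measurable (Omega : set T) := open_leb_measurable oO.

Lemma leb_bounded : (mu Omega < +oo)%E.
Proof.
have [M hM] := bO.
apply: (@le_lt_trans _ _ (box_gauge Omega)).
  exact/cover_outer_le/box_gauge0.
(* Boxes of the gauge are open and [M] may be negative, hence the absolute value and the margin
   [1]. *)
pose b : E := const_mx (`|M| + 1).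
apply: (@le_lt_trans _ _ (\prod_(i < n.+1) (b 0 i - (- b) 0 i))%:E); last exact: ltry.
apply: box_gauge_le => [i|x Ox i]; rewrite !mxE; first by have := normr_ge0 M; lra.
rewrite -ltr_norml; have := coord_le_enorm x i.
by have := hM x Ox; have := ler_norm M; lra.
Qed.

(* [inLp], [eLp] and [normLp] are convertible to [Lfun_on], [Lnorm_on] and
   [fLnorm_on]. *)
Lemma inLp_measurable p phi : inLp Omega p phi -> measurable_fun (Omega : set T) phi.
Proof. exact: (@Lfun_on_measurable _ T R mu Omega mO). Qed.

Lemma eLp_ge0 p phi : (0 <= eLp Omega p phi)%E.
Proof. exact: (@Lnorm_on_ge0 _ T R mu Omega). Qed.

Lemma normLp_ge0 p phi : 0 <= normLp Omega p phi.
Proof. exact: (@fLnorm_on_ge0 _ T R mu Omega). Qed.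

Lemma eLp_fin p phi : inLp Omega p phi -> eLp Omega p phi = (normLp Omega p phi)%:E.
Proof. exact: (@Lnorm_on_fin _ T R mu Omega mO). Qed.

Lemma eLpD p phi psi : 1 <= p ->
  measurable_fun (Omega : set T) phi -> measurable_fun (Omega : set T) psi ->
  (eLp Omega p (fun x => (phi x + psi x)%R) <= eLp Omega p phi + eLp Omega p psi)%E.
Proof. exact: (@Lnorm_onD _ T R mu Omega mO). Qed.

Lemma inLpD p phi psi : 1 <= p -> inLp Omega p phi -> inLp Omega p psi ->
  inLp Omega p (fun x => phi x + psi x).
Proof. exact: (@Lfun_onD _ T R mu Omega mO). Qed.

Lemma normLpD p phi psi : 1 <= p -> inLp Omega p phi -> inLp Omega p psi ->
  normLp Omega p (fun x => phi x + psi x) <= normLp Omega p phi + normLp Omega p psi.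
Proof. exact: (@fLnorm_onD _ T R mu Omega mO). Qed.

Lemma eLpZ p a phi : 0 < p -> measurable_fun (Omega : set T) phi ->
  eLp Omega p (fun x => (a * phi x)%R) = (`|a|%:E * eLp Omega p phi)%E.
Proof. exact: (@Lnorm_onZ _ T R mu Omega mO). Qed.

Lemma inLpZ p a phi : 0 < p -> inLp Omega p phi -> inLp Omega p (fun x => a * phi x).
Proof. exact: (@Lfun_onZ _ T R mu Omega mO). Qed.

Lemma normLpZ p a phi : 0 < p -> inLp Omega p phi ->
  normLp Omega p (fun x => a * phi x) = `|a| * normLp Omega p phi.
Proof. exact: (@fLnorm_onZ _ T R mu Omega mO). Qed.

Lemma inLpM p q r phi psi : 0 < p -> 0 < q -> 0 < r -> p^-1 + q^-1 = r^-1 ->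
  inLp Omega p phi -> inLp Omega q psi -> inLp Omega r (fun x => phi x * psi x).
Proof. exact: (@Lfun_onM _ T R mu Omega mO). Qed.

Lemma normLpM p q r phi psi : 0 < p -> 0 < q -> 0 < r -> p^-1 + q^-1 = r^-1 ->
  inLp Omega p phi -> inLp Omega q psi ->
  normLp Omega r (fun x => phi x * psi x) <= normLp Omega p phi * normLp Omega q psi.
Proof. exact: (@fLnorm_onM _ T R mu Omega mO). Qed.

Lemma bounded_inLp p phi (M : R) : 0 < p -> measurable_fun (Omega : set T) phi ->
  {ae mu, forall x, Omega x -> `|phi x| <= M} -> inLp Omega p phi.
Proof. exact: (@bounded_Lfun_on _ T R mu Omega mO leb_bounded). Qed.

Lemma bounded_normLp (M p q : R) phi : inLp Omega p phi -> 0 < p -> p <= q ->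
  0 <= M -> {ae mu, forall x, Omega x -> `|phi x| <= M} ->
  normLp Omega q phi <= M `^ (1 - p / q) * normLp Omega p phi `^ (p / q).
Proof. exact: (@bounded_fLnorm_on _ T R mu Omega mO leb_bounded). Qed.

Lemma inLpMb p phi psi (M : R) : 0 < p -> measurable_fun (Omega : set T) phi ->
  {ae mu, forall x, Omega x -> `|phi x| <= M} ->
  inLp Omega p psi -> inLp Omega p (fun x => phi x * psi x).
Proof. exact: (@Lfun_onMb _ T R mu Omega mO). Qed.

Lemma inLp_cst p (c : R) : 0 < p -> inLp Omega p (fun=> c).
Proof. exact: (@Lfun_on_cst _ T R mu Omega mO leb_bounded). Qed.

Lemma inLp_le p r phi : 0 < r -> r <= p -> inLp Omega p phi -> inLp Omega r phi.
Proof. exact: (@Lfun_on_le _ T R mu Omega mO leb_bounded). Qed.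

Lemma normLp_le p r : 0 < r -> r <= p -> exists2 C : R, 0 <= C &
  forall phi, inLp Omega p phi -> normLp Omega r phi <= C * normLp Omega p phi.
Proof. exact: (@fLnorm_on_le _ T R mu Omega mO leb_bounded). Qed.

Lemma ae_eq_eLp p phi psi : measurable_fun (Omega : set T) phi ->
  measurable_fun (Omega : set T) psi ->
  {ae mu, forall x, Omega x -> phi x = psi x} -> eLp Omega p phi = eLp Omega p psi.
Proof. exact: (@ae_eq_Lnorm_on _ T R mu Omega mO). Qed.

Lemma ae_eq_inLp p phi psi : measurable_fun (Omega : set T) psi ->
  {ae mu, forall x, Omega x -> phi x = psi x} ->
  inLp Omega p phi -> inLp Omega p psi.
Proof. exact: (@ae_eq_Lfun_on _ T R mu Omega mO). Qed.

Lemma le_norm_int_Omega phi : inLp Omega 1 phi ->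
  `|int_Omega Omega phi| <= normLp Omega 1 phi.
Proof. exact: (@le_norm_int_on _ T R mu Omega mO). Qed.

Lemma int_OmegaD phi psi : inLp Omega 1 phi -> inLp Omega 1 psi ->
  int_Omega Omega (fun x => phi x + psi x) = int_Omega Omega phi + int_Omega Omega psi.
Proof. exact: (@int_onD _ T R mu Omega mO). Qed.

Lemma int_OmegaZ a phi : inLp Omega 1 phi ->
  int_Omega Omega (fun x => a * phi x) = a * int_Omega Omega phi.
Proof. exact: (@int_onZ _ T R mu Omega mO). Qed.

Lemma inLp_sum p (I : Type) (r : seq I) (F : I -> E -> R) : 1 <= p ->
  (forall i, inLp Omega p (F i)) -> inLp Omega p (fun x => \sum_(i <- r) F i x).
Proof. exact: (@Lfun_on_sum _ T R mu Omega mO leb_bounded). Qed.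

Lemma normLp_sum p (I : Type) (r : seq I) (F : I -> E -> R) : 1 <= p ->
  (forall i, inLp Omega p (F i)) ->
  normLp Omega p (fun x => \sum_(i <- r) F i x) <= \sum_(i <- r) normLp Omega p (F i).
Proof. exact: (@fLnorm_on_sum _ T R mu Omega mO leb_bounded). Qed.

Lemma continuous_bounded phi : continuous phi ->
  exists M : R, forall x, Omega x -> `|phi x| <= M.
Proof.
move=> cphi; have [M hM] := bO.
pose K : set E := [set x | forall i, `[- M, M]%classic (x 0 i)].
have cK : compact K.
  apply: (@rV_compact _ _ (fun=> `[- M, M]%classic)) => _.
  exact: segment_compact.
have /compact_bounded[N [_ hN]] : compact (phi @` K).
  by apply: continuous_compact cK; exact: continuous_subspaceT.
exists (N + 1) => x Ox; apply: (hN (N + 1)); first by rewrite ltrDl.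
exists x => // i; rewrite /= in_itv /= -ler_norml.
exact: le_trans (coord_le_enorm x i) (hM x Ox).
Qed.

(** * Vector fields with components in L^p *)

Section fields.
Implicit Types (g h : E -> E).

Definition inLpv p g : Prop := forall i : 'I_n.+1, inLp Omega p (fun x => g x 0 i).
Definition normLpv p g : R := \sum_(i < n.+1) normLp Omega p (fun x => g x 0 i).

Lemma normLpv_ge0 p g : 0 <= normLpv p g.
Proof. by apply: sumr_ge0 => i _; exact: normLp_ge0. Qed.

Lemma inLpvP p a g h : 1 <= p -> inLpv p g -> inLpv p h ->
  inLpv p (fun x => a *: g x + h x).
Proof.
move=> p1 lg lh i; have p0 : 0 < p := lt_le_trans ltr01 p1.
under eq_fun do rewrite !mxE.
by apply: inLpD => //; exact: inLpZ.
Qed.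

Lemma normLpvP p (a : R) g h : 1 <= p -> inLpv p g -> inLpv p h ->
  normLpv p (fun x => a *: g x + h x) <= `|a| * normLpv p g + normLpv p h.
Proof.
move=> p1 lg lh; have p0 : 0 < p := lt_le_trans ltr01 p1.
rewrite /normLpv mulr_sumr -big_split; apply: ler_sum => i _ /=.
rewrite -(normLpZ a p0 (lg i)).
have -> : (fun x => (a *: g x + h x) 0 i) = (fun x => a * g x 0 i + h x 0 i).
  by apply/funext => x; rewrite !mxE.
exact: (normLpD p1 (inLpZ a p0 (lg i)) (lh i)).
Qed.

Lemma inLpv_scale p q r phi g : 0 < p -> 0 < q -> 0 < r -> p^-1 + q^-1 = r^-1 ->
  inLp Omega p phi -> inLpv q g -> inLpv r (fun x => phi x *: g x).
Proof.
move=> p0 q0 r0 pqr lphi lg i; under eq_fun do rewrite mxE.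
exact: (inLpM p0 q0 r0 pqr).
Qed.

Lemma normLpv_scale p q r phi g : 0 < p -> 0 < q -> 0 < r -> p^-1 + q^-1 = r^-1 ->
  inLp Omega p phi -> inLpv q g ->
  normLpv r (fun x => phi x *: g x) <= normLp Omega p phi * normLpv q g.
Proof.
move=> p0 q0 r0 pqr lphi lg; rewrite /normLpv mulr_sumr; apply: ler_sum => i _.
under eq_fun do rewrite mxE.
exact: (normLpM p0 q0 r0 pqr).
Qed.

Lemma inLpv_le p r g : 0 < r -> r <= p -> inLpv p g -> inLpv r g.
Proof. by move=> r0 rp lg i; exact: (inLp_le r0 rp). Qed.

Lemma edotC (x y : E) : edot x y = edot y x.
Proof. by apply: eq_bigr => i _; rewrite mulrC. Qed.

Lemma edotPl (a : R) (x y z : E) : edot (a *: x + y) z = a * edot x z + edot y z.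
Proof.
rewrite /edot mulr_sumr -big_split; apply: eq_bigr => i _ /=.
by rewrite !mxE mulrDl mulrA.
Qed.

Lemma edotPr (a : R) (x y z : E) : edot z (a *: x + y) = a * edot z x + edot z y.
Proof. by rewrite edotC edotPl !(edotC z). Qed.

Lemma edotZl (a : R) (x z : E) : edot (a *: x) z = a * edot x z.
Proof. by rewrite /edot mulr_sumr; apply: eq_bigr => i _; rewrite mxE mulrA. Qed.

Lemma inL1_edot p q g h : 0 < p -> 0 < q -> p^-1 + q^-1 = 1 ->
  inLpv p g -> inLpv q h -> inLp Omega 1 (fun x => edot (g x) (h x)).
Proof.
move=> p0 q0 pq lg lh; apply: inLp_sum => // i.
by apply: (inLpM p0 q0 ltr01); rewrite ?invr1.
Qed.

Lemma norm_int_edot p q g h : 0 < p -> 0 < q -> p^-1 + q^-1 = 1 ->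
  inLpv p g -> inLpv q h ->
  `|int_Omega Omega (fun x => edot (g x) (h x))| <= normLpv p g * normLpv q h.
Proof.
move=> p0 q0 pq lg lh; apply: le_trans (le_norm_int_Omega (inL1_edot p0 q0 pq lg lh)) _.
have lgh i : inLp Omega 1 (fun x => g x 0 i * h x 0 i).
  by apply: (inLpM p0 q0 ltr01); rewrite ?invr1.
apply: le_trans (normLp_sum _ _ lgh) _ => //.
rewrite /normLpv mulr_suml; apply: ler_sum => i _.
apply: (@le_trans _ _ (normLp Omega p (fun x => g x 0 i) * normLp Omega q (fun x => h x 0 i))).
  by apply: (normLpM p0 q0 ltr01); rewrite ?invr1.
rewrite ler_wpM2l ?normLp_ge0// (bigD1 i)//= lerDl.
by apply: sumr_ge0 => j _; exact: normLp_ge0.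
Qed.

End fields.

Lemma eW1p_fin p w : W1p Omega p w ->
  eW1p Omega p w = (normLp Omega p w.1 + normLpv p (grad w))%:E.
Proof.
move=> [lw lgw _]; rewrite /eW1p EFinD eLp_fin// /normLpv -sumEFin.
by congr (_ + _)%E; apply: eq_bigr => i _; rewrite eLp_fin.
Qed.

Lemma normW1pE p w : W1p Omega p w ->
  normW1p Omega p w = normLp Omega p w.1 + normLpv p (grad w).
Proof. by move=> ww; rewrite /normW1p eW1p_fin. Qed.

Lemma normW1p_ge0 p w : 0 <= normW1p Omega p w.
Proof.
apply: fine_ge0; apply: adde_ge0; first exact: eLp_ge0.
by apply: sume_ge0 => i _; exact: eLp_ge0.
Qed.

Lemma normLpv_grad p w : W1p Omega p w -> normLpv p (grad w) <= normW1p Omega p w.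
Proof. by move=> /normW1pE ->; rewrite lerDr normLp_ge0. Qed.

Lemma grad_inLpv p w : W1p Omega p w -> inLpv p (grad w).
Proof. by case. Qed.

Lemma normW1p0 p : 0 < p -> normW1p Omega p 0 = 0.
Proof.
move=> p0; have e0 : eLp Omega p (fun=> 0) = 0%E.
  rewrite (eLp_fin (inLp_cst 0 p0)); apply: (congr1 EFin (y := 0)).
  by have := normLpZ 0 p0 (inLp_cst 0 p0); rewrite normr0 !mul0r.
rewrite /normW1p /eW1p [X in (X + _)%E]e0 add0e big1// => i _.
by rewrite [X in eLp _ _ X](_ : _ = fun=> 0)//; apply/funext => x; rewrite mxE.
Qed.

Lemma normW1pP p (a : R) v w : 1 <= p -> W1p Omega p v -> W1p Omega p w ->
  W1p Omega p (a *: v + w) ->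
  normW1p Omega p (a *: v + w) <= `|a| * normW1p Omega p v + normW1p Omega p w.
Proof.
move=> p1 wv ww wvw; have p0 : 0 < p := lt_le_trans ltr01 p1.
have [lv lgv _] := wv; have [lw lgw _] := ww.
rewrite !normW1pE// mulrDr addrACA; apply: lerD.
  rewrite -normLpZ//; apply: (normLpD (phi := fun x => a * v.1 x)) => //.
  exact: inLpZ.
rewrite /normLpv mulr_sumr -big_split; apply: ler_sum => i _ /=.
rewrite -normLpZ//.
rewrite [X in normLp _ _ X](_ : _ = fun x => a * grad v x 0 i + grad w x 0 i); last first.
  by apply/funext => x; rewrite !mxE.
by apply: (normLpD (phi := fun x => a * grad v x 0 i)) => //; exact: inLpZ.
Qed.

Lemma inL1_test p phi psi : 1 <= p -> inLp Omega p phi -> continuous psi ->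
  inLp Omega 1 (fun x => phi x * psi x).
Proof.
move=> p1 lphi cpsi; have [M hM] := continuous_bounded cpsi.
under eq_fun do rewrite mulrC; apply: (@inLpMb _ _ _ M ltr01).
- exact: (continuous_leb_measurable mO cpsi).
- exact: aeW.
- exact: inLp_le p1 lphi.
Qed.

Lemma W1pP p (a : R) v w : 1 <= p -> W1p Omega p v -> W1p Omega p w ->
  W1p Omega p (a *: v + w).
Proof.
move=> p1 [lv lgv wv] [lw lgw ww]; have p0 : 0 < p := lt_le_trans ltr01 p1.
split.
- by apply: (@inLpD _ (fun x => a * v.1 x)) => //; exact: inLpZ.
- exact: inLpvP.
move=> phi i Cphi sphi.
have cphi : continuous phi by have [] := Cphi [::].
have cdphi : continuous (pderiv i phi) by have [_ /(_ i)[]] := Cphi [::].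
transitivity (int_Omega Omega (fun x => a * (v.1 x * pderiv i phi x) + w.1 x * pderiv i phi x)).
  by congr int_Omega; apply/funext => x; rewrite /= mulrDl mulrA.
rewrite int_OmegaD ?int_OmegaZ; [|exact: (inL1_test p1)|
  by apply: inLpZ => //; exact: (inL1_test p1)|exact: (inL1_test p1)].
rewrite wv// ww//.
transitivity (- int_Omega Omega (fun x => a * (grad v x 0 i * phi x) + grad w x 0 i * phi x)).
  rewrite int_OmegaD ?int_OmegaZ; [|exact: (inL1_test p1 (lgv i))|
    by apply: inLpZ => //; exact: (inL1_test p1 (lgv i))|exact: (inL1_test p1 (lgw i))].
  by rewrite opprD mulrN.
by congr (- int_Omega _ _); apply/funext => x; rewrite !mxE mulrDl mulrA.
Qed.

Lemma int_Omega0 : int_Omega Omega (fun=> 0) = 0.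
Proof. by rewrite /int_Omega /Rintegral integral0. Qed.

Lemma W1p_0 p : 0 < p -> W1p Omega p 0.
Proof.
move=> p0; split; first exact: inLp_cst.
  by move=> i; under eq_fun do rewrite mxE; exact: inLp_cst.
move=> phi i _ _.
transitivity (int_Omega Omega (fun=> 0)).
  by congr int_Omega; apply/funext => x; rewrite mul0r.
transitivity (- int_Omega Omega (fun=> 0 : R)); first by rewrite int_Omega0 oppr0.
congr (- int_Omega _ _).
by apply/funext => x; rewrite mxE mul0r.
Qed.

(** * Linearity of the trace *)

Section traces.
Local Notation S := (caratheodory_type (haus_om R n)).

Lemma open_surf_measurable (U : set E) : open U -> measurable (U : set S).
Proof. by apply: open_caratheodory => i c; exact: haus_half_space. Qed.

Lemma bdry_surf_measurable : measurable (bdry Omega : set S).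
Proof.
apply: (@measurableD _ S); last by apply: open_surf_measurable; exact: open_interior.
rewrite -[closure _]setCK; apply: (@measurableC _ S); apply: open_surf_measurable.
by apply: closed_openC; exact: closed_closure.
Qed.

Lemma C1P (a : R) phi psi : C1 phi -> C1 psi -> C1 (fun x => a * phi x + psi x) /\
  forall i x, pderiv i (fun x => a * phi x + psi x) x = a * pderiv i phi x + pderiv i psi x.
Proof.
move=> [cphi dphi] [cpsi dpsi].
have dE i x : pderiv i (fun x => a * phi x + psi x) x = a * pderiv i phi x + pderiv i psi x.
  have [d1 _] := dphi i; have [d2 _] := dpsi i.
  rewrite /pderiv -[fun x => _]/((a \*: phi) + psi) deriveD ?deriveZ//.
  exact: derivableZ.
split=> //; split.
  move=> x; apply: (@cvgD _ _ _ (nbhs x) _ (a \*: phi)); last exact: cpsi.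
  by apply: cvgZl_tmp; exact: cphi.
move=> i; have [d1 c1] := dphi i; have [d2 c2] := dpsi i; split.
  by move=> x; apply: (@derivableD _ _ _ (a \*: phi)) => //; exact: derivableZ.
rewrite (funext (dE i)) => x.
apply: (@cvgD _ _ _ (nbhs x) _ (a \*: pderiv i phi)); last exact: c2.
by apply: cvgZl_tmp; exact: c1.
Qed.

(** Measurability is all that the triangle inequality for the extended norm [eW1p] requires, so
    nothing about the integrability of the approximants in [is_trace] has to be established. *)
Definition measurable_sob (w : @sob R n) : Prop :=
  measurable_fun (Omega : set T) w.1 /\
  forall i, measurable_fun (Omega : set T) (fun x => grad w x 0 i).

Lemma eW1pP p (a : R) (v w : @sob R n) : 1 <= p -> measurable_sob v -> measurable_sob w ->
  (eW1p Omega p (a *: v + w)%R <= `|a|%:E * eW1p Omega p v + eW1p Omega p w)%E.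
Proof.
move=> p1 [mv mgv] [mw mgw]; have p0 : 0 < p := lt_le_trans ltr01 p1.
have ma (f : E -> R) : measurable_fun (Omega : set T) f ->
    measurable_fun (Omega : set T) (fun x => a * f x).
  exact: (@measurableT_comp _ _ _ _ _ _ ( *%R a)).
have sum_ge0 u : (0 <= \sum_(i < n.+1) eLp Omega p (fun x => grad u x 0 i)%R)%E.
  by apply: sume_ge0 => i _; exact: eLp_ge0.
rewrite /eW1p ge0_muleDr ?eLp_ge0// addeACA; apply: leeD.
  by rewrite -(eLpZ a p0 mv); exact: (eLpD p1 (ma _ mv) mw).
rewrite ge0_sume_distrr; last by move=> i _; exact: eLp_ge0.
rewrite -big_split; apply: lee_sum => i _ /=.
rewrite -(eLpZ a p0 (mgv i)).
rewrite [X in (eLp _ _ X <= _)%E](_ : _ = fun x => a * grad v x 0 i + grad w x 0 i); last first.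
  by apply/funext => x; rewrite !mxE.
exact: (eLpD p1 (ma _ (mgv i)) (mgw i)).
Qed.

Lemma cvg0_lin (a : R) (u v w : nat -> \bar R) : (forall k, 0 <= u k)%E ->
  (forall k, u k <= `|a|%:E * v k + w k)%E ->
  v @ \oo --> 0%E -> w @ \oo --> 0%E -> u @ \oo --> 0%E.
Proof.
move=> u0 uvw v0 w0.
apply: (@squeeze_cvge _ _ _ _ (fun=> 0%E) _ (fun k => `|a|%:E * v k + w k)%E).
- by apply: nearW => k; rewrite u0 uvw.
- exact: cvg_cst.
- rewrite -[X in _ --> X](_ : `|a|%:E * 0 + 0 = 0)%E; last by rewrite mule0 adde0.
  by apply: cvgeD; [rewrite mule0 fin_num_adde_defl|exact: cvgeZl|exact: w0].
Qed.

(** The same linear combination of the two approximating sequences works; both convergences follow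
    from triangle inequalities, in the extended W^{1,1} norm and in L^1 of the boundary. The latter
    uses that the boundary is measurable for the surface measure. *)
Lemma is_traceP (a : R) v w g h : measurable_sob v -> measurable_sob w ->
  is_trace Omega v g -> is_trace Omega w h ->
  is_trace Omega (a *: v + w) (fun x => a * g x + h x).
Proof.
move=> mv mw [mg [phi [Cphi phiv phig]]] [mh [psi [Cpsi psiw psih]]].
have ma (f : E -> R) : measurable_fun (bdry Omega : set S) f ->
    measurable_fun (bdry Omega : set S) (fun x => a * f x).
  exact: (@measurableT_comp _ _ _ _ _ _ ( *%R a)).
split; first exact: (measurable_funD (ma _ mg) mh).
exists (fun k x => a * phi k x + psi k x).
have msub u f : measurable_sob u -> C1 f -> measurable_sob (u - (f, egrad f) : sob).
  move=> [mu1 mu2] [cf df]; split.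
    exact: (measurable_funB mu1 (continuous_leb_measurable mO cf)).
  move=> i; have [_ cdf] := df i.
  rewrite [X in measurable_fun _ X](_ : _ = fun x => grad u x 0 i - pderiv i f x); last first.
    by apply/funext => x; rewrite !mxE.
  exact: (measurable_funB (mu2 i) (continuous_leb_measurable mO cdf)).
split.
- by move=> k; have [] := C1P a (Cphi k) (Cpsi k).
- apply: (cvg0_lin _ _ phiv psiw) => k.
    apply: adde_ge0; first exact: eLp_ge0.
    by apply: sume_ge0 => i _; exact: eLp_ge0.
  have [_ dE] := C1P a (Cphi k) (Cpsi k).
  have pairE : ((fun x => a * phi k x + psi k x), egrad (fun x => a * phi k x + psi k x)) =
      a *: ((phi k, egrad (phi k)) : sob) + ((psi k, egrad (psi k)) : sob) :> sob.
    change (((fun x => a * phi k x + psi k x), egrad (fun x => a * phi k x + psi k x)) =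
      ((fun x => a * phi k x + psi k x), (fun x => a *: egrad (phi k) x + egrad (psi k) x))).
    by f_equal; apply/funext => x; apply/rowP => i; rewrite !mxE dE.
  rewrite pairE opprD addrACA -scalerBr.
  exact: (eW1pP a (lexx 1) (msub _ _ mv (Cphi k)) (msub _ _ mw (Cpsi k))).
- apply: (cvg0_lin _ _ phig psih) => k; first exact: integral_ge0.
  have mf (f q : E -> R) : C1 f -> measurable_fun (bdry Omega : set S) q ->
      measurable_fun (bdry Omega : set S) (fun x => f x - q x).
    move=> [cf _] mq; refine (measurable_funB _ mq).
    exact: (continuous_caratheodory haus_half_space bdry_surf_measurable cf).
  apply: le_trans (@integral_abs_lin _ _ _ _ _ a _ _ bdry_surf_measurable
    (mf _ _ (Cphi k) mg) (mf _ _ (Cpsi k) mh)).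
  rewrite le_eqVlt; apply/orP; left; apply/eqP; apply: eq_integral => x _.
  by rewrite mulrBr opprD addrACA.
Qed.

End traces.

Lemma W1p_measurable p w : W1p Omega p w -> measurable_sob w.
Proof.
move=> [lw lgw _]; split; first exact: (inLp_measurable lw).
by move=> i; exact: (inLp_measurable (lgw i)).
Qed.

(** Integrability and bounds are given for the representative returned by [S]; this carries them
    over to every other representative. *)
Lemma sob_eq_W1p p w1 w2 : is_weak_grad Omega w1 -> measurable_sob w1 ->
  sob_eq Omega w1 w2 -> W1p Omega p w2 ->
  W1p Omega p w1 /\ normW1p Omega p w1 = normW1p Omega p w2.
Proof.
move=> wg1 [m1 mg1] e12 W2; have [l2 lg2 _] := W2.
have e21 : {ae mu, forall x, Omega x -> w2.1 x = w1.1 x}.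
  by apply: ae_imp e12 => x /= h /h [].
have eg21 i : {ae mu, forall x, Omega x -> grad w2 x 0 i = grad w1 x 0 i}.
  by apply: ae_imp e12 => x /= h /h [_ ->].
have l1 := ae_eq_inLp m1 e21 l2.
have lg1 i := ae_eq_inLp (mg1 i) (eg21 i) (lg2 i).
split; first by split.
congr fine; congr (_ + _)%E.
  by apply/esym; exact: (ae_eq_eLp p (inLp_measurable l2) m1 e21).
apply: eq_bigr => i _; apply/esym.
exact: (ae_eq_eLp p (inLp_measurable (lg2 i)) (mg1 i) (eg21 i)).
Qed.

(** * Functions vanishing on the Dirichlet part *)

Section dirichlet.
Variable Gt : set E.

Lemma has_trace_onP (a : R) v w g h : measurable_sob v -> measurable_sob w ->
  has_trace_on Omega Gt v g -> has_trace_on Omega Gt w h ->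
  has_trace_on Omega Gt (a *: v + w) (fun x => a * g x + h x).
Proof.
move=> mv mw [g' [tv gg]] [h' [tw hh]].
exists (fun x => a * g' x + h' x); split; first exact: is_traceP.
by apply: ae_imp2 gg hh => x /= gx hx Gx; rewrite gx// hx.
Qed.

Lemma C1_cst0 : C1 ((fun=> 0) : E -> R) /\ egrad ((fun=> 0) : E -> R) = (fun=> 0).
Proof.
have dE (i : 'I_n.+1) (x : E) : pderiv i (fun=> 0 : R) x = 0 by rewrite /pderiv derive_cst.
split.
  split=> [|i]; first exact: cst_continuous.
  split=> [x|]; first exact: (@derivable_cst R E R 0).
  by rewrite (funext (dE i)); exact: cst_continuous.
by apply/funext => x; apply/rowP => i; rewrite !mxE dE.
Qed.

Lemma has_trace_on0 : has_trace_on Omega Gt 0 (fun=> 0).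
Proof.
have [C0 g0] := C1_cst0.
exists (fun=> 0); split; last exact: aeW.
split; first exact: measurable_cst.
exists (fun _ _ => 0); split => //.
  rewrite [X in X @ _ --> _](_ : _ = fun=> 0%E); first exact: cvg_cst.
  apply/funext => k; rewrite g0 subr0.
  have := eW1p_fin (W1p_0 ltr01); have := normW1pE (W1p_0 ltr01).
  by rewrite normW1p0// => <-.
rewrite [X in X @ _ --> _](_ : _ = fun=> 0%E); first exact: cvg_cst.
by apply/funext => k; apply: integral0_eq => x _; rewrite subr0 normr0.
Qed.

Lemma W1p0P p (a : R) v w : 1 <= p -> W1p0 Omega Gt p v -> W1p0 Omega Gt p w ->
  W1p0 Omega Gt p (a *: v + w).
Proof.
move=> p1 [Wv tv] [Ww tw]; split; first exact: W1pP.
have := has_trace_onP a (W1p_measurable Wv) (W1p_measurable Ww) tv tw.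
by under eq_fun do rewrite mulr0 addr0.
Qed.

Lemma W1p0_0 p : 0 < p -> W1p0 Omega Gt p 0.
Proof. by move=> p0; split; [exact: W1p_0|exact: has_trace_on0]. Qed.

Lemma W1pB p v w : 1 <= p -> W1p Omega p v -> W1p Omega p w -> W1p Omega p (v - w).
Proof. by move=> p1 Wv Ww; rewrite addrC -scaleN1r; exact: W1pP. Qed.

Lemma W1p0B p v w : 1 <= p -> W1p0 Omega Gt p v -> W1p0 Omega Gt p w ->
  W1p0 Omega Gt p (v - w).
Proof. by move=> p1 Wv Ww; rewrite addrC -scaleN1r; exact: W1p0P. Qed.

Lemma W1p0D p v w : 1 <= p -> W1p0 Omega Gt p v -> W1p0 Omega Gt p w ->
  W1p0 Omega Gt p (v + w).
Proof. by move=> p1 Wv Ww; rewrite -[v]scale1r; exact: W1p0P. Qed.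

Lemma W1p0_liftB p fD w w' : 1 <= p -> is_lift Omega Gt p fD w ->
  is_lift Omega Gt p fD w' -> W1p0 Omega Gt p (w' - w).
Proof.
move=> p1 [Ww tw _] [Ww' tw' _]; split; first exact: W1pB.
have := has_trace_onP (-1) (W1p_measurable Ww) (W1p_measurable Ww') tw tw'.
under eq_fun do rewrite mulN1r addNr.
by rewrite scaleN1r addrC.
Qed.

(** Each state comes with its own lift of [fD]. The two lifts may differ as representatives, but
    their difference has trace zero on [Gt] and is added as a third element of the space. *)
Lemma W1p0_stateB f f' fD u u' y y' : is_state Omega Gt f fD u y ->
  is_state Omega Gt f' fD u' y' -> W1p0 Omega Gt 2 (y' - y).
Proof.
move=> [_ [w [lw yw]] _] [_ [w' [lw' yw']] _].
have l12 : 1 <= 2 :> R by rewrite ler1n.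
rewrite (_ : y' - y = (y' - w') - (y - w) + (w' - w)).
  exact: (W1p0D l12 (W1p0B l12 yw' yw) (W1p0_liftB l12 lw lw')).
by rewrite opprB -addrA (addrC (w - y)) (addrA (w' - w)) subrK addrA subrK.
Qed.

Lemma is_lift0 p : 0 < p -> is_lift Omega Gt p (fun=> 0) 0.
Proof.
move=> p0; split; [exact: W1p_0|exact: has_trace_on0|move=> v _].
rewrite /weak_form -[RHS]int_Omega0; congr int_Omega; apply/funext => x.
by rewrite mul1r /edot big1// => i _; rewrite mxE mul0r.
Qed.

Lemma Wbd0 p : 0 < p -> Wbd Gt p (fun=> 0) /\ normWbd Gt p (fun=> 0) = 0.
Proof.
move=> p0.
have e0 : eWbd Gt p (fun=> 0) = 0%E.
  rewrite /eWbd [X in (X + _)%E]integral0_eq ?[X in (_ + X)%E]integral0_eq.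
  - by rewrite adde0 poweR0r// invr_neq0// gt_eqF.
  - move=> x _; rewrite integral0_eq// => y _.
    by rewrite subrr normr0 powR0 ?gt_eqF// mul0r.
  - by move=> x _; rewrite normr0 powR0 ?gt_eqF.
by split; [split; [exact: measurable_cst|rewrite e0]|rewrite /normWbd e0].
Qed.

End dirichlet.

Lemma W1p_le p r w : 0 < r -> r <= p -> W1p Omega p w -> W1p Omega r w.
Proof.
move=> r0 rp [lw lgw ww]; split => //; first exact: inLp_le lw.
exact: inLpv_le lgw.
Qed.

Lemma normW1p_le p r : 0 < r -> r <= p -> exists2 C : R, 0 <= C &
  forall w, W1p Omega p w -> normW1p Omega r w <= C * normW1p Omega p w.
Proof.
move=> r0 rp; have [C C0 hC] := normLp_le r0 rp; exists C => // w Ww.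
have [lw lgw _] := Ww.
rewrite !normW1pE//; last exact: W1p_le Ww.
rewrite mulrDr; apply: lerD; first exact: hC.
by rewrite /normLpv mulr_sumr; apply: ler_sum => i _; exact: hC.
Qed.

(** * Functionals given by vector fields *)

Definition dual_pairing (g : E -> E) (v : @sob R n) : R :=
  int_Omega Omega (fun x => edot (g x) (grad v x)).

Section pairing.
Variables (p q : R).
Hypotheses (p0 : 0 < p) (q0 : 0 < q) (pq : p^-1 + q^-1 = 1).

Lemma dual_pairingPl (a : R) g h v : inLpv p g -> inLpv p h -> inLpv q (grad v) ->
  dual_pairing (fun x => a *: g x + h x) v = a * dual_pairing g v + dual_pairing h v.
Proof.
move=> lg lh lv; have lgv := inL1_edot p0 q0 pq lg lv.
have lhv := inL1_edot p0 q0 pq lh lv.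
rewrite /dual_pairing -(int_OmegaZ a lgv) -(int_OmegaD (inLpZ a ltr01 lgv) lhv).
by congr int_Omega; apply/funext => x; rewrite edotPl.
Qed.

Lemma dual_pairingPr (a : R) g v w : inLpv p g -> inLpv q (grad v) -> inLpv q (grad w) ->
  dual_pairing g (a *: v + w) = a * dual_pairing g v + dual_pairing g w.
Proof.
move=> lg lv lw; have lgv := inL1_edot p0 q0 pq lg lv.
have lgw := inL1_edot p0 q0 pq lg lw.
rewrite /dual_pairing -(int_OmegaZ a lgv) -(int_OmegaD (inLpZ a ltr01 lgv) lgw).
by congr int_Omega; apply/funext => x; rewrite -edotPr.
Qed.

Lemma norm_dual_pairing g v : inLpv p g -> W1p Omega q v ->
  `|dual_pairing g v| <= normLpv p g * normW1p Omega q v.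
Proof.
move=> lg Wv; apply: (le_trans (norm_int_edot p0 q0 pq lg (grad_inLpv Wv))).
by apply: ler_wpM2l; [exact: normLpv_ge0|exact: normLpv_grad].
Qed.

End pairing.

Let half_half : 2^-1 + 2^-1 = 1 :> R. Proof. by field. Qed.
Let l12 : 1 <= 2 :> R. Proof. by rewrite ler1n. Qed.
Let l02 : 0 < 2 :> R. Proof. by rewrite ltr0n. Qed.

(** * The state equation *)

Section groger.
Variables (Gt : set E) (ul uu s : R).
Variable S : (@sob R n -> R) -> (E -> R) -> (E -> R) -> @sob R n.
Hypothesis hul : 0 < ul.
Hypothesis hS : is_solution_operator Omega Gt ul uu s S.
Hypothesis hsS : is_groger_exponent Omega Gt ul uu s S.
Local Notation Uad := (Uad Omega ul uu).
Local Notation H1D := (W1p0 Omega Gt 2).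

Lemma Uad_measurable u : Uad u -> measurable_fun (Omega : set T) u.
Proof. by move=> [[lu _] _]; exact: (inLp_measurable lu). Qed.

Lemma Uad_bounded u : Uad u -> {ae mu, forall x, Omega x -> `|u x| <= uu}.
Proof.
move=> [_ ub]; apply: ae_imp ub => x /= h /h /andP[ulx uux].
by rewrite ger0_norm// (le_trans (ltW hul)).
Qed.

(** The bound depends neither on [u] nor on [eta]; this uniformity is what makes the interpolation
    of increments possible. *)
Lemma Uad_diff u eta : Uad u -> Uad (u + eta) ->
  measurable_fun (Omega : set T) eta /\
  {ae mu, forall x, Omega x -> `|eta x| <= uu - ul}.
Proof.
move=> Uu Ue; split.
  rewrite (_ : eta = fun x => (u + eta) x - u x).
    exact: (measurable_funB (Uad_measurable Ue) (Uad_measurable Uu)).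
  by apply/funext => x; rewrite /= addrAC subrr add0r.
have [_ ub] := Uu; have [_ eb] := Ue.
apply: ae_imp2 ub eb => x /= hu he Ox.
have /andP[u1 u2] := hu Ox; have /andP[] := he Ox.
rewrite -[(u + eta) x]/(u x + eta x) => e1 e2.
by rewrite ler_norml; apply/andP; split; lra.
Qed.

Lemma inL1_Uad u g h : Uad u -> inLpv 2 g -> inLpv 2 h ->
  inLp Omega 1 (fun x => u x * edot (g x) (h x)).
Proof.
move=> Uu lg lh.
exact: (inLpMb ltr01 (Uad_measurable Uu) (Uad_bounded Uu) (inL1_edot l02 l02 half_half lg lh)).
Qed.

Lemma weak_formC u v w : weak_form Omega u v w = weak_form Omega u w v.
Proof. by congr int_Omega; apply/funext => x; rewrite edotC. Qed.

Lemma weak_formPl u (a : R) v w t : Uad u -> inLpv 2 (grad v) -> inLpv 2 (grad w) ->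
  inLpv 2 (grad t) ->
  weak_form Omega u (a *: v + w) t = a * weak_form Omega u v t + weak_form Omega u w t.
Proof.
move=> Uu lv lw lt; have l1 := inL1_Uad Uu lv lt; have l2 := inL1_Uad Uu lw lt.
rewrite /weak_form -(int_OmegaZ a l1) -(int_OmegaD (inLpZ a ltr01 l1) l2).
by congr int_Omega; apply/funext => x; rewrite edotPl mulrDr mulrCA.
Qed.

(** A relation rather than an operator: it is stable under linear combinations of sources and
    solutions, whereas a chosen solution depends linearly on the source only up to null sets. *)
Definition solves u (g : E -> E) z : Prop :=
  H1D z /\ forall v, H1D v -> weak_form Omega u z v = - dual_pairing g v.

Let H1D_grad z : H1D z -> inLpv 2 (grad z).
Proof. by case=> Wz _; exact: grad_inLpv. Qed.

Lemma solvesP u (a : R) g h z w : Uad u -> inLpv 2 g -> inLpv 2 h ->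
  solves u g z -> solves u h w -> solves u (fun x => a *: g x + h x) (a *: z + w).
Proof.
move=> Uu lg lh [Hz zE] [Hw wE]; split; first exact: W1p0P.
move=> v Hv; rewrite weak_formPl ?zE ?wE//; try exact: H1D_grad.
by rewrite (dual_pairingPl l02 l02 half_half a lg lh (H1D_grad Hv)) opprD mulrN.
Qed.

Let conj_ge (sigma : R) : 2 <= sigma -> [/\ 0 < sigma, 1 <= sigma / (sigma - 1),
  0 < sigma / (sigma - 1) & sigma^-1 + (sigma / (sigma - 1))^-1 = 1].
Proof.
move=> h; have s1 : 0 < sigma - 1 by lra.
have s0 : 0 < sigma by lra.
split => //.
- by rewrite ler_pdivlMr//; lra.
- exact: divr_gt0.
- by rewrite invf_div; field; rewrite gt_eqF.
Qed.

Lemma dual_pairing_Wm1p sigma g : 2 <= sigma -> inLpv sigma g ->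
  Wm1p Omega Gt sigma (fun v => - dual_pairing g v) /\
  normWm1p Omega Gt sigma (fun v => - dual_pairing g v) <= normLpv sigma g.
Proof.
move=> s2 lg; have [s0 c1 c0 cE] := conj_ge s2.
have bound v : W1p0 Omega Gt (sigma / (sigma - 1)) v ->
    `|- dual_pairing g v| <= normLpv sigma g * normW1p Omega (sigma / (sigma - 1)) v.
  by move=> [Wv _]; rewrite normrN; exact: norm_dual_pairing.
split.
  split; last by exists (normLpv sigma g).
  move=> a v w [Wv _] [Ww _].
  by rewrite (dual_pairingPr s0 c0 cE a lg (grad_inLpv Wv) (grad_inLpv Ww)) opprD mulrN.
apply: ge_sup.
  exists `|- dual_pairing g 0|; exists 0 => //=; split; first exact: W1p0_0.
  by rewrite normW1p0.
move=> _ [v [Hv v1] <-]; apply: (le_trans (bound v Hv)).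
by rewrite -[leRHS]mulr1; apply: ler_wpM2l => //; exact: normLpv_ge0.
Qed.

Lemma solves_ex u g : 2 <= s -> Uad u -> inLpv 2 g -> exists z, solves u g z.
Proof.
move=> s2 Uu lg; have [Wl _] := dual_pairing_Wm1p (lexx 2) lg.
have s22 : (2 : R) <= 2 <= s by apply/andP; split.
(* [is_state] only provides some lift [w] of the zero data. It lies itself in the Dirichlet
   subspace, so adding it back to the difference puts the state there too. *)
have [[Wz [w [[Ww tw _] zw]] zE] _] := hS s22 Wl (Wbd0 Gt l02).1 Uu.
exists (S (fun v => - dual_pairing g v) (fun=> 0) u); split; last exact: zE.
by rewrite -(subrK w (S _ _ _)); apply: (W1p0D l12 zw); split.
Qed.

(** A solution is a priori only in W^{1,2}. With [0] as lift it is a state for zero Dirichlet data,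
    hence agrees almost everywhere with the value of [S] and inherits its higher integrability and a
    bound uniform in [u]. *)
Lemma solves_est sigma : 2 <= sigma <= s -> exists2 C : R, 0 <= C &
  forall u g z, Uad u -> inLpv sigma g -> solves u g z ->
    W1p Omega sigma z /\ normW1p Omega sigma z <= C * normLpv sigma g.
Proof.
move=> hsigma; have [C C0 hC] := hsS hsigma; exists C => // u g z Uu lg [Hz zE].
have /andP[s2 _] := hsigma; have s0 : 0 < sigma := lt_le_trans l02 s2.
have [Wl nl] := dual_pairing_Wm1p s2 lg.
have [W0 n0] := Wbd0 Gt s0.
have [_ uniq] := hS hsigma Wl W0 Uu.
have [Wz _] := Hz; have [_ _ wgz] := Wz.
have zS : is_state Omega Gt (fun v => - dual_pairing g v) (fun=> 0) u z.
  split=> //; exists 0; split; first exact: is_lift0.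
  by rewrite subr0.
have [WS nS] := hC _ _ _ Wl W0 Uu.
have [Wsz ->] := sob_eq_W1p wgz (W1p_measurable Wz) (uniq z zS) WS.
split=> //; apply: (le_trans nS); apply: ler_wpM2l => //.
by rewrite n0 add0r.
Qed.

(** * Exponents and estimates for the increments of the state *)

Section estimates.
Variables (qt : R) (f : @sob R n -> R) (fD : E -> R).
Hypotheses (hs : 2 < s) (qt0 : 0 < qt) (hexp : s^-1 + 2 * qt^-1 < 2^-1).
Hypotheses (huu : ul <= uu) (hf : Wm1p Omega Gt s f) (hfD : Wbd Gt s fD).

Local Notation Y := (S f fD).
Local Notation N := (normLp Omega qt).

Let s1 : R := (s^-1 + qt^-1)^-1.
Let s2 : R := (s^-1 + 2 * qt^-1)^-1.
(** Complementary to [qt]: a direction in L^qt times a gradient in L^s3 lies in L^2 and can be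
    paired with the gradient of the adjoint state. The exponent condition gives [s3 <= s1], so
    linearised states are regular enough. *)
Let s3 : R := (2^-1 - qt^-1)^-1.
Let rho : R := (2^-1 - s^-1 - 2 * qt^-1)^-1.

Let s0 : 0 < s. Proof. exact: lt_trans l02 hs. Qed.
Let sV : 0 < s^-1. Proof. by rewrite invr_gt0 s0. Qed.
Let qtV : 0 < qt^-1. Proof. by rewrite invr_gt0. Qed.

Let between (t : R) : s^-1 <= t <= 2^-1 -> 2 <= t^-1 <= s.
Proof.
move=> /andP[st t2]; have t0 : 0 < t := lt_le_trans sV st.
apply/andP; split; first by rewrite -[leLHS]invrK lef_pV2 ?posrE ?invr_gt0.
by rewrite -[leRHS]invrK lef_pV2 ?posrE ?invr_gt0.
Qed.

Let s1_itv : 2 <= s1 <= s.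
Proof.
have := hexp; have := qtV; have := sV => *.
by apply: between; apply/andP; split; lra.
Qed.
Let s2_itv : 2 <= s2 <= s.
Proof.
have := hexp; have := qtV; have := sV => *.
by apply: between; apply/andP; split; lra.
Qed.
Let s3_itv : 2 <= s3 <= s.
Proof.
have := hexp; have := qtV; have := sV => *.
by apply: between; apply/andP; split; lra.
Qed.
Let qt1 : 1 <= qt.
Proof.
have := hexp; have := sV => ? ?; have h : qt^-1 <= 1 by lra.
by rewrite -[qt]invrK -[leLHS]invr1 lef_pV2 ?posrE ?ltr01.
Qed.
Let s1_gt0 : 0 < s1.
Proof. by rewrite invr_gt0; have := hexp; have := qtV; have := sV; lra. Qed.
Let s2_gt0 : 0 < s2.
Proof. by rewrite invr_gt0; have := hexp; have := qtV; have := sV; lra. Qed.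
Let s3_gt0 : 0 < s3.
Proof. by rewrite invr_gt0; have := hexp; have := qtV; have := sV; lra. Qed.
Let rho_gt0 : 0 < rho.
Proof. by rewrite invr_gt0; have := hexp; have := qtV; have := sV; lra. Qed.
Let s3_le_s1 : s3 <= s1.
Proof. by have := hexp; have := qtV; have := sV; move=> *; rewrite lef_pV2 ?posrE; lra. Qed.
Let s1_ge2 : 2 <= s1. Proof. by case/andP: s1_itv. Qed.
Let s2_ge2 : 2 <= s2. Proof. by case/andP: s2_itv. Qed.
Let exp_qt_s : qt^-1 + s^-1 = s1^-1. Proof. by rewrite invrK addrC. Qed.
Let exp_qt_s1 : qt^-1 + s1^-1 = s2^-1. Proof. by rewrite !invrK; ring. Qed.
Let exp_rho_s1 : rho^-1 + s1^-1 = s3^-1. Proof. by rewrite !invrK; ring. Qed.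
Let exp_rho_s2 : rho^-1 + s2^-1 = 2^-1. Proof. by rewrite !invrK; ring. Qed.
Let exp_qt_s3 : qt^-1 + s3^-1 = 2^-1. Proof. by rewrite !invrK; ring. Qed.

Lemma feasible_inLp u eta p : 0 < p -> Uad u -> Uad (u + eta) -> inLp Omega p eta.
Proof. by move=> p0 Uu /(Uad_diff Uu)[me be]; exact: bounded_inLp p0 me be. Qed.

Lemma feasible_rho_small (e : R) : 0 < e -> exists2 d : R, 0 < d &
  forall u eta, Uad u -> Uad (u + eta) -> N eta < d -> normLp Omega rho eta < e.
Proof.
(* Interpolation with the uniform bound needs an exponent not below [qt]; the maximum also covers
   [rho < qt], and the finite measure of the domain leads from [t] back to [rho]. *)
move=> e0; pose t := Num.max rho qt.
have rt : rho <= t by rewrite le_max lexx.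
have qtt : qt <= t by rewrite le_max lexx orbT.
have t0 : 0 < t := lt_le_trans qt0 qtt.
have [C C0 hC] := normLp_le rho_gt0 rt.
have th0 : 0 < qt / t by exact: divr_gt0.
pose B := C * (uu - ul) `^ (1 - qt / t) + 1.
have CM0 : 0 <= C * (uu - ul) `^ (1 - qt / t) by rewrite mulr_ge0// powR_ge0.
have B0 : 0 < B by rewrite /B; lra.
have eB : 0 < e / B by exact: divr_gt0.
(* The value of [N eta] at which [B * N eta ^ (qt / t)] reaches [e]. *)
exists ((e / B) `^ (qt / t)^-1); first exact: powR_gt0.
move=> u eta Uu Ue Nd; have [me be] := Uad_diff Uu Ue.
have le_p p : 0 < p -> inLp Omega p eta.
  by move=> p0; exact: feasible_inLp p0 Uu Ue.
have M0 : 0 <= uu - ul by rewrite subr_ge0.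
have h0 := hC eta (le_p t t0); apply: (le_lt_trans h0).
have h := bounded_normLp (le_p qt qt0) qt0 qtt M0 be.
apply: (le_lt_trans (ler_wpM2l C0 h)); rewrite mulrA.
have Nth : N eta `^ (qt / t) < e / B.
  have -> : e / B = ((e / B) `^ (qt / t)^-1) `^ (qt / t).
    by rewrite -powRrM mulVf ?gt_eqF// powRr1// ltW.
  by apply: gt0_ltr_powR => //; rewrite nnegrE ?normLp_ge0// powR_ge0.
apply: (@le_lt_trans _ _ (B * N eta `^ (qt / t))).
  by rewrite ler_wpM2r ?powR_ge0// /B lerDl.
by rewrite mulrC -ltr_pdivlMr.
Qed.

Lemma state_bound : exists2 K : R, 0 <= K & forall u, Uad u ->
  W1p Omega s (Y u) /\ normLpv s (grad (Y u)) <= K.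
Proof.
have ss : 2 <= s <= s by rewrite lexx andbT ltW.
have [C C0 hC] := hsS ss.
exists `|C * (normWbd Gt s fD + normWm1p Omega Gt s f)|; first exact: normr_ge0.
move=> u Uu; have [Ws nS] := hC f fD u hf hfD Uu; split => //.
by apply: (le_trans (normLpv_grad Ws)); apply: (le_trans nS); exact: ler_norm.
Qed.

Lemma stateP u : Uad u -> is_state Omega Gt f fD u (Y u).
Proof.
move=> Uu; have ss : 2 <= s <= s by rewrite lexx andbT ltW.
by have [] := hS ss hf hfD Uu.
Qed.

Lemma state_W12 u : Uad u -> W1p Omega 2 (Y u).
Proof. by move=> /stateP[]. Qed.

(* The solution operator [S'(u)] extended to all of [L^qt]; it is determined
   up to null sets only. *)
Definition zsol u phi : @sob R n :=
  xget 0 [set z | solves u (fun x => phi x *: grad (Y u) x) z].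

Lemma source_bound u phi : Uad u -> inLp Omega qt phi ->
  inLpv s1 (fun x => phi x *: grad (Y u) x).
Proof.
move=> Uu lphi; have [? _ hK] := state_bound; have [Ws _] := hK u Uu.
exact: (inLpv_scale qt0 s0 s1_gt0 exp_qt_s lphi (grad_inLpv Ws)).
Qed.

Lemma zsolP u phi : Uad u -> inLp Omega qt phi ->
  solves u (fun x => phi x *: grad (Y u) x) (zsol u phi).
Proof.
move=> Uu lphi; rewrite /zsol; case: xgetP => [z _ //|nz].
(* Existence rules out the default value [0] of [xget]. *)
have [z zP] := solves_ex (ltW hs) Uu (inLpv_le l02 s1_ge2 (source_bound Uu lphi)).
by have := nz z; rewrite /= => /(_ zP).
Qed.

Lemma zsol_bound : exists2 K : R, 0 <= K & forall u phi, Uad u -> inLp Omega qt phi ->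
  W1p Omega s1 (zsol u phi) /\ normW1p Omega s1 (zsol u phi) <= K * N phi.
Proof.
have [Y0 Y0_ge0 hY] := state_bound; have [C C0 hC] := solves_est s1_itv.
exists (C * Y0) => [|u phi Uu lphi]; first exact: mulr_ge0.
have [Wz nz] := hC _ _ _ Uu (source_bound Uu lphi) (zsolP Uu lphi); split => //.
have [Ws nY] := hY u Uu.
have h := normLpv_scale qt0 s0 s1_gt0 exp_qt_s lphi (grad_inLpv Ws).
apply: (le_trans nz); rewrite -mulrA; apply: ler_wpM2l => //.
by apply: (le_trans h); rewrite mulrC; apply: ler_wpM2r => //; exact: normLp_ge0.
Qed.

Lemma weak_formDu u eta v w : Uad u -> Uad (u + eta) -> inLpv 2 (grad v) ->
  inLpv 2 (grad w) ->
  weak_form Omega (u + eta) v w =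
  weak_form Omega u v w + dual_pairing (fun x => eta x *: grad v x) w.
Proof.
move=> Uu Ue lv lw; have [me be] := Uad_diff Uu Ue.
have l1 := inL1_Uad Uu lv lw.
have l2 := inLpMb ltr01 me be (inL1_edot l02 l02 half_half lv lw).
rewrite /dual_pairing.
have -> : (fun x => edot (eta x *: grad v x) (grad w x)) =
    (fun x => eta x * edot (grad v x) (grad w x)).
  by apply/funext => x; rewrite edotZl.
rewrite /weak_form -(int_OmegaD l1 l2); congr int_Omega; apply/funext => x.
by rewrite -mulrDl.
Qed.

Section increment.
Variables (u eta : E -> R).
Hypotheses (Uu : Uad u) (Ue : Uad (u + eta)).
Let d : @sob R n := Y (u + eta) - Y u.
Let r : @sob R n := d - zsol u eta.
Let leta p : 0 < p -> inLp Omega p eta.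
Proof. by move=> p0; exact: feasible_inLp p0 Uu Ue. Qed.
Let leta_qt := leta qt0.

Lemma increment_H1D : H1D d.
Proof. exact: (W1p0_stateB (stateP Uu) (stateP Ue)). Qed.

Lemma increment_solves : solves u (fun x => eta x *: grad (Y (u + eta)) x) d.
Proof.
split; first exact: increment_H1D.
move=> v Hv; have [_ _ eu] := stateP Uu; have [_ _ ee] := stateP Ue.
have lY := grad_inLpv (state_W12 Uu); have lY' := grad_inLpv (state_W12 Ue).
have lv := H1D_grad Hv.
rewrite /d addrC -scaleN1r (weak_formPl _ Uu lY lY' lv).
have := ee v Hv; rewrite (weak_formDu Uu Ue lY' lv) -(eu v Hv) => <-.
by rewrite mulN1r opprD addrAC addNr add0r.
Qed.

Lemma increment2_solves : solves u (fun x => eta x *: grad d x) r.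
Proof.
have l2 := inLpv_le l02 s1_ge2 (source_bound Uu leta_qt).
have l1 := inLpv_le l02 s1_ge2 (source_bound Ue leta_qt).
have := solvesP (-1) Uu l2 l1 (zsolP Uu leta_qt) increment_solves.
have -> : (fun x => - 1 *: (eta x *: grad (Y u) x) + eta x *: grad (Y (u + eta)) x) =
    (fun x => eta x *: grad d x).
  by apply/funext => x; rewrite scaleN1r addrC -scalerBr.
by rewrite scaleN1r addrC.
Qed.

End increment.

Lemma increment_bound : exists2 K : R, 0 <= K & forall u eta, Uad u -> Uad (u + eta) ->
  W1p Omega s1 (Y (u + eta) - Y u) /\
  normW1p Omega s1 (Y (u + eta) - Y u) <= K * N eta.
Proof.
have [Y0 Y0_ge0 hY] := state_bound; have [C C0 hC] := solves_est s1_itv.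
exists (C * Y0) => [|u eta Uu Ue]; first exact: mulr_ge0.
have leta := feasible_inLp qt0 Uu Ue.
have [Wz nz] := hC _ _ _ Uu (source_bound Ue leta) (increment_solves Uu Ue); split => //.
have [Ws nY] := hY _ Ue.
have h := normLpv_scale qt0 s0 s1_gt0 exp_qt_s leta (grad_inLpv Ws).
apply: (le_trans nz); rewrite -mulrA; apply: ler_wpM2l => //.
by apply: (le_trans h); rewrite mulrC; apply: ler_wpM2r => //; exact: normLp_ge0.
Qed.

(** One equation for [r], estimated twice. With [eta] in L^qt the order is two but only W^{1,s2} is
    reached; with one factor [eta] in L^rho the remainder lies in W^{1,s3}, which is what
    multiplication by an arbitrary direction in L^qt demands. *)
Lemma increment2_bound : exists2 K : R, 0 <= K & forall u eta, Uad u -> Uad (u + eta) ->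
  let r := Y (u + eta) - Y u - zsol u eta in
  [/\ W1p Omega s2 r, normW1p Omega s2 r <= K * N eta ^+ 2,
      W1p Omega s3 r & normW1p Omega s3 r <= K * (normLp Omega rho eta * N eta)].
Proof.
have [K1 K1_ge0 h1] := increment_bound.
have [C2 C20 hC2] := solves_est s2_itv; have [C3 C30 hC3] := solves_est s3_itv.
exists ((C2 + C3) * K1) => [|u eta Uu Ue r].
  by apply: mulr_ge0 => //; exact: addr_ge0.
have leta := feasible_inLp qt0 Uu Ue; have leta' := feasible_inLp rho_gt0 Uu Ue.
have [Wd nd] := h1 u eta Uu Ue; have ld := grad_inLpv Wd.
have nd' := le_trans (normLpv_grad Wd) nd.
have rs := increment2_solves Uu Ue.
have lr2 := inLpv_scale qt0 s1_gt0 s2_gt0 exp_qt_s1 leta ld.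
have nr2 := normLpv_scale qt0 s1_gt0 s2_gt0 exp_qt_s1 leta ld.
have lr3 := inLpv_scale rho_gt0 s1_gt0 s3_gt0 exp_rho_s1 leta' ld.
have nr3 := normLpv_scale rho_gt0 s1_gt0 s3_gt0 exp_rho_s1 leta' ld.
have [W2 n2] := hC2 _ _ _ Uu lr2 rs; have [W3 n3] := hC3 _ _ _ Uu lr3 rs.
have N0 := normLp_ge0 qt eta; have N0' := normLp_ge0 rho eta.
split=> //.
  apply: (le_trans n2); apply: (@le_trans _ _ (C2 * (N eta * (K1 * N eta)))).
    by apply: ler_wpM2l => //; apply: (le_trans nr2); exact: ler_wpM2l.
  rewrite (_ : C2 * _ = C2 * (K1 * N eta ^+ 2)); last by ring.
  by rewrite -mulrA ler_wpM2r ?mulr_ge0 ?sqr_ge0// lerDl.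
apply: (le_trans n3); apply: (@le_trans _ _ (C3 * (normLp Omega rho eta * (K1 * N eta)))).
  by apply: ler_wpM2l => //; apply: (le_trans nr3); exact: ler_wpM2l.
rewrite (_ : C3 * _ = C3 * (K1 * (normLp Omega rho eta * N eta))); last by ring.
by rewrite -mulrA ler_wpM2r ?mulr_ge0// lerDr.
Qed.

(** Moves the change of coefficient into the source, so that solutions for [u + eta] and for [u] can
    be subtracted as solutions for the same coefficient. *)
Lemma solves_shift u eta g z : Uad u -> Uad (u + eta) -> inLpv 2 g ->
  solves (u + eta) g z -> solves u (fun x => 1 *: (eta x *: grad z x) + g x) z.
Proof.
move=> Uu Ue lg [Hz zE]; split => // v Hv; have [me be] := Uad_diff Uu Ue.
have lz := H1D_grad Hz.
have lez : inLpv 2 (fun x => eta x *: grad z x).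
  by move=> i; under eq_fun do rewrite mxE; exact: (inLpMb l02 me be (lz i)).
rewrite (dual_pairingPl l02 l02 half_half 1 lez lg (H1D_grad Hv)) mul1r opprD.
by rewrite -(zE v Hv) (weak_formDu Uu Ue lz (H1D_grad Hv)) addrCA addNr addr0.
Qed.

Lemma zsol_diff_bound : exists2 K : R, 0 <= K & forall u eta phi,
  Uad u -> Uad (u + eta) -> inLp Omega qt phi ->
  let zeta := zsol (u + eta) phi - zsol u phi in
  [/\ solves u (fun x => 1 *: (eta x *: grad (zsol (u + eta) phi) x) +
                         phi x *: grad (Y (u + eta) - Y u) x) zeta,
      W1p Omega s2 zeta & normW1p Omega s2 zeta <= K * (N eta * N phi)].
Proof.
have [K1 K1_ge0 h1] := increment_bound; have [K2 K2_ge0 h2] := zsol_bound.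
have [C C0 hC] := solves_est s2_itv.
exists (C * (K2 + K1)) => [|u eta phi Uu Ue lphi zeta].
  by apply: mulr_ge0 => //; exact: addr_ge0.
have leta := feasible_inLp qt0 Uu Ue.
have [Wd nd] := h1 u eta Uu Ue; have ld := grad_inLpv Wd.
have [Wz nz] := h2 _ phi Ue lphi; have lz := grad_inLpv Wz.
have nd' := le_trans (normLpv_grad Wd) nd.
have nz' := le_trans (normLpv_grad Wz) nz.
have l1 := inLpv_scale qt0 s1_gt0 s2_gt0 exp_qt_s1 leta lz.
have n1 := normLpv_scale qt0 s1_gt0 s2_gt0 exp_qt_s1 leta lz.
have l2 := inLpv_scale qt0 s1_gt0 s2_gt0 exp_qt_s1 lphi ld.
have n2 := normLpv_scale qt0 s1_gt0 s2_gt0 exp_qt_s1 lphi ld.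
have lsrc := inLpv_le l02 s1_ge2 (source_bound Uu lphi).
have lsrc' := inLpv_le l02 s1_ge2 (source_bound Ue lphi).
have lez := inLpv_le l02 s2_ge2 l1.
have sh := solves_shift Uu Ue lsrc' (zsolP Ue lphi).
have zs : solves u (fun x => 1 *: (eta x *: grad (zsol (u + eta) phi) x) +
                         phi x *: grad (Y (u + eta) - Y u) x) zeta.
  have := solvesP (-1) Uu lsrc (inLpvP 1 l12 lez lsrc') (zsolP Uu lphi) sh.
  rewrite scaleN1r [- _ + _]addrC; congr (solves u _ _); apply/funext => x.
  by rewrite scaleN1r addrCA [- _ + _]addrC -scalerBr.
have s21 : 1 <= s2 := le_trans l12 s2_ge2.
have [W nW] := hC _ _ _ Uu (inLpvP 1 s21 l1 l2) zs.
split => //; apply: (le_trans nW); rewrite -mulrA; apply: ler_wpM2l => //.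
apply: (le_trans (normLpvP 1 s21 l1 l2)); rewrite normr1 mul1r mulrDl; apply: lerD.
  apply: (le_trans n1).
  rewrite (_ : K2 * _ = N eta * (K2 * N phi)); last by ring.
  by apply: ler_wpM2l => //; exact: normLp_ge0.
apply: (le_trans n2).
rewrite (_ : K1 * _ = N phi * (K1 * N eta)); last by ring.
by apply: ler_wpM2l => //; exact: normLp_ge0.
Qed.

(** The difference solves the equation with zero source. Without a quotient by null sets the outcome
    is a difference of norm zero, not equality. *)
Lemma solves_uniq sigma u g z z' : 2 <= sigma <= s -> Uad u -> inLpv sigma g ->
  solves u g z -> solves u g z' ->
  W1p Omega sigma (z - z') /\ normW1p Omega sigma (z - z') = 0.
Proof.
move=> hsigma Uu lg zs zs'; have [C C0 hC] := solves_est hsigma.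
have /andP[sig2 _] := hsigma.
have sig1 : 1 <= sigma := le_trans l12 sig2.
have l2 := inLpv_le l02 sig2 lg.
have := solvesP (-1) Uu l2 l2 zs' zs; rewrite scaleN1r addrC => zs0.
have lg0 := inLpvP (-1) sig1 lg lg.
have [W nW] := hC _ _ _ Uu lg0 zs0; split => //.
apply/eqP; rewrite eq_le normW1p_ge0 andbT; apply: (le_trans nW).
have -> : (fun x => -1 *: g x + g x) = (fun=> 0 : E).
  by apply/funext => x; rewrite scaleN1r addNr.
rewrite /normLpv big1 ?mulr0// => i _.
have sig0 : 0 < sigma := lt_le_trans ltr01 sig1.
under eq_fun do rewrite mxE.
by have := normLpZ 0 sig0 (inLp_cst 0 sig0); rewrite normr0 !mul0r.
Qed.

Lemma all_bounds : exists2 K : R, 0 <= K & forall u, Uad u ->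
  [/\ forall phi, inLp Omega qt phi -> let z := zsol u phi in
        [/\ W1p Omega s1 z, normW1p Omega 2 z <= K * N phi
          & normW1p Omega s3 z <= K * N phi],
      forall eta, Uad (u + eta) -> let d := Y (u + eta) - Y u in
        W1p Omega s1 d /\ normW1p Omega 2 d <= K * N eta,
      forall eta, Uad (u + eta) -> let r := Y (u + eta) - Y u - zsol u eta in
        [/\ normW1p Omega 2 r <= K * N eta ^+ 2, W1p Omega s2 r,
            normW1p Omega s2 r <= K * N eta ^+ 2, W1p Omega s3 r
          & normW1p Omega s3 r <= K * (normLp Omega rho eta * N eta)]
    & forall eta phi, Uad (u + eta) -> inLp Omega qt phi ->
        let zeta := zsol (u + eta) phi - zsol u phi in
        [/\ normW1p Omega 2 zeta <= K * (N eta * N phi), W1p Omega s2 zeta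
          & normW1p Omega s2 zeta <= K * (N eta * N phi)]].
Proof.
have [Kz Kz0 hz] := zsol_bound; have [Kd Kd0 hd] := increment_bound.
have [Kr Kr0 hr] := increment2_bound; have [Ky Ky0 hy] := zsol_diff_bound.
have [I2 I20 hI2] := normW1p_le l02 s1_ge2.
have [I3 I30 hI3] := normW1p_le s3_gt0 s3_le_s1.
have [J2 J20 hJ2] := normW1p_le l02 s2_ge2.
have p1 : 0 <= I2 * Kz by exact: mulr_ge0. have p2 : 0 <= I3 * Kz by exact: mulr_ge0.
have p3 : 0 <= I2 * Kd by exact: mulr_ge0. have p4 : 0 <= J2 * Kr by exact: mulr_ge0.
have p5 : 0 <= J2 * Ky by exact: mulr_ge0.
(* The sum of all the nonnegative constants dominates each of them. W^{1,2} norms are included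
   because [F] is differentiated there; the norms with [s2] and [s3] serve the integrals with the
   adjoint state. *)
pose K := I2 * Kz + I3 * Kz + I2 * Kd + J2 * Kr + J2 * Ky + Kr + Ky.
have le_K c x : 0 <= x -> c <= K -> c * x <= K * x by move=> ? ?; exact: ler_wpM2r.
exists K => [|u Uu]; first by rewrite /K; lra.
have N0 := normLp_ge0 qt.
split=> [phi lphi z|eta Ue d|eta Ue r|eta phi Ue lphi zeta].
- have [Wz nz] := hz u phi Uu lphi; split => //.
    apply: (le_trans (hI2 z Wz)); apply: (le_trans (ler_wpM2l I20 nz)).
    by rewrite mulrA; apply: le_K => //; rewrite /K; lra.
  apply: (le_trans (hI3 z Wz)); apply: (le_trans (ler_wpM2l I30 nz)).
  by rewrite mulrA; apply: le_K => //; rewrite /K; lra.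
- have [Wd nd] := hd u eta Uu Ue; split => //.
  apply: (le_trans (hI2 d Wd)); apply: (le_trans (ler_wpM2l I20 nd)).
  by rewrite mulrA; apply: le_K => //; rewrite /K; lra.
- have [W2 n2 W3 n3] := hr u eta Uu Ue; split => //.
  + apply: (le_trans (hJ2 r W2)); apply: (le_trans (ler_wpM2l J20 n2)).
    by rewrite mulrA; apply: le_K; [exact: sqr_ge0|rewrite /K; lra].
  + by apply: (le_trans n2); apply: le_K; [exact: sqr_ge0|rewrite /K; lra].
  + apply: (le_trans n3); apply: le_K; last by rewrite /K; lra.
    by rewrite mulr_ge0 ?normLp_ge0.
- have [_ W2 n2] := hy u eta phi Uu Ue lphi.
  have NN : 0 <= N eta * N phi by rewrite mulr_ge0.
  split => //.
    apply: (le_trans (hJ2 zeta W2)); apply: (le_trans (ler_wpM2l J20 n2)).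
    by rewrite (mulrA J2); apply: le_K => //; rewrite /K; lra.
  by apply: (le_trans n2); apply: le_K => //; rewrite /K; lra.
Qed.

Lemma weak_formE phi w v :
  weak_form Omega phi w v = dual_pairing (fun x => phi x *: grad w x) v.
Proof. by congr int_Omega; apply/funext => x; rewrite edotZl. Qed.

(** Hoelder with three factors, the last one in L^2. The pair [(qt, s3)] is used for arbitrary
    directions and [(rho, s2)] for feasible increments. *)
Lemma weak_form_bound p q phi w v : 0 < p -> 0 < q -> p^-1 + q^-1 = 2^-1 ->
  inLp Omega p phi -> W1p Omega q w -> W1p Omega 2 v ->
  `|weak_form Omega phi w v| <= normLp Omega p phi * normW1p Omega q w * normW1p Omega 2 v.
Proof.
move=> p0 q0 pq lphi Ww Wv; have lw := grad_inLpv Ww.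
have l2 := inLpv_scale p0 q0 l02 pq lphi lw.
have n2 := normLpv_scale p0 q0 l02 pq lphi lw.
rewrite weak_formE; apply: (le_trans (norm_dual_pairing l02 l02 half_half l2 Wv)).
apply: ler_wpM2r; first exact: normW1p_ge0.
apply: (le_trans n2); apply: ler_wpM2l; [exact: normLp_ge0|exact: normLpv_grad].
Qed.

Lemma weak_formPphi (a : R) phi phi' w v : inLp Omega qt phi -> inLp Omega qt phi' ->
  W1p Omega s3 w -> W1p Omega 2 v ->
  weak_form Omega (fun x => a * phi x + phi' x) w v =
  a * weak_form Omega phi w v + weak_form Omega phi' w v.
Proof.
move=> l l' /grad_inLpv lw /grad_inLpv lv.
have l2 := inLpv_scale qt0 s3_gt0 l02 exp_qt_s3 l lw.
have l2' := inLpv_scale qt0 s3_gt0 l02 exp_qt_s3 l' lw.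
rewrite !weak_formE -(dual_pairingPl l02 l02 half_half a l2 l2' lv).
by congr dual_pairing; apply/funext => x; rewrite scalerA -scalerDl.
Qed.

Lemma weak_formPw (a : R) phi w w' v : inLp Omega qt phi ->
  W1p Omega s3 w -> W1p Omega s3 w' -> W1p Omega 2 v ->
  weak_form Omega phi (a *: w + w') v =
  a * weak_form Omega phi w v + weak_form Omega phi w' v.
Proof.
move=> l /grad_inLpv lw /grad_inLpv lw' /grad_inLpv lv.
have l2 := inLpv_scale qt0 s3_gt0 l02 exp_qt_s3 l lw.
have l2' := inLpv_scale qt0 s3_gt0 l02 exp_qt_s3 l lw'.
rewrite !weak_formE -(dual_pairingPl l02 l02 half_half a l2 l2' lv).
have <- : (fun x => phi x *: (a *: grad w x + grad w' x)) =
    (fun x => a *: (phi x *: grad w x) + phi x *: grad w' x).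
  by apply/funext => x; rewrite scalerDr !scalerA mulrC.
by [].
Qed.

Lemma weak_formB phi w w' v : inLp Omega qt phi ->
  W1p Omega s3 w -> W1p Omega s3 w' -> W1p Omega 2 v ->
  weak_form Omega phi (w - w') v = weak_form Omega phi w v - weak_form Omega phi w' v.
Proof.
move=> l Ww Ww' Wv; rewrite addrC -scaleN1r (weak_formPw (-1) l Ww' Ww Wv).
by rewrite mulN1r addrC.
Qed.

Let W1p_s1_s3 w : W1p Omega s1 w -> W1p Omega s3 w.
Proof. exact: (W1p_le s3_gt0 s3_le_s1). Qed.
Let W1p_s1_2 w : W1p Omega s1 w -> W1p Omega 2 w.
Proof. exact: (W1p_le l02 s1_ge2). Qed.

Lemma weak_form_eq phi w w' v : inLp Omega qt phi ->
  W1p Omega s1 w -> W1p Omega s1 w' -> normW1p Omega s1 (w - w') = 0 ->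
  W1p Omega 2 v -> weak_form Omega phi w v = weak_form Omega phi w' v.
Proof.
move=> l W W' n0 Wv; apply/eqP; rewrite -subr_eq0 -normr_le0.
have s11 : 1 <= s1 := le_trans l12 s1_ge2.
have WB := W1pB s11 W W'.
rewrite -weak_formB//; try exact: W1p_s1_s3.
apply: (le_trans (weak_form_bound qt0 s3_gt0 exp_qt_s3 l (W1p_s1_s3 WB) Wv)).
have [C C0 hC] := normW1p_le s3_gt0 s3_le_s1.
have := hC _ WB; rewrite n0 mulr0 => h.
have -> : normW1p Omega s3 (w - w') = 0 by apply/eqP; rewrite eq_le h normW1p_ge0.
by rewrite mulr0 mul0r.
Qed.

(** * The reduced objective *)

Section objective.
Variables (F : @sob R n -> R) (dF : @sob R n -> @sob R n -> R)
  (d2F : @sob R n -> @sob R n -> @sob R n -> R).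
Hypothesis hF : frechet_C2 Omega F dF d2F.
Variable Sp : @sob R n -> (E -> R) -> @sob R n.
Hypothesis hSp : forall y u, W1p Omega 2 y -> Uad u ->
  is_adjoint Omega Gt u (dF y) (Sp y u).
Local Notation H1 := (W1p Omega 2).
Local Notation nH1 := (normW1p Omega 2).
Local Notation P u := (Sp (Y u) u).

Let dF_lin y : H1 y -> is_linear_on H1 (dF y).
Proof. by case: hF => h _ /h[]. Qed.

Let d2F_linl y v : H1 y -> H1 v -> is_linear_on H1 ((d2F y)^~ v).
Proof. by case: hF => _ [h _] /h[_ + _] Hv; apply. Qed.

Let d2F_linr y h : H1 y -> H1 h -> is_linear_on H1 (d2F y h).
Proof. by case: hF => _ [k _] /k[+ _ _] Hh; apply. Qed.

Lemma linear_onB (f0 : @sob R n -> R) v w : is_linear_on H1 f0 -> H1 v -> H1 w ->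
  f0 (v - w) = f0 v - f0 w.
Proof. by move=> lf Hv Hw; rewrite addrC -scaleN1r lf// mulN1r addrC. Qed.

Lemma d2F_bound y : H1 y -> exists2 D : R, 0 <= D &
  forall h v, H1 h -> H1 v -> `|d2F y h v| <= D * nH1 h * nH1 v.
Proof.
case: hF => _ [h _] /h[_ _ [C hC]]; exists `|C| => // k v Hk Hv.
apply: (le_trans (hC k v Hk Hv)); apply: ler_wpM2r; first exact: normW1p_ge0.
by apply: ler_wpM2r; [exact: normW1p_ge0|exact: ler_norm].
Qed.

Lemma d2F_eq y h h' v v' : H1 y -> H1 h -> H1 h' -> H1 v -> H1 v' ->
  nH1 (h - h') = 0 -> nH1 (v - v') = 0 -> d2F y h v = d2F y h' v'.
Proof.
move=> Hy Hh Hh' Hv Hv' h0 v0; have [D D0 hD] := d2F_bound Hy.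
have e1 : d2F y h v = d2F y h' v.
  apply/eqP; rewrite -subr_eq0 -normr_le0 -(linear_onB (d2F_linl Hy Hv) Hh Hh').
  by have := hD _ _ (W1pB l12 Hh Hh') Hv; rewrite h0 mulr0 mul0r.
rewrite e1; apply/eqP; rewrite -subr_eq0 -normr_le0.
rewrite -(linear_onB (d2F_linr Hy Hh') Hv Hv').
by have := hD _ _ Hh' (W1pB l12 Hv Hv'); rewrite v0 mulr0.
Qed.

Lemma adjoint_H1 u : Uad u -> H1 (P u).
Proof. by move=> Uu; have [[]] := hSp (state_W12 Uu) Uu. Qed.

(** By symmetry of the weak form, the equation of [z] tested with the adjoint state and the adjoint
    equation tested with [z] have the same left-hand side. This trades F'(y) z for an integral that
    involves only the source. *)
Lemma adjoint_pairing u g z : Uad u -> solves u g z ->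
  dF (Y u) z = dual_pairing g (P u).
Proof.
move=> Uu [Hz zE]; have [HP PE] := hSp (state_W12 Uu) Uu.
by apply: oppr_inj; rewrite -(PE z Hz) weak_formC zE.
Qed.

(** The adjoint form is meaningful, and linear, for every direction in L^qt and not only for
    feasible ones. *)
Definition dj u phi : R := weak_form Omega phi (Y u) (P u).

Definition d2j u phi psi : R :=
  d2F (Y u) (zsol u psi) (zsol u phi) + weak_form Omega psi (zsol u phi) (P u)
  + weak_form Omega phi (zsol u psi) (P u).

Lemma dj_solves u phi z : Uad u -> solves u (fun x => phi x *: grad (Y u) x) z ->
  dj u phi = dF (Y u) z.
Proof. by move=> Uu zs; rewrite (adjoint_pairing Uu zs) /dj weak_formE. Qed.

(** Replacing [zsol] by other solutions changes each term by something bounded by a norm that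
    vanishes. Inserting linear combinations of solutions gives bilinearity; inserting [dS] gives the
    formula for feasible directions. *)
Lemma d2j_solves u phi psi zphi zpsi : Uad u ->
  inLp Omega qt phi -> inLp Omega qt psi ->
  solves u (fun x => phi x *: grad (Y u) x) zphi ->
  solves u (fun x => psi x *: grad (Y u) x) zpsi ->
  d2j u phi psi = d2F (Y u) zpsi zphi + weak_form Omega psi zphi (P u)
                  + weak_form Omega phi zpsi (P u).
Proof.
move=> Uu lphi lpsi zphis zpsis.
have [C C0 hC] := solves_est s1_itv.
have [W1 _] := hC _ _ _ Uu (source_bound Uu lphi) zphis.
have [W2 _] := hC _ _ _ Uu (source_bound Uu lpsi) zpsis.
have [W3 _] := hC _ _ _ Uu (source_bound Uu lphi) (zsolP Uu lphi).
have [W4 _] := hC _ _ _ Uu (source_bound Uu lpsi) (zsolP Uu lpsi).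
have [_ n1] := solves_uniq s1_itv Uu (source_bound Uu lphi) (zsolP Uu lphi) zphis.
have [_ n2] := solves_uniq s1_itv Uu (source_bound Uu lpsi) (zsolP Uu lpsi) zpsis.
have l22 : (2 : R) <= 2 <= s by apply/andP; split => //; exact: ltW.
have b1 := inLpv_le l02 s1_ge2 (source_bound Uu lphi).
have b2 := inLpv_le l02 s1_ge2 (source_bound Uu lpsi).
have [_ m1] := solves_uniq l22 Uu b1 (zsolP Uu lphi) zphis.
have [_ m2] := solves_uniq l22 Uu b2 (zsolP Uu lpsi) zpsis.
have HP := adjoint_H1 Uu.
rewrite /d2j (weak_form_eq lpsi W3 W1 n1 HP) (weak_form_eq lphi W4 W2 n2 HP).
rewrite (d2F_eq (state_W12 Uu) (W1p_s1_2 W4) (W1p_s1_2 W2) (W1p_s1_2 W3)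
  (W1p_s1_2 W1) m2 m1).
by [].
Qed.

Lemma dj_bounded_linear u : Uad u -> bounded_linear_Lp Omega qt (dj u).
Proof.
move=> Uu; have [K _ hK] := state_bound; have [Ws _] := hK u Uu.
have /andP[_ s3s] := s3_itv.
have W3 := W1p_le s3_gt0 s3s Ws; have HP := adjoint_H1 Uu.
split; first by move=> a phi psi l l'; exact: weak_formPphi.
exists (normW1p Omega s3 (Y u) * nH1 (P u)) => phi l.
by rewrite mulrC mulrA; exact: weak_form_bound.
Qed.

Lemma solves_comb u (a : R) phi phi' z z' : Uad u ->
  inLp Omega qt phi -> inLp Omega qt phi' ->
  solves u (fun x => phi x *: grad (Y u) x) z ->
  solves u (fun x => phi' x *: grad (Y u) x) z' ->
  solves u (fun x => (a * phi x + phi' x) *: grad (Y u) x) (a *: z + z').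
Proof.
move=> Uu l l' zs zs'.
have b1 := inLpv_le l02 s1_ge2 (source_bound Uu l).
have b2 := inLpv_le l02 s1_ge2 (source_bound Uu l').
have := solvesP a Uu b1 b2 zs zs'; congr (solves u _ _); apply/funext => x.
by rewrite scalerA -scalerDl.
Qed.

Lemma d2j_bounded_bilinear u : Uad u -> bounded_bilinear_Lp Omega qt (d2j u).
Proof.
move=> Uu; have HP := adjoint_H1 Uu; have Hy := state_W12 Uu.
have [K K0 hK] := all_bounds; have [bz _ _ _] := hK u Uu.
have [D D0 hD] := d2F_bound Hy.
have l_comb (a : R) phi phi' : inLp Omega qt phi -> inLp Omega qt phi' ->
    inLp Omega qt (fun x => a * phi x + phi' x).
  by move=> l l'; exact: (inLpD qt1 (inLpZ a qt0 l) l').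
split.
- move=> a phi phi' psi l l' lp.
  have zc := solves_comb a Uu l l' (zsolP Uu l) (zsolP Uu l').
  rewrite (d2j_solves Uu (l_comb a _ _ l l') lp zc (zsolP Uu lp)) /d2j.
  have [W1 _ _] := bz phi l; have [W2 _ _] := bz phi' l'; have [W3 _ _] := bz psi lp.
  have q1 := d2F_linr Hy (W1p_s1_2 W3) a (W1p_s1_2 W1) (W1p_s1_2 W2).
  have q2 := weak_formPw a lp (W1p_s1_s3 W1) (W1p_s1_s3 W2) HP.
  have q3 := weak_formPphi a l l' (W1p_s1_s3 W3) HP.
  exact: (etrans (f_equal2 +%R (f_equal2 +%R q1 q2) q3) (comb3 _ _ _ _ _ _ _)).
- move=> a phi psi psi' lp l l'.
  have zc := solves_comb a Uu l l' (zsolP Uu l) (zsolP Uu l').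
  rewrite (d2j_solves Uu lp (l_comb a _ _ l l') (zsolP Uu lp) zc) /d2j.
  have [W1 _ _] := bz psi l; have [W2 _ _] := bz psi' l'; have [W3 _ _] := bz phi lp.
  have q1 := d2F_linl Hy (W1p_s1_2 W3) a (W1p_s1_2 W1) (W1p_s1_2 W2).
  have q2 := weak_formPphi a l l' (W1p_s1_s3 W3) HP.
  have q3 := weak_formPw a lp (W1p_s1_s3 W1) (W1p_s1_s3 W2) HP.
  exact: (etrans (f_equal2 +%R (f_equal2 +%R q1 q2) q3) (comb3 _ _ _ _ _ _ _)).
exists (D * K * K + K * nH1 (P u) + K * nH1 (P u)) => phi psi l l'.
have [W1 n1 m1] := bz phi l; have [W2 n2 m2] := bz psi l'.
have N1 := normLp_ge0 qt phi; have N2 := normLp_ge0 qt psi.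
have P0 := normW1p_ge0 2 (P u).
have b1 : `|d2F (Y u) (zsol u psi) (zsol u phi)| <= D * K * K * (N phi * N psi).
  apply: (le_trans (hD _ _ (W1p_s1_2 W2) (W1p_s1_2 W1))).
  apply: (@le_trans _ _ (D * (K * N psi) * (K * N phi))).
    exact: (prod_le D0 (normW1p_ge0 2 _) (normW1p_ge0 2 _) n2 n1).
  by rewrite le_eqVlt; apply/orP; left; apply/eqP; ring.
have bw phi' psi' : inLp Omega qt phi' -> inLp Omega qt psi' ->
    `|weak_form Omega psi' (zsol u phi') (P u)| <= K * nH1 (P u) * (N phi' * N psi').
  move=> h h'; have [W _ m] := bz phi' h.
  apply: (le_trans (weak_form_bound qt0 s3_gt0 exp_qt_s3 h' (W1p_s1_s3 W) HP)).
  apply: (@le_trans _ _ (N psi' * (K * N phi') * nH1 (P u))).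
    by apply: ler_wpM2r => //; apply: ler_wpM2l => //; exact: normLp_ge0.
  by rewrite le_eqVlt; apply/orP; left; apply/eqP; ring.
have b2 := bw phi psi l l'; have b3 := bw psi phi l' l.
rewrite [N psi * _]mulrC in b3.
by rewrite -[leRHS]mulrA; exact: (norm_sum3_le b1 b2 b3).
Qed.

Let F_first y : H1 y -> forall e : R, 0 < e -> exists2 d : R, 0 < d &
  forall h, H1 h -> nH1 h < d -> `|F (y + h) - F y - dF y h| <= e * nH1 h.
Proof. by case: hF => _ [_ [h _]]; exact: h. Qed.

Let F_second y : H1 y -> forall e : R, 0 < e -> exists2 d : R, 0 < d &
  forall h, H1 h -> nH1 h < d -> forall v, H1 v ->
    `|dF (y + h) v - dF y v - d2F y h v| <= e * nH1 h * nH1 v.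
Proof. by case: hF => _ [_ [_ [h _]]]; exact: h. Qed.

Lemma F_taylor2 y (e : R) : H1 y -> 0 < e -> exists2 d : R, 0 < d &
  forall h, H1 h -> nH1 h < d ->
    `|F (y + h) - F y - dF y h - 2^-1 * d2F y h h| <= e * nH1 h ^+ 2.
Proof.
move=> Hy e0; apply: (@taylor2 R (@sob R n) H1 nH1) => //.
- by move=> a v w; exact: W1pP.
- move=> a v Hv; have H0 := W1p_0 l02.
  have := normW1pP l12 Hv H0 (W1pP a l12 Hv H0).
  by rewrite normW1p0// !addr0.
- exact: normW1p_ge0.
- by move=> x a v w Hx; exact: dF_lin.
- by move=> x v a h k Hx Hv; exact: d2F_linl.
- exact: W1p_0.
Qed.

(** Taylor's formula is applied to the whole increment [d], after which [d] is replaced by its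
    linearisation [z]. This leaves the Taylor remainder, the integral of [eta grad r . grad p], and
    F'' with one argument [r], which is of third order; each takes a third of [e]. *)
Lemma second_order_remainder u (e : R) : Uad u -> 0 < e -> exists2 delta : R, 0 < delta &
  forall eta, Uad (u + eta) -> N eta < delta ->
    `|F (Y (u + eta)) - F (Y u) - dj u eta - 2^-1 * d2j u eta eta| <= e * N eta ^+ 2.
Proof.
move=> Uu e0; have HP := adjoint_H1 Uu; have Hy := state_W12 Uu.
have [K K0 hK] := all_bounds; have [bz bd br _] := hK u Uu.
have [D D0 hD] := d2F_bound Hy.
have P0 := normW1p_ge0 2 (P u).
have e3 : 0 < e / 3 by rewrite divr_gt0.
have KK0 : 0 <= K * K by exact: mulr_ge0.
have KP0 : 0 <= K * nH1 (P u) by exact: mulr_ge0.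
have DK0 : 0 <= D * (K * K) by exact: mulr_ge0.
have [d1 d10 hd1] := F_taylor2 Hy (frac_gt0 e3 KK0).
have [d2 d20 hd2] := feasible_rho_small (frac_gt0 e3 KP0).
(* Three conditions: [d] stays in the neighbourhood where Taylor's formula holds, the L^rho norm of
   [eta] is small, and [N eta] is small enough to absorb the third-order terms. *)
exists (Num.min (d1 / (K + 1)) (Num.min d2 (e / 3 / (D * (K * K) + 1)))).
  by rewrite !lt_min d20 !frac_gt0//.
move=> eta Ue; rewrite !lt_min => /andP[Nd1 /andP[Nd2 Nd3]].
have leta := feasible_inLp qt0 Uu Ue.
have Nrho := ltW (hd2 u eta Uu Ue Nd2).
have [Wd nd] := bd eta Ue; have [nr Wr2 nr2 Wr3 nr3] := br eta Ue.
have [Wz nz _] := bz eta leta.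
have N0 := normLp_ge0 qt eta.
pose d := Y (u + eta) - Y u; pose z := zsol u eta; pose r := d - z.
rewrite -/d -/z -/r in Wd nd nr Wr2 nr2 Wr3 nr3 Wz nz.
have Hd : H1 d := W1p_s1_2 Wd; have Hz : H1 z := W1p_s1_2 Wz.
have Hr : H1 r := W1pB l12 Hd Hz.
have yd : Y u + d = Y (u + eta) by rewrite /d addrC subrK.
have small : nH1 d < d1.
  apply: (le_lt_trans nd); apply: (@le_lt_trans _ _ ((K + 1) * N eta)).
    by apply: ler_wpM2r => //; rewrite lerDl.
  by rewrite mulrC -ltr_pdivlMr// ltr_wpDl.
have T1 := hd1 d Hd small; rewrite yd in T1.
have dFz : dj u eta = dF (Y u) z by apply: dj_solves => //; exact: zsolP.
(* The left-hand side is F'(y) r, and [r] solves the equation with source [eta grad d]. Subtracting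
   the same integral with [z], which [d2j] contributes, leaves the one with [r]. *)
have dFr : dF (Y u) d - dF (Y u) z = weak_form Omega eta d (P u).
  rewrite -(linear_onB (dF_lin Hy) Hd Hz) weak_formE.
  exact: (adjoint_pairing Uu (increment2_solves Uu Ue)).
have wr : weak_form Omega eta r (P u) =
    weak_form Omega eta d (P u) - weak_form Omega eta z (P u).
  exact: (weak_formB leta (W1p_s1_s3 Wd) (W1p_s1_s3 Wz) HP).
have q1 : d2F (Y u) d r = d2F (Y u) d d - d2F (Y u) d z.
  exact: (linear_onB (d2F_linr Hy Hd) Hd Hz).
have q2 : d2F (Y u) r z = d2F (Y u) d z - d2F (Y u) z z.
  exact: (linear_onB (d2F_linl Hy Hz) Hd Hz).
have -> : F (Y (u + eta)) - F (Y u) - dj u eta - 2^-1 * d2j u eta eta =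
    (F (Y (u + eta)) - F (Y u) - dF (Y u) d - 2^-1 * d2F (Y u) d d)
    + weak_form Omega eta r (P u) + 2^-1 * (d2F (Y u) d r + d2F (Y u) r z).
  by rewrite dFz wr q1 q2 /d2j -/z; exact: second_order_algebra.
have t1 : e / 3 / (K * K + 1) * nH1 d ^+ 2 <= e / 3 * N eta ^+ 2.
  apply: (@le_trans _ _ (e / 3 / (K * K + 1) * ((K * K) * N eta ^+ 2))).
    apply: ler_wpM2l; first exact/ltW/frac_gt0.
    rewrite (_ : K * K * _ = (K * N eta) ^+ 2); last by ring.
    by rewrite ler_sqr ?nnegrE ?mulr_ge0 ?normW1p_ge0.
  by rewrite mulrA; apply: ler_wpM2r; [exact: sqr_ge0|exact: frac_le].
have t2 : `|weak_form Omega eta r (P u)| <= e / 3 * N eta ^+ 2.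
  have lrho := feasible_inLp rho_gt0 Uu Ue.
  apply: (le_trans (weak_form_bound rho_gt0 s2_gt0 exp_rho_s2 lrho Wr2 HP)).
  apply: (@le_trans _ _ (e / 3 / (K * nH1 (P u) + 1) * (K * N eta ^+ 2) * nH1 (P u))).
    apply: ler_wpM2r => //; apply: ler_pM => //; [exact: normLp_ge0|exact: normW1p_ge0].
  rewrite (_ : _ * nH1 (P u) =
    e / 3 / (K * nH1 (P u) + 1) * (K * nH1 (P u)) * N eta ^+ 2); last by ring.
  by apply: ler_wpM2r; [exact: sqr_ge0|exact: frac_le].
have t3 : `|2^-1 * (d2F (Y u) d r + d2F (Y u) r z)| <= e / 3 * N eta ^+ 2.
  have a1 : `|d2F (Y u) d r| <= D * (K * K) * (N eta * N eta ^+ 2).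
    apply: (le_trans (hD _ _ Hd Hr)).
    apply: (@le_trans _ _ (D * (K * N eta) * (K * N eta ^+ 2))).
      exact: (prod_le D0 (normW1p_ge0 2 d) (normW1p_ge0 2 r) nd nr).
    by rewrite le_eqVlt; apply/orP; left; apply/eqP; ring.
  have a2 : `|d2F (Y u) r z| <= D * (K * K) * (N eta * N eta ^+ 2).
    apply: (le_trans (hD _ _ Hr Hz)).
    apply: (@le_trans _ _ (D * (K * N eta ^+ 2) * (K * N eta))).
      exact: (prod_le D0 (normW1p_ge0 2 r) (normW1p_ge0 2 z) nr nz).
    by rewrite le_eqVlt; apply/orP; left; apply/eqP; ring.
  have a3 : D * (K * K) * (N eta * N eta ^+ 2) <= e / 3 * N eta ^+ 2.
    rewrite mulrA; apply: ler_wpM2r; first exact: sqr_ge0.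
    rewrite mulrC; apply: (@le_trans _ _ (e / 3 / (D * (K * K) + 1) * (D * (K * K)))).
      by apply: ler_wpM2r => //; exact: ltW.
    exact: frac_le.
  exact: (half_sum_le (le_trans a1 a3) (le_trans a2 a3)).
exact: (norm3_le (le_trans T1 t1) t2 t3).
Qed.

(** The factor [N phi] makes the estimate uniform on the unit ball of directions, as the dual norm
    of the remainder requires. [delta] is chosen independently of [phi], so smallness may come from
    [eta] only. *)
Lemma derivative_remainder u (e : R) : Uad u -> 0 < e -> exists2 delta : R, 0 < delta &
  forall eta phi, Uad (u + eta) -> N eta < delta -> inLp Omega qt phi ->
    `|dj (u + eta) phi - dj u phi - d2j u phi eta| <= e * (N eta * N phi).
Proof.
move=> Uu e0; have HP := adjoint_H1 Uu; have Hy := state_W12 Uu.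
have [K K0 hK] := all_bounds; have [bz bd br by_] := hK u Uu.
have [D D0 hD] := d2F_bound Hy.
have P0 := normW1p_ge0 2 (P u).
have e3 : 0 < e / 3 by rewrite divr_gt0.
have KK0 : 0 <= K * K by exact: mulr_ge0.
have KP0 : 0 <= 2 * (K * nH1 (P u)) by rewrite !mulr_ge0.
have DK0 : 0 <= 2 * (D * (K * K)) by rewrite !mulr_ge0.
have [d1 d10 hd1] := F_second Hy (frac_gt0 e3 KK0).
have [d2 d20 hd2] := feasible_rho_small (frac_gt0 e3 KP0).
(* The last two constants are doubled because two integrals and two values of F'' each share one
   third of [e]. *)
exists (Num.min (d1 / (K + 1)) (Num.min d2 (e / 3 / (2 * (D * (K * K)) + 1)))).
  by rewrite !lt_min d20 !frac_gt0.
move=> eta phi Ue; rewrite !lt_min => /andP[Nd1 /andP[Nd2 Nd3]] lphi.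
have leta := feasible_inLp qt0 Uu Ue.
have lrho := feasible_inLp rho_gt0 Uu Ue.
have Nrho := ltW (hd2 u eta Uu Ue Nd2).
have [Wd nd] := bd eta Ue; have [nr Wr2 nr2 Wr3 nr3] := br eta Ue.
have [We ne _] := bz eta leta; have [Wz nz _] := bz phi lphi.
(* [K] is uniform over admissible coefficients, so it also bounds the linearised state at
   [u + eta]. *)
have [bz' _ _ _] := hK _ Ue; have [Wz' nz' _] := bz' phi lphi.
have [nt Wt2 nt2] := by_ eta phi Ue lphi.
have N0 := normLp_ge0 qt eta; have M0 := normLp_ge0 qt phi.
have NM0 : 0 <= N eta * N phi by exact: mulr_ge0.
have [? _ hzeta] := zsol_diff_bound; have [zs _ _] := hzeta u eta phi Uu Ue lphi.
pose d := Y (u + eta) - Y u; pose ze := zsol u eta; pose z := zsol u phi.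
pose z' := zsol (u + eta) phi; pose r := d - ze; pose t := z' - z.
rewrite -/d -/ze -/z -/z' -/r -/t in Wd nd nr Wr2 nr2 Wr3 nr3 We ne Wz nz Wz' nz' nt Wt2 nt2 zs.
have Hd : H1 d := W1p_s1_2 Wd; have He : H1 ze := W1p_s1_2 We.
have Hz : H1 z := W1p_s1_2 Wz; have Hz' : H1 z' := W1p_s1_2 Wz'.
have Hr : H1 r := W1pB l12 Hd He; have Ht : H1 t := W1pB l12 Hz' Hz.
have yd : Y u + d = Y (u + eta) by rewrite /d addrC subrK.
have small : nH1 d < d1.
  apply: (le_lt_trans nd); apply: (@le_lt_trans _ _ ((K + 1) * N eta)).
    by apply: ler_wpM2r => //; rewrite lerDl.
  by rewrite mulrC -ltr_pdivlMr// ltr_wpDl.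
have T1 := hd1 d Hd small z' Hz'; rewrite yd in T1.
have jz : dj u phi = dF (Y u) z by apply: dj_solves => //; exact: zsolP.
have jz' : dj (u + eta) phi = dF (Y (u + eta)) z' by apply: dj_solves => //; exact: zsolP.
have dFt : dF (Y u) z' - dF (Y u) z = weak_form Omega eta z' (P u) + weak_form Omega phi d (P u).
  rewrite -(linear_onB (dF_lin Hy) Hz' Hz) (adjoint_pairing Uu zs) !weak_formE.
  have l1 := inLpv_scale qt0 s3_gt0 l02 exp_qt_s3 leta (grad_inLpv (W1p_s1_s3 Wz')).
  have l2 := inLpv_scale qt0 s3_gt0 l02 exp_qt_s3 lphi (grad_inLpv (W1p_s1_s3 Wd)).
  by rewrite (dual_pairingPl l02 l02 half_half 1 l1 l2 (grad_inLpv HP)) mul1r.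
have wt := weak_formB leta (W1p_s1_s3 Wz') (W1p_s1_s3 Wz) HP.
have wr := weak_formB lphi (W1p_s1_s3 Wd) (W1p_s1_s3 We) HP.
have qd1 := linear_onB (d2F_linr Hy Hd) Hz' Hz.
have qr1 := linear_onB (d2F_linl Hy Hz) Hd He.
have E0 := derivative_algebra (dF (Y (u + eta)) z') (d2F (Y u) d z') (d2F (Y u) d z)
  (d2F (Y u) ze z) (weak_form Omega eta z (P u)) (weak_form Omega phi ze (P u)) dFt.
have -> : dj (u + eta) phi - dj u phi - d2j u phi eta =
    (dF (Y (u + eta)) z' - dF (Y u) z' - d2F (Y u) d z')
    + (weak_form Omega eta t (P u) + weak_form Omega phi r (P u))
    + (d2F (Y u) d t + d2F (Y u) r z).
  rewrite jz jz'.
  exact: (etrans E0 (esym (f_equal2 +%R (f_equal2 +%R erefl (f_equal2 +%R wt wr))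
    (f_equal2 +%R qd1 qr1)))).
have t1 : e / 3 / (K * K + 1) * nH1 d * nH1 z' <= e / 3 * (N eta * N phi).
  apply: (@le_trans _ _ (e / 3 / (K * K + 1) * (K * N eta) * (K * N phi))).
    have c0 : 0 <= e / 3 / (K * K + 1) by exact/ltW/frac_gt0.
    exact: (prod_le c0 (normW1p_ge0 2 d) (normW1p_ge0 2 z') nd nz').
  rewrite (_ : _ * (K * N phi) = e / 3 / (K * K + 1) * (K * K) * (N eta * N phi)).
    by apply: ler_wpM2r => //; exact: frac_le.
  by ring.
have t2 : `|weak_form Omega eta t (P u) + weak_form Omega phi r (P u)|
    <= e / 3 * (N eta * N phi).
  set c := e / 3 / (2 * (K * nH1 (P u)) + 1).
  have c0 : 0 <= c by exact/ltW/frac_gt0.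
  (* Here the increment multiplies, so it is taken in L^rho against [t] in W^{1,s2}. *)
  have b1 : `|weak_form Omega eta t (P u)| <= c * (K * nH1 (P u)) * (N eta * N phi).
    apply: (le_trans (weak_form_bound rho_gt0 s2_gt0 exp_rho_s2 lrho Wt2 HP)).
    apply: (@le_trans _ _ (c * (K * (N eta * N phi)) * nH1 (P u))).
      by apply: ler_wpM2r => //; apply: ler_pM => //; [exact: normLp_ge0|exact: normW1p_ge0].
    by rewrite le_eqVlt; apply/orP; left; apply/eqP; ring.
  (* Here [phi] multiplies and is only in L^qt; the small factor in L^rho is contained in the
     W^{1,s3} bound of [r]. *)
  have b2 : `|weak_form Omega phi r (P u)| <= c * (K * nH1 (P u)) * (N eta * N phi).
    apply: (le_trans (weak_form_bound qt0 s3_gt0 exp_qt_s3 lphi Wr3 HP)).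
    apply: (@le_trans _ _ (N phi * (K * (c * N eta)) * nH1 (P u))).
      apply: ler_wpM2r => //; apply: ler_wpM2l => //; apply: (le_trans nr3).
      by apply: ler_wpM2l => //; apply: ler_wpM2r.
    by rewrite le_eqVlt; apply/orP; left; apply/eqP; ring.
  apply: (norm_sum2_le b1 b2 (c := e / 3)) => //.
  rewrite (_ : _ + _ = c * (2 * (K * nH1 (P u)))); last by ring.
  exact: frac_le.
have t3 : `|d2F (Y u) d t + d2F (Y u) r z| <= e / 3 * (N eta * N phi).
  set c := e / 3 / (2 * (D * (K * K)) + 1) in Nd3.
  have a1 : `|d2F (Y u) d t| <= c * (D * (K * K)) * (N eta * N phi).
    apply: (le_trans (hD _ _ Hd Ht)).
    apply: (@le_trans _ _ (D * (K * N eta) * (K * (N eta * N phi)))).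
      exact: (prod_le D0 (normW1p_ge0 2 d) (normW1p_ge0 2 t) nd nt).
    rewrite (_ : _ * (K * _) = N eta * (D * (K * K)) * (N eta * N phi)); last by ring.
    by apply: ler_wpM2r => //; apply: ler_wpM2r; [rewrite !mulr_ge0|exact: ltW].
  have a2 : `|d2F (Y u) r z| <= c * (D * (K * K)) * (N eta * N phi).
    apply: (le_trans (hD _ _ Hr Hz)).
    apply: (@le_trans _ _ (D * (K * N eta ^+ 2) * (K * N phi))).
      exact: (prod_le D0 (normW1p_ge0 2 r) (normW1p_ge0 2 z) nr nz).
    rewrite (_ : _ * (K * _) = N eta * (D * (K * K)) * (N eta * N phi)); last by ring.
    by apply: ler_wpM2r => //; apply: ler_wpM2r; [rewrite !mulr_ge0|exact: ltW].
  apply: (norm_sum2_le a1 a2 (c := e / 3)) => //.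
  rewrite (_ : _ + _ = c * (2 * (D * (K * K)))); last by ring.
  exact: frac_le.
exact: (norm3_le (le_trans T1 t1) t2 t3).
Qed.

(** * Differentiability for feasible variations *)

Local Notation j := (fun u => F (Y u)).

Lemma second_order_feasible u : Uad u -> feasible_to0 Omega ul uu qt u (fun eta =>
  (j (u + eta) - j u - dj u eta - 2^-1 * d2j u eta eta) / N eta ^+ 2).
Proof.
move=> Uu e e0; have [d d0 hd] := second_order_remainder Uu (half_gt0 e0).
exists d => // eta Ue /andP[N0 Nd].
exact: (quotient_lt e0 (exprn_gt0 2 N0) (hd eta Ue Nd)).
Qed.

(** The second-order remainder with tolerance [1] and the boundedness of [d2j] make the first-order
    remainder O(|eta|^2). *)
Lemma first_order_feasible u : Uad u -> feasible_to0 Omega ul uu qt u (fun eta =>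
  (j (u + eta) - j u - dj u eta) / N eta).
Proof.
move=> Uu e e0; have [d d0 hd] := second_order_remainder Uu ltr01.
have [_ _ [C hC]] := d2j_bounded_bilinear Uu.
have C0 : 0 <= 1 + `|C| by rewrite addr_ge0.
exists (Num.min d (e / 2 / (1 + `|C| + 1))).
  by rewrite lt_min d0 frac_gt0// half_gt0.
move=> eta Ue /andP[N0]; rewrite lt_min => /andP[Nd1 Nd2].
have leta := feasible_inLp qt0 Uu Ue.
apply: (quotient_lt e0 N0); apply: (@le_trans _ _ ((1 + `|C|) * N eta * N eta)).
  exact: (first_order_algebra (hd eta Ue Nd1) (hC eta eta leta leta) (ltW N0)).
apply: ler_wpM2r; first exact: ltW.
apply: (@le_trans _ _ (e / 2 / (1 + `|C| + 1) * (1 + `|C|))).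
  by rewrite mulrC; apply: ler_wpM2r => //; exact: ltW.
by apply: frac_le => //; exact: half_gt0.
Qed.

Lemma derivative_feasible u : Uad u -> feasible_to0 Omega ul uu qt u (fun eta =>
  norm_dual_Lp Omega qt (fun phi => dj (u + eta) phi - dj u phi - d2j u phi eta) / N eta).
Proof.
move=> Uu e e0; have [d d0 hd] := derivative_remainder Uu (half_gt0 e0).
exists d => // eta Ue /andP[N0 Nd].
have bound phi : inLp Omega qt phi /\ N phi <= 1 ->
    `|dj (u + eta) phi - dj u phi - d2j u phi eta| <= e / 2 * N eta.
  move=> [lphi n1]; apply: (le_trans (hd eta phi Ue Nd lphi)).
  apply: ler_wpM2l; first by rewrite ltW// half_gt0.
  by rewrite -[leRHS]mulr1; apply: ler_wpM2l => //; exact: ltW.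
apply: (quotient_lt e0 N0); rewrite /norm_dual_Lp.
set A := (X in sup X).
(* The zero direction makes the set nonempty, as needed both to bound its supremum and to see that
   the supremum is nonnegative. *)
have A0 : A `|dj (u + eta) (fun=> 0) - dj u (fun=> 0) - d2j u (fun=> 0) eta|.
  exists (fun=> 0) => //; split; first exact: inLp_cst.
  by have := normLpZ 0 qt0 (inLp_cst 0 qt0); rewrite normr0 !mul0r => ->.
have ubA : ubound A (e / 2 * N eta) by move=> _ [phi h <-]; exact: bound.
rewrite ger0_norm; first by apply: ge_sup => //; eexists; exact: A0.
apply: (le_trans (normr_ge0 _)); apply: ub_le_sup A0.
by exists (e / 2 * N eta).
Qed.

(** Feasible directions are bounded, hence in L^qt, and [dS] solves the equation that defines
    [zsol]; the formulas with [dS] thus follow from the independence of the chosen solution. *)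
Lemma reduced_objective_derivatives (dS : (E -> R) -> (E -> R) -> @sob R n) :
  (forall u phi, Uad u -> Uad (u + phi) -> is_dS Omega Gt u (Y u) phi (dS u phi)) ->
  twice_frechet_feasible Omega ul uu qt j dj d2j /\
  forall u, Uad u ->
    let y := Y u in
    let p := P u in
    [/\ forall phi, Uad (u + phi) ->
          dj u phi = dF y (dS u phi) /\
          dj u phi = int_Omega Omega (fun x => phi x * edot (grad y x) (grad p x)),
        forall phi psi, Uad (u + phi) -> Uad (u + psi) ->
          d2j u phi psi = d2F y (dS u psi) (dS u phi)
            + int_Omega Omega (fun x => psi x * edot (grad (dS u phi) x) (grad p x))
            + int_Omega Omega (fun x => phi x * edot (grad (dS u psi) x) (grad p x)),
        feasible_to0 Omega ul uu qt u (fun eta =>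
          (j (u + eta) - j u - dj u eta - 2^-1 * d2j u eta eta) / N eta ^+ 2)
      & bounded_bilinear_Lp Omega qt (d2j u)].
Proof.
move=> hdS; have dSP u phi : Uad u -> Uad (u + phi) ->
    solves u (fun x => phi x *: grad (Y u) x) (dS u phi).
  move=> Uu Up; have [Hz zE] := hdS u phi Uu Up; split => // v Hv.
  by rewrite zE// weak_formE.
split=> u Uu.
  split; [exact: dj_bounded_linear|exact: d2j_bounded_bilinear|
    exact: first_order_feasible|exact: derivative_feasible].
move=> y p; split.
- by move=> phi Up; split => //; apply: dj_solves => //; exact: dSP.
- move=> phi psi Up Us.
  exact: (d2j_solves Uu (feasible_inLp qt0 Uu Up) (feasible_inLp qt0 Uu Us)
    (dSP u phi Uu Up) (dSP u psi Uu Us)).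
- exact: second_order_feasible.
- exact: d2j_bounded_bilinear.
Qed.

End objective.

End estimates.

End groger.

End Lp_domain.

(** The bound on [q] makes the denominator positive, and then the second summand of the threshold is
    at least [2 s / (s - 2)]. Hence [qt > 4 s / (s - 2)], which is the inequality between
    reciprocals. *)
Lemma exponent_condition (R : realType) (s q qt : R) : 2 < s ->
  2 * s / (s - 2) < q ->
  2 * s / (s - 2) + 2 * s * q / (q * (s - 2) - 2 * s) < qt ->
  0 < qt /\ s^-1 + 2 * qt^-1 < 2^-1.
Proof.
move=> s2 hq hqt; have d0 : 0 < s - 2 by lra.
have s0 : 0 < s by lra.
have X0 : 0 < q * (s - 2) - 2 * s by move: hq; rewrite ltr_pdivrMr// subr_gt0.
have q0 : 0 < q by apply: lt_trans hq; rewrite divr_gt0//; lra.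
have h : 2 * s / (s - 2) <= 2 * s * q / (q * (s - 2) - 2 * s).
  rewrite ler_pdivrMr// mulrAC ler_pdivlMr//; have := mulr_gt0 s0 s0; lra.
have qt4 : 4 * s < qt * (s - 2).
  have : 2 * s / (s - 2) + 2 * s / (s - 2) < qt by lra.
  rewrite -mulrDl ltr_pdivrMr//; lra.
have qt0 : 0 < qt.
  have : 0 < qt * (s - 2) by lra.
  by rewrite pmulr_lgt0.
split=> //.
have -> : s^-1 + 2 * qt^-1 = (qt + 2 * s) / (s * qt).
  by field; rewrite !gt_eqF.
by rewrite ltr_pdivrMr ?mulr_gt0//; lra.
Qed.

Theorem theorem2p19 (R : realType) (n : nat) (hd : (2 <= n.+1)%N)
  (alpha : R) (Omega Gt Gn : set 'rV[R]_n.+1)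
  (hgeo : boundary_setting alpha Omega Gt Gn)
  (ul uu : R) (hul : 0 < ul) (huu : ul <= uu)
  (hlift : lift_wellposed Omega Gt)
  (s : R) (hs : 2 < s)
  (S : (@sob R n -> R) -> ('rV[R]_n.+1 -> R) -> ('rV[R]_n.+1 -> R) -> @sob R n)
  (hS : is_solution_operator Omega Gt ul uu s S)
  (hsS : is_groger_exponent Omega Gt ul uu s S)
  (q qt : R) (hq : 2 * s / (s - 2) < q)
  (hqt : 2 * s / (s - 2) + 2 * s * q / (q * (s - 2) - 2 * s) < qt)
  (f : @sob R n -> R) (hf : Wm1p Omega Gt s f)
  (fD : 'rV[R]_n.+1 -> R) (hfD : Wbd Gt s fD)
  (F : @sob R n -> R) (dF : @sob R n -> @sob R n -> R)
  (d2F : @sob R n -> @sob R n -> @sob R n -> R)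
  (hF : frechet_C2 Omega F dF d2F)
  (hFdual : derivatives_in_dual Omega Gt dF d2F)
  (hFlip : derivatives_lipschitz Omega Gt dF d2F)
  (Sp : @sob R n -> ('rV[R]_n.+1 -> R) -> @sob R n)
  (hSp : forall y u, W1p Omega 2 y -> Uad Omega ul uu u ->
     is_adjoint Omega Gt u (dF y) (Sp y u))
  (dS : ('rV[R]_n.+1 -> R) -> ('rV[R]_n.+1 -> R) -> @sob R n)
  (hdS : forall u phi, Uad Omega ul uu u -> Uad Omega ul uu (u + phi) ->
     is_dS Omega Gt u (S f fD u) phi (dS u phi)) :
  let j := fun u => F (S f fD u) in
  exists (j1 : ('rV[R]_n.+1 -> R) -> ('rV[R]_n.+1 -> R) -> R)
         (j2 : ('rV[R]_n.+1 -> R) -> ('rV[R]_n.+1 -> R) ->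
               ('rV[R]_n.+1 -> R) -> R),
    twice_frechet_feasible Omega ul uu qt j j1 j2 /\
    forall u, Uad Omega ul uu u ->
      let y := S f fD u in
      let p := Sp y u in
      [/\ forall phi, Uad Omega ul uu (u + phi) ->
            j1 u phi = dF y (dS u phi) /\
            j1 u phi =
              int_Omega Omega (fun x => phi x * edot (grad y x) (grad p x)),
          forall phi psi,
            Uad Omega ul uu (u + phi) -> Uad Omega ul uu (u + psi) ->
            j2 u phi psi =
              d2F y (dS u psi) (dS u phi)
              + int_Omega Omega
                  (fun x => psi x * edot (grad (dS u phi) x) (grad p x))
              + int_Omega Omega
                  (fun x => phi x * edot (grad (dS u psi) x) (grad p x)),
          feasible_to0 Omega ul uu qt u (fun eta =>
            (j (u + eta) - j u - j1 u eta - 2^-1 * j2 u eta eta)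
              / normLp Omega qt eta ^+ 2)
        & bounded_bilinear_Lp Omega qt (j2 u)].
Proof.
have [[oO _ _ bO] _ _ _ _] := hgeo.
have [qt0 hexp] := exponent_condition hs hq hqt.
exists (dj Omega S f fD Sp), (d2j Omega Gt S f fD d2F Sp).
exact: (reduced_objective_derivatives oO bO hul hS hsS hs qt0 hexp huu hf hfD hF hSp hdS).
Qed.
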